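(* Let $\delta>0$. The space of traces on $\mathrm{gp}_\delta$ of functions in $H^1(\mathbb{R}^2)$ is exactly $H^{1/2}(\mathrm{gp}_\delta)$.
   Context: $H^1(\mathbb{R}^2)$ is the homogeneous Sobolev space of functions with distributional gradient in $L^2(\mathbb{R}^2)$ (modulo constants), with $\|F\|_{H^1(\mathbb{R}^2)}^2=\int|\nabla F|^2$; such functions have well-defined traces on lines. $\mathrm{gp}_\delta$ is the graph-paper metric graph with vertices $(j\delta,k\delta)$, $j,k\in\mathbb{Z}$, and horizontal and vertical edges of length $\delta$ joining $(j\delta,k\delta)$ to $((j+1)\delta,k\delta)$ and to $(j\delta,(k+1)\delta)$; the trace on $\mathrm{gp}_\delta$ is the trace on the union of these lines. $H^{1/2}(\mathrm{gp}_\delta)$ is the space of locally $L^2$ functions $f$ on $\mathrm{gp}_\delta$ (modulo constants) with finite norm $$\begin{aligned}\|f\|_{H^{1/2}(\mathrm{gp}_\delta)}^2&=\sum_{j,k}\int_0^\delta\!\!\int_0^\delta\frac{|f(j\delta+x,k\delta)-f(j\delta+y,k\delta)|^2}{|x-y|^2}dxdy+\sum_{j,k}\int_0^\delta\!\!\int_0^\delta\frac{|f(j\delta,k\delta+x)-f(j\delta,k\delta+y)|^2}{|x-y|^2}dxdy\\&+\sum_{j,k}\int_{-\delta}^\delta|f(j\delta+x,k\delta)-f(j\delta,k\delta+x)|^2\frac{dx}{|x|}+\sum_{j,k}\int_0^\delta|f(j\delta+x,k\delta)-f(j\delta-x,k\delta)|^2\frac{dx}{x}\\&+\sum_{j,k}\int_0^\delta|f(j\delta,k\delta+x)-f(j\delta,k\delta-x)|^2\frac{dx}{x}.\end{aligned}$$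 *)

(* Defs.v *)
From HB Require Import structures.
From mathcomp Require Import all_boot all_order all_algebra.
From mathcomp Require Import all_classical all_reals all_analysis.
Set Implicit Arguments. Unset Strict Implicit. Unset Printing Implicit Defensive.
Import Order.TTheory GRing.Theory Num.Theory.
Import numFieldNormedType.Exports.
Local Open Scope classical_set_scope.
Local Open Scope ring_scope.

Section Defs.
Variable R : realType.

(* points of R^2 are pairs; R^o * R^o is the normed module used for derivatives *)
Notation P2 := (R^o * R^o)%type.

Definition leb1 := (@lebesgue_measure R).
Definition leb2 := (leb1 \x leb1)%E.

Definition d1 (phi : P2 -> R^o) (x : P2) : R := 'D_(1, 0) phi x.
Definition d2 (phi : P2 -> R^o) (x : P2) : R := 'D_(0, 1) phi x.

Definition C1 (phi : P2 -> R^o) : Prop :=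
  (forall x, differentiable phi x) /\ continuous (d1 phi) /\ continuous (d2 phi).

Definition box (M : R) : set (R * R) := `[- M, M] `*` `[- M, M].

Definition test_fun (phi : P2 -> R^o) : Prop :=
  C1 phi /\ exists M : R, forall x : P2, ~ box M x -> phi x = 0.

Definition weak_gradient (F G1 G2 : P2 -> R) : Prop :=
  forall phi, test_fun phi ->
    (\int[leb2]_x (F x * d1 phi x)%:E = - \int[leb2]_x (G1 x * phi x)%:E)%E /\
    (\int[leb2]_x (F x * d2 phi x)%:E = - \int[leb2]_x (G2 x * phi x)%:E)%E.

(* F is a (representative of an) element of the homogeneous space H^1(R^2):
   F is locally integrable, with distributional gradient (G1, G2) in L^2(R^2) *)
Definition H1 (F G1 G2 : P2 -> R) : Prop :=
  [/\ measurable_fun setT F,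
      (forall M : R, leb2.-integrable (box M) (EFin \o F)),
      measurable_fun setT G1 /\ measurable_fun setT G2,
      (\int[leb2]_x ((G1 x) ^+ 2)%:E < +oo)%E /\
      (\int[leb2]_x ((G2 x) ^+ 2)%:E < +oo)%E &
      weak_gradient F G1 G2].

(* parametrisations of the edges of gp_delta:
   horizontal edge from (j d, k d) to ((j+1) d, k d), vertical edge from
   (j d, k d) to (j d, (k+1) d); t ranges over [0, d] *)
Definition hpt (d : R) (j k : int) (t : R) : P2 := (j%:~R * d + t, k%:~R * d).
Definition vpt (d : R) (j k : int) (t : R) : P2 := (j%:~R * d, k%:~R * d + t).

(* f (a function on R^2 of which only the values on gp_d matter) is
   measurable and square integrable on every edge of gp_d, i.e. locally L^2 *)
Definition gp_L2loc (d : R) (f : P2 -> R) : Prop :=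
  forall j k : int,
  [/\ measurable_fun `[0%R, d] (fun t => f (hpt d j k t)),
      measurable_fun `[0%R, d] (fun t => f (vpt d j k t)),
      (\int[leb1]_(t in `[0%R, d]) ((f (hpt d j k t)) ^+ 2)%:E < +oo)%E &
      (\int[leb1]_(t in `[0%R, d]) ((f (vpt d j k t)) ^+ 2)%:E < +oo)%E].

Definition is_trace (d : R) (F G1 G2 f : P2 -> R) : Prop :=
  gp_L2loc d f /\
  exists Fn : nat -> P2 -> R^o,
  [/\ (forall n, C1 (Fn n)),
      (forall M : R,
        (\int[leb2]_(x in box M) ((Fn n x - F x) ^+ 2)%:E)%E @[n --> \oo] --> 0%E),
      (\int[leb2]_x ((d1 (Fn n) x - G1 x) ^+ 2 + (d2 (Fn n) x - G2 x) ^+ 2)%:E)%E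
         @[n --> \oo] --> 0%E &
      forall j k : int,
        (\int[leb1]_(t in `[0%R, d])
            ((Fn n (hpt d j k t) - f (hpt d j k t)) ^+ 2)%:E)%E
           @[n --> \oo] --> 0%E /\
        (\int[leb1]_(t in `[0%R, d])
            ((Fn n (vpt d j k t) - f (vpt d j k t)) ^+ 2)%:E)%E
           @[n --> \oo] --> 0%E].

Definition gp_norm2 (d : R) (f : P2 -> R) : \bar R :=
  (\esum_(jk in [set: int * int])
     \int[leb1]_(y in `[0%R, d]) \int[leb1]_(x in `[0%R, d])
        ((f (hpt d jk.1 jk.2 x) - f (hpt d jk.1 jk.2 y)) ^+ 2 / (x - y) ^+ 2)%:E
 + \esum_(jk in [set: int * int])
     \int[leb1]_(y in `[0%R, d]) \int[leb1]_(x in `[0%R, d])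
        ((f (vpt d jk.1 jk.2 x) - f (vpt d jk.1 jk.2 y)) ^+ 2 / (x - y) ^+ 2)%:E
 + \esum_(jk in [set: int * int])
     \int[leb1]_(x in `[(- d)%R, d])
        ((f (hpt d jk.1 jk.2 x) - f (vpt d jk.1 jk.2 x)) ^+ 2 / `|x|)%:E
 + \esum_(jk in [set: int * int])
     \int[leb1]_(x in `[0%R, d])
        ((f (hpt d jk.1 jk.2 x) - f (hpt d jk.1 jk.2 (- x))) ^+ 2 / x)%:E
 + \esum_(jk in [set: int * int])
     \int[leb1]_(x in `[0%R, d])
        ((f (vpt d jk.1 jk.2 x) - f (vpt d jk.1 jk.2 (- x))) ^+ 2 / x)%:E)%E.

Definition H12 (d : R) (f : P2 -> R) : Prop :=
  gp_L2loc d f /\ (gp_norm2 d f < +oo)%E.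

End Defs.

(* Main.v *)
(** The trace of a C^1 function on gp_delta is controlled square by square: two
    points of the boundary of a square are joined by a path inside it, and Hardy's
    inequality together with Cauchy-Schwarz bounds each term of the norm by the
    Dirichlet integral of the square. Lower semicontinuity then covers all of H^1.

    Conversely, divide each edge of gp_delta into K + 1 parts of length h, replace f
    by its averages around the nodes, and extend these discrete data to the
    grid (h Z)^2: near a corner of a square the two adjacent sides form a line, and a
    node at distances k and l from them receives the average of f over a window of
    size min(k, l). The discrete H^{1/2} norm controls the sum of the squared
    differences, so C^1 interpolation gives functions of bounded energy that are
    O(1 / K)-close to f on every edge. Their near-minimizers of the energy form a
    Cauchy sequence by the parallelogram identity; its limit is an H^1 function with
    trace f. *)
Require Import Defs.
From HB Require Import structures.
From mathcomp Require Import all_boot all_order all_algebra.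
From mathcomp Require Import all_classical all_reals all_analysis.
From mathcomp Require Import measurable_realfun zify ring lra.
Set Implicit Arguments. Unset Strict Implicit. Unset Printing Implicit Defensive.
Import Order.TTheory GRing.Theory Num.Theory.
Import numFieldNormedType.Exports.
Local Open Scope classical_set_scope.
Local Open Scope ring_scope.

(** * Extension of discrete data from the boundary of a square *)

(** A function in H^{1/2} has no value at a vertex, so vertex values must be chosen; the terms
    weighted by [1 / x] keep the averages on the four arms of a vertex close to one another, which
    makes the choice harmless. In each square the data are reduced by the mean [m] of the bottom
    side and cut off linearly, so that the four corner constructions add up to the right boundary
    values. The cutoff costs the squared distance to [m]: a discrete Poincare inequality bounds it
    on the bottom side, and the corner terms carry the bound to the other sides.

    A trace is defined through strong convergence of gradients in L^2, whereas the extensions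
    obtained for growing [K] are only bounded in energy. Minimization replaces weak compactness: the
    constraint is convex and the energy quadratic, so near-minimizers converge strongly, at a
    geometric rate. The energy does not see additive constants; the values converge because the
    traces on the axis [y = 0] do, through a Poincare inequality. Only finiteness matters, so the
    factors lost in lower semicontinuity and in the discrete estimates are harmless. *)

Section discrete_windows.
Context {R : realFieldType}.
Implicit Types (b : nat -> R).

(** The energy comparisons below have this form: the indices of one sum are sent injectively into
    those of a larger sum of nonnegative terms. *)
Lemma ler_sum_inj (I J : finType) (P : pred I) (Q : pred J) (f : I -> J) (h : J -> R) :
  {in P &, injective f} -> (forall i, P i -> Q (f i)) -> (forall j, Q j -> 0 <= h j) ->
  \sum_(i | P i) h (f i) <= \sum_(j | Q j) h j.
Proof.
move=> finj PQ h0.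
rewrite -(big_imset (h := f) (A := [pred i | P i]) h)/=; last by move=> x y Px Py; exact: finj.
rewrite [leRHS](bigID (mem (f @: [pred i | P i])))/=.
rewrite -[leLHS]addr0; apply: lerD; last by apply: sumr_ge0 => j /andP[Qj _]; exact: h0.
rewrite le_eqVlt; apply/orP; left; apply/eqP; apply: eq_bigl => j.
case: (boolP (j \in _)) => jA; rewrite ?andbT ?andbF//.
by case/imsetP: jA => i Pi ->; rewrite PQ.
Qed.

(** Jensen's inequality for the square; it is the nonnegativity of the variance of the numbers
    [x - a t], whose mean is [D]. *)
Lemma sqr_mean_le n (x : R) (a : nat -> R) : (0 < n)%N ->
  (x - n%:R^-1 * \sum_(t < n) a t) ^+ 2 <= n%:R^-1 * \sum_(t < n) (x - a t) ^+ 2.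
Proof.
move=> n0; have n0R : (0 : R) < n%:R by rewrite ltr0n.
pose D := x - n%:R^-1 * \sum_(t < n) a t.
have sD : \sum_(t < n) (x - a t) = n%:R * D.
  rewrite sumrB sumr_const card_ord mulrBr mulrA divff ?gt_eqF// mul1r.
  by rewrite mulr_natl.
have : 0 <= \sum_(t < n) (x - a t - D) ^+ 2 by apply: sumr_ge0 => t _; exact: sqr_ge0.
have -> : \sum_(t < n) (x - a t - D) ^+ 2 =
    \sum_(t < n) (x - a t) ^+ 2 - (D *+ 2) * \sum_(t < n) (x - a t) + n%:R * D ^+ 2.
  rewrite mulr_sumr -sumrB mulr_natl -[X in _ + _ *+ X](card_ord n) -sumr_const -big_split/=.
  by apply: eq_bigr => t _; ring.
rewrite sD -/D => h.
rewrite mulrC ler_pdivlMr//.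
have -> : D ^+ 2 * n%:R = n%:R * D ^+ 2 by ring.
move: h; rewrite (_ : _ - _ + _ = \sum_(t < n) (x - a t) ^+ 2 - n%:R * D ^+ 2); last by ring.
by rewrite subr_ge0.
Qed.

(* The discrete H^{1/2} seminorm; its diagonal terms are 0 / 0 = 0. *)
Definition Hs b (M : nat) : R :=
  \sum_(p : 'I_M * 'I_M) (b p.1 - b p.2) ^+ 2 / (p.1%:R - p.2%:R) ^+ 2.

Definition wmean b (s n : nat) : R := n%:R^-1 * \sum_(t < n) b (s + t)%N.

Lemma Hs_ge0 b M : 0 <= Hs b M.
Proof. by apply: sumr_ge0 => p _; rewrite divr_ge0 ?sqr_ge0. Qed.

Lemma wmean_shift b s n : wmean b s.+1 n - wmean b s n = (b (s + n)%N - b s) / n%:R.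
Proof.
rewrite /wmean -mulrBr mulrC; congr (_ / _).
have : \sum_(t < n.+1) b (s + t)%N = \sum_(t < n.+1) b (s + t)%N by [].
rewrite {1}big_ord_recl/= big_ord_recr/= addn0.
under eq_bigr do rewrite /bump/= add1n -addSnnS.
by move=> h; apply/eqP; rewrite subr_eq -(inj_eq (addrI (b s))) h; apply/eqP; ring.
Qed.

Lemma wmean_grow b s n : (0 < n)%N ->
  wmean b s n.+1 - wmean b s n = (b (s + n)%N - wmean b s n) / n.+1%:R.
Proof.
move=> n0; rewrite /wmean big_ord_recr/=.
have n0R : n%:R != 0 :> R by rewrite pnatr_eq0 -lt0n.
have n1R : n.+1%:R != 0 :> R by rewrite pnatr_eq0.
rewrite -natr1 in n1R *; field; exact/andP.
Qed.

Lemma sum_inv_sqr_le (d M : nat) : (0 < d)%N ->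
  \sum_(t < M) ((d + t)%:R ^+ 2)^-1 <= 2 / d%:R :> R.
Proof.
(* Telescoping: for [x >= 1], [2 / x - 2 / (x + 1)] exceeds [1 / x ^ 2] by
   [(x - 1) / (x ^ 2 * (x + 1))]. *)
move=> d0; suff : \sum_(t < M) ((d + t)%:R ^+ 2)^-1 <= 2 / d%:R - 2 / (d + M)%:R :> R.
  by move=> /le_trans; apply; rewrite gerBl divr_ge0.
elim: M => [|M IH]; first by rewrite big_ord0 addn0 subrr.
rewrite big_ord_recr/= (le_trans (lerD IH (lexx _)))// addnS.
have x1 : (1 : R) <= (d + M)%:R by rewrite ler1n addn_gt0 d0.
rewrite -natr1; set x := (d + M)%:R in x1 *.
rewrite -addrA lerD2l -subr_ge0 (_ : _ - _ = (x - 1) / (x ^+ 2 * (x + 1))); last first.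
  by field; apply/andP; split; lra.
by rewrite divr_ge0 ?mulr_ge0 ?sqr_ge0//; lra.
Qed.

Lemma sum_inv_cube_le (d M : nat) : (0 < d)%N ->
  \sum_(t < M) ((d + t)%:R ^+ 3)^-1 <= 2 / d%:R ^+ 2 :> R.
Proof.
move=> d0; have d0R : (0 : R) < d%:R by rewrite ltr0n.
apply: (@le_trans _ _ (\sum_(t < M) (d%:R^-1 * ((d + t)%:R ^+ 2)^-1))).
  apply: ler_sum => t _; have x0 : (0 : R) < (d + t)%:R by rewrite ltr0n addn_gt0 d0.
  rewrite -invfM lef_pV2 ?posrE ?mulr_gt0 ?exprn_gt0//.
  by rewrite [leRHS]exprS ler_pM2r ?exprn_gt0// ler_nat leq_addr.
rewrite -mulr_sumr mulrC ler_pdivrMr// (le_trans (sum_inv_sqr_le M d0))//.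
by rewrite [leRHS](_ : _ = 2 / d%:R)//; field; rewrite gt_eqF.
Qed.

Let ord_pair_inj M (x y : 'I_M * 'I_M) : (x.1 = y.1 :> nat) -> (x.2 = y.2 :> nat) -> x = y.
Proof. by case: x y => [a b] [c d] /= h1 h2; congr pair; exact: val_inj. Qed.

(** Sliding a window of width [n] by one node exchanges one end for the other, so each squared
    increment is exactly the term of [Hs] at the pair [(s, s + n)], and each pair arises once. *)
Lemma sum_shift_energy b M :
  \sum_(p : 'I_M * 'I_M | (0 < p.2)%N && (p.1 + p.2 < M)%N)
    (wmean b p.1.+1 p.2 - wmean b p.1 p.2) ^+ 2 <= Hs b M.
Proof.
case: M => [|M]; first by rewrite big1 ?Hs_ge0// => -[[]].
pose f (p : 'I_M.+1 * 'I_M.+1) : 'I_M.+1 * 'I_M.+1 := (p.1, inord (p.1 + p.2)).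
pose h (q : 'I_M.+1 * 'I_M.+1) := (b q.1 - b q.2) ^+ 2 / (q.1%:R - q.2%:R) ^+ 2.
have -> : \sum_(p : 'I_M.+1 * 'I_M.+1 | (0 < p.2)%N && (p.1 + p.2 < M.+1)%N)
    (wmean b p.1.+1 p.2 - wmean b p.1 p.2) ^+ 2 =
    \sum_(p : 'I_M.+1 * 'I_M.+1 | (0 < p.2)%N && (p.1 + p.2 < M.+1)%N) h (f p).
  apply: eq_bigr => p /andP[p0 pM]; rewrite wmean_shift /h /f /= inordK// natrD.
  rewrite opprD addNKr sqrrN expr_div_n -[in LHS](opprB (b p.1)) sqrrN//.
apply: (@ler_sum_inj _ _ _ predT f h) => //.
- move=> x y /andP[_ xM] /andP[_ yM] /(congr1 (fun z => (nat_of_ord z.1, nat_of_ord z.2))).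
  by rewrite /f /= !inordK// => -[e1 e2]; apply: ord_pair_inj; lia.
- by move=> q _; rewrite /h divr_ge0 ?sqr_ge0.
Qed.

(** By Jensen the increment at width [n] costs [n ^- 3] times the squared differences between the
    new node and the old ones. For two fixed nodes at distance [e], the windows that pair them have
    widths [e + t], and the sum of [(e + t) ^- 3] is at most [2 / e ^ 2], twice the weight in
    [Hs]. *)
Lemma sum_grow_energy b M :
  \sum_(p : 'I_M * 'I_M | (0 < p.2)%N && (p.1 + p.2 < M)%N)
    (wmean b p.1 p.2.+1 - wmean b p.1 p.2) ^+ 2 <= 2 * Hs b M.
Proof.
case: M => [|M]; first by rewrite big1 ?mulr_ge0 ?Hs_ge0// => -[[]].
pose T := ('I_M.+1 * 'I_M.+1)%type.
pose P := [pred p : T | (0 < p.2)%N && (p.1 + p.2 < M.+1)%N].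
pose h (q : T * 'I_M.+1) : R :=
  (b q.1.2 - b q.1.1) ^+ 2 / ((q.1.2 - q.1.1) + q.2)%N%:R ^+ 3.
pose f (q : T * 'I_M.+1) : T * 'I_M.+1 := ((inord (q.1.1 + q.2), inord (q.1.1 + q.1.2)), q.2).
apply: (@le_trans _ _ (\sum_(q : T * 'I_M.+1 | P q.1 && (q.2 < q.1.2)%N) h (f q))).
  rewrite -(pair_big_dep P (fun p (t : 'I_M.+1) => (t < p.2)%N) (fun p t => h (f (p, t))))/=.
  apply: ler_sum => p /andP[p0 pM]; rewrite wmean_grow// expr_div_n.
  have n0 : (0 : R) < p.2%:R by rewrite ltr0n.
  have J := sqr_mean_le (b (p.1 + p.2)%N) (fun t => b (p.1 + t)%N) p0.
  apply: (@le_trans _ _ ((p.2%:R ^+ 3)^-1 * \sum_(t < p.2) (b (p.1 + p.2)%N - b (p.1 + t)%N) ^+ 2)).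
    rewrite ler_pdivrMr ?exprn_gt0 ?ltr0n// (le_trans J)//.
    rewrite mulrAC ler_wpM2r//; first by apply: sumr_ge0 => t _; exact: sqr_ge0.
    rewrite -natr1 -subr_ge0 (_ : _ - _ = (p.2%:R *+ 2 + 1) / p.2%:R ^+ 3); last first.
      by field; rewrite gt_eqF.
    by rewrite divr_ge0 ?exprn_ge0//; lra.
  rewrite mulr_sumr le_eqVlt; apply/orP; left; apply/eqP.
  have pM' : (p.2 <= M.+1)%N by exact: ltnW (ltn_ord _).
  rewrite (big_ord_widen _ (fun t => (p.2%:R ^+ 3)^-1 * (b (p.1 + p.2)%N - b (p.1 + t)%N) ^+ 2) pM').
  apply: eq_bigr => t tp; rewrite /h /f /= !inordK//; last by lia.
  by rewrite mulrC; congr (_ / _%:R ^+ 3); lia.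
apply: (@le_trans _ _ (\sum_(q : T * 'I_M.+1 | (q.1.1 < q.1.2)%N) h q)).
  apply: ler_sum_inj => //.
  - move=> [[x1 x2] x3] [[y1 y2] y3] /andP[/andP[_ /= xM] /= xt] /andP[/andP[_ /= yM] /= yt].
    move=> /(congr1 (fun z => (nat_of_ord z.1.1, nat_of_ord z.1.2, nat_of_ord z.2))).
    rewrite /f /= !inordK//; [|lia..] => -[e1 e2 e3].
    by congr (_, _, _); apply: val_inj => /=; lia.
  - by move=> [[x1 x2] x3] /andP[/andP[_ /= xM] /= xt]; rewrite /f /= !inordK//; lia.
  - by move=> q _; rewrite /h divr_ge0 ?sqr_ge0// exprn_ge0.
have -> : \sum_(q : T * 'I_M.+1 | (q.1.1 < q.1.2)%N) h q =
    \sum_(p : T | (p.1 < p.2)%N) \sum_(t < M.+1) h (p, t).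
  by rewrite pair_big_dep/=; apply: eq_big => [q|[p t] _//]; rewrite andbT.
rewrite mulr_sumr.
rewrite [leRHS](bigID (fun p : T => (p.1 < p.2)%N))/= -[leLHS]addr0.
apply: lerD; last by apply: sumr_ge0 => p _; rewrite mulr_ge0// divr_ge0 ?sqr_ge0.
apply: ler_sum => p p12; rewrite /h /= -mulr_sumr.
have d0 : (0 < p.2 - p.1)%N by rewrite subn_gt0.
rewrite (_ : 2 * _ = (b p.2 - b p.1) ^+ 2 * (2 / (p.2 - p.1)%N%:R ^+ 2)); last first.
  rewrite natrB ?(ltnW p12)//; rewrite -(sqrrN (b p.1 - _)) opprB -(sqrrN (p.1%:R - _)) opprB; ring.
by rewrite ler_wpM2l ?sqr_ge0// sum_inv_cube_le.
Qed.

(** For a fixed width [n] a node lies in at most [n] windows, which cancels the [1 / n] of Jensen's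
    inequality; the factor [M] counts the widths. *)
Lemma sum_mean_le b M (m : R) :
  \sum_(p : 'I_M * 'I_M | (0 < p.2)%N && (p.1 + p.2 <= M)%N) (wmean b p.1 p.2 - m) ^+ 2 <=
  M%:R * \sum_(i < M) (b i - m) ^+ 2.
Proof.
case: M => [|M]; first by rewrite big1 ?big_ord0 ?mulr0// => -[[]].
rewrite -(pair_big_dep predT (fun s n : 'I_M.+1 => (0 < n)%N && (s + n <= M.+1)%N)
  (fun s n => (wmean b s n - m) ^+ 2))/=.
rewrite (exchange_big_dep predT)//=.
have -> : M.+1%:R * (\sum_(i < M.+1) (b i - m) ^+ 2) = \sum_(n < M.+1) \sum_(i < M.+1) (b i - m) ^+ 2.
  by rewrite sumr_const card_ord mulr_natl.
apply: ler_sum => n _.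
have [n0|n0] := posnP n.
  rewrite big_pred0; last by move=> s; rewrite n0.
  by apply: sumr_ge0 => i _; exact: sqr_ge0.
have n0R : (0 : R) < n%:R by rewrite ltr0n.
apply: (@le_trans _ _ (\sum_(s < M.+1 | (s + n <= M.+1)%N) \sum_(t < n) n%:R^-1 * (b (s + t)%N - m) ^+ 2)).
  apply: ler_sum => s _; rewrite -mulr_sumr -(sqrrN (_ - m)) opprB.
  apply: (le_trans (sqr_mean_le m (fun t => b (s + t)%N) n0)).
  by rewrite le_eqVlt; apply/orP; left; apply/eqP; congr (_ * _); apply: eq_bigr => t _; rewrite -sqrrN opprB.
rewrite exchange_big/=.
apply: (@le_trans _ _ (\sum_(t < n) n%:R^-1 * \sum_(i < M.+1) (b i - m) ^+ 2)).
  apply: ler_sum => t _; rewrite -mulr_sumr ler_wpM2l ?invr_ge0//.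
  pose h (i : 'I_M.+1) := (b i - m) ^+ 2.
  rewrite (eq_bigr (fun s : 'I_M.+1 => h (inord (s + t)))); last first.
    by move=> s sn; rewrite /h inordK//; have := ltn_ord t; lia.
  apply: (@ler_sum_inj _ _ _ predT (fun s : 'I_M.+1 => inord (s + t)) h) => //.
  - move=> x y; rewrite !unfold_in => xn yn /(congr1 (@nat_of_ord _)).
    have tn := ltn_ord t.
    rewrite !inordK; [|lia..] => /addIn xy; exact: val_inj.
  - by move=> i _; exact: sqr_ge0.
by rewrite sumr_const card_ord -[X in X <= _]mulr_natl mulrA divff ?gt_eqF// mul1r.
Qed.

Lemma wmean_rev b K s n : (s + n <= K)%N ->
  wmean (fun i => b (K - i.+1)%N) s n = wmean b (K - s - n) n.
Proof.
move=> snK; rewrite /wmean; congr (_ * _).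
rewrite (reindex_inj rev_ord_inj)/=; apply: eq_bigr => t _; congr b.
by have := ltn_ord t; lia.
Qed.

(* The triangle k + l <= K is folded onto a half plane: the point (k, l) is sent
   to the window of 2 min(k, l) + 1 nodes whose middle node is K + k - l, so that
   (k, 0) sees the node K + k only and (0, l) sees the node K - l only. *)
Definition fold b (K k l : nat) : R := wmean b (K - l + (k - l)) (minn k l).*2.+1.

Lemma fold_bottom b K k : fold b K k 0 = b (K + k)%N.
Proof. by rewrite /fold minn0 /wmean big_ord1 invr1 mul1r; congr b => /=; lia. Qed.

Lemma fold_left b K l : fold b K 0 l = b (K - l)%N.
Proof. by rewrite /fold min0n /wmean big_ord1 invr1 mul1r; congr b => /=; lia. Qed.

(** For [l <= k] a step in [k] slides the window by one node. For [k < l] it widens the window by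
    two nodes with its left end fixed, that is by two growth steps at widths [2 k + 1] and
    [2 k + 2]; these have different parities, so each of the two families is summed separately. The
    constant is generous. *)
Lemma fold_horizontal b K :
  \sum_(p : 'I_K.+1 * 'I_K.+1 | (p.1 + p.2 < K)%N)
    (fold b K p.1.+1 p.2 - fold b K p.1 p.2) ^+ 2 <= 17 * Hs b K.*2.+1.
Proof.
pose M := K.*2.+1; pose T := ('I_M * 'I_M)%type.
pose P (p : 'I_K.+1 * 'I_K.+1) := (p.1 + p.2 < K)%N.
pose Q (p : T) := (0 < p.2)%N && (p.1 + p.2 < M)%N.
pose A (p : T) := (wmean b p.1.+1 p.2 - wmean b p.1 p.2) ^+ 2.
pose B (p : T) := (wmean b p.1 p.2.+1 - wmean b p.1 p.2) ^+ 2.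
pose f1 (p : 'I_K.+1 * 'I_K.+1) : T := (inord (K - p.2 + (p.1 - p.2)), inord p.2.*2.+1).
pose f2 (p : 'I_K.+1 * 'I_K.+1) : T := (inord (K - p.2), inord p.1.*2.+1).
pose f3 (p : 'I_K.+1 * 'I_K.+1) : T := (inord (K - p.2), inord p.1.*2.+2).
have inj (f : 'I_K.+1 * 'I_K.+1 -> T) (D : pred ('I_K.+1 * 'I_K.+1)) :
    (forall x y, D x -> D y -> (f x).1 = (f y).1 :> nat -> (f x).2 = (f y).2 :> nat ->
      x.1 = y.1 :> nat /\ x.2 = y.2 :> nat) -> {in D &, injective f}.
  move=> H x y Dx Dy fxy; have [] := H x y Dx Dy; rewrite ?fxy// => e1 e2.
  exact: ord_pair_inj.
rewrite (bigID (fun p : 'I_K.+1 * 'I_K.+1 => (p.2 <= p.1)%N))/=.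
have -> : 17 * Hs b M = Hs b M + 16 * Hs b M by ring.
apply: lerD.
  apply: le_trans (sum_shift_energy b M).
  rewrite (eq_bigr (fun p => A (f1 p))); last first.
    move=> [k l] /= /andP[klK lk]; rewrite /A /f1 /= !inordK; [|rewrite /M; lia..].
    rewrite /fold (minn_idPr lk) (minn_idPr (leqW lk)).
    by congr ((wmean _ _ _ - _) ^+ 2); lia.
  apply: (@ler_sum_inj _ _ _ Q f1 A).
  - apply: inj => -[k l] [k' l'] /andP[/= c1 c2] /andP[/= c3 c4].
    by rewrite /f1 /= !inordK; [lia|rewrite /M; lia..].
  - move=> [k l] /andP[/= c1 c2]; rewrite /Q /f1 /= !inordK; rewrite /M; lia.
  - by move=> p _; exact: sqr_ge0.
have F2 : \sum_(p : 'I_K.+1 * 'I_K.+1 | P p && ~~ (p.2 <= p.1)%N) B (f2 p) <= 2 * Hs b M.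
  apply: le_trans (sum_grow_energy b M); apply: (@ler_sum_inj _ _ _ Q f2 B).
  - apply: inj => -[k l] [k' l'] /andP[/= c1 c2] /andP[/= c3 c4]; rewrite /P /= in c1 c3.
    by rewrite /f2 /= !inordK; [lia|rewrite /M; lia..].
  - move=> [k l] /andP[/= c1 c2]; rewrite /P /= in c1; rewrite /Q /f2 /= !inordK; rewrite /M; lia.
  - by move=> p _; exact: sqr_ge0.
have F3 : \sum_(p : 'I_K.+1 * 'I_K.+1 | P p && ~~ (p.2 <= p.1)%N) B (f3 p) <= 2 * Hs b M.
  apply: le_trans (sum_grow_energy b M); apply: (@ler_sum_inj _ _ _ Q f3 B).
  - apply: inj => -[k l] [k' l'] /andP[/= c1 c2] /andP[/= c3 c4]; rewrite /P /= in c1 c3.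
    by rewrite /f3 /= !inordK; [lia|rewrite /M; lia..].
  - move=> [k l] /andP[/= c1 c2]; rewrite /P /= in c1; rewrite /Q /f3 /= !inordK; rewrite /M; lia.
  - by move=> p _; exact: sqr_ge0.
apply: (@le_trans _ _ (\sum_(p : 'I_K.+1 * 'I_K.+1 | P p && ~~ (p.2 <= p.1)%N) 2 * (B (f2 p) + B (f3 p)))).
  apply: ler_sum => -[k l] /= /andP[klK lk]; rewrite -ltnNge in lk.
  rewrite /B /f2 /f3 /= !inordK; [|rewrite /M; lia..].
  rewrite /fold (minn_idPl (ltnW lk)) (minn_idPl lk).
  have -> : (K - l + (k - l) = K - l)%N by lia.
  have -> : (K - l + (k.+1 - l) = K - l)%N by lia.
  rewrite doubleS; set a := wmean _ _ _; set c := wmean _ _ _; set e := wmean _ _ _.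
  by rewrite -subr_ge0 (_ : _ - _ = (a + c - e *+ 2) ^+ 2) ?sqr_ge0//; ring.
rewrite -mulr_sumr big_split/=.
have := Hs_ge0 b M; set H := Hs b M in F2 F3 * => H0; lra.
Qed.

End discrete_windows.

Section discrete_square.
Context {R : realFieldType}.
Implicit Types (b c x : nat -> R).

Lemma Hs_rev b K : Hs (fun i => b (K - i.+1)%N) K = Hs b K.
Proof.
have inj : injective (fun p : 'I_K * 'I_K => (rev_ord p.1, rev_ord p.2)).
  move=> [x1 x2] [y1 y2] h; have h1 := congr1 fst h; have h2 := congr1 snd h.
  by congr pair; exact: rev_ord_inj.
rewrite /Hs [RHS](reindex_inj inj)/=; apply: eq_bigr => p _; congr (_ / _).
have h1 := ltn_ord p.1; have h2 := ltn_ord p.2.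
by rewrite !natrB//; rewrite -(natr1 p.1) -(natr1 p.2) -sqrrN; congr (_ ^+ 2); ring.
Qed.

Lemma fold_rev b K k l : (k <= K)%N -> (l <= K)%N ->
  fold (fun i => b (K.*2.+1 - i.+1)%N) K k l = fold b K l k.
Proof.
move=> kK lK; rewrite /fold wmean_rev; last by lia.
by rewrite minnC; congr wmean; lia.
Qed.

(** Reversing [b] exchanges the two legs of the triangle and preserves [Hs], which turns vertical
    differences into horizontal ones. *)
Lemma fold_vertical b K :
  \sum_(p : 'I_K.+1 * 'I_K.+1 | (p.1 + p.2 < K)%N)
    (fold b K p.1 p.2.+1 - fold b K p.1 p.2) ^+ 2 <= 17 * Hs b K.*2.+1.
Proof.
rewrite -Hs_rev; apply: le_trans (fold_horizontal _ K).
have inj : injective (fun p : 'I_K.+1 * 'I_K.+1 => (p.2, p.1)) by move=> [? ?] [? ?] [-> ->].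
rewrite (reindex_inj inj)/= le_eqVlt; apply/orP; left; apply/eqP.
apply: eq_big => [p|p pK]; first by rewrite addnC.
by rewrite !fold_rev//; lia.
Qed.

(** Distinct points of the triangle receive distinct windows, so this is part of the sum in
    [sum_mean_le]. *)
Lemma fold_mean b K (m : R) : (0 < K)%N ->
  \sum_(p : 'I_K.+1 * 'I_K.+1 | (p.1 + p.2 <= K)%N) (fold b K p.1 p.2 - m) ^+ 2 <=
  K.*2.+1%:R * \sum_(i < K.*2.+1) (b i - m) ^+ 2.
Proof.
move=> K0; apply: le_trans (sum_mean_le b _ m).
pose M := K.*2.+1.
pose f (p : 'I_K.+1 * 'I_K.+1) : 'I_M * 'I_M :=
  (inord (K - p.2 + (p.1 - p.2)), inord (minn p.1 p.2).*2.+1).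
pose h (q : 'I_M * 'I_M) := (wmean b q.1 q.2 - m) ^+ 2.
rewrite (eq_bigr (fun p => h (f p))); last first.
  by move=> [k l] /= kl; rewrite /h /f /= !inordK// /M; lia.
apply: (@ler_sum_inj _ _ _ _ _ f h).
- move=> [k l] [k' l']; rewrite !unfold_in /= => c1 c2.
  move=> /(congr1 (fun z => (nat_of_ord z.1, nat_of_ord z.2))).
  rewrite /f /= !inordK; [|rewrite /M; lia..] => -[e1 e2].
  by congr pair; apply: val_inj => /=; lia.
- by move=> [k l] /= c1; rewrite /f /= !inordK; rewrite /M; lia.
- by move=> q _; exact: sqr_ge0.
Qed.

(* The cutoff is linear along both legs of the triangle and makes the function
   vanish on the two opposite sides of the square. *)
Definition tri b (K : nat) (m : R) (k l : nat) : R :=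
  (K.+1 - (k + l))%N%:R / K.+1%:R * (fold b K k l - m).

Lemma tri_out b K m k l : (K < k + l)%N -> tri b K m k l = 0.
Proof. by move=> kl; rewrite /tri (_ : (_ - _ = 0)%N) ?mul0r//; lia. Qed.

(** Discrete product rule: the cutoff drops by [1 / (K + 1)] per step, so the increment is
    [w (a - e) - e / (K + 1)]. On the last diagonal [k + l = K] the new weight [w] is 0 and the
    difference term disappears. *)
Let step_le (K k l : nat) (a e : R) : (k + l <= K)%N ->
  ((K.+1 - (k + l).+1)%N%:R / K.+1%:R * a - (K.+1 - (k + l))%N%:R / K.+1%:R * e) ^+ 2 <=
  (if (k + l < K)%N then 2 * (a - e) ^+ 2 else 0) + 2 / K.+1%:R ^+ 2 * e ^+ 2.
Proof.
move=> kl; have N0 : (0 : R) < K.+1%:R by rewrite ltr0n.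
have -> : (K.+1 - (k + l))%N%:R = (K.+1 - (k + l).+1)%N%:R + 1 :> R.
  by rewrite natr1; congr _%:R; lia.
set w := (K.+1 - _)%N%:R / K.+1%:R.
have w0 : 0 <= w by rewrite divr_ge0.
have w1 : w <= 1 by rewrite ler_pdivrMr// mul1r ler_nat leq_subr.
have -> : ((K.+1 - (k + l).+1)%N%:R + 1) / K.+1%:R = w + K.+1%:R^-1 by rewrite mulrDl mul1r.
set u := K.+1%:R^-1.
have -> : 2 / K.+1%:R ^+ 2 * e ^+ 2 = 2 * (u * e) ^+ 2.
  rewrite /u [in RHS]exprMn exprVn -mulrA; reflexivity.
apply: (@le_trans _ _ (2 * (w * (a - e)) ^+ 2 + 2 * (u * e) ^+ 2)).
  by rewrite -subr_ge0 (_ : _ - _ = (w * (a - e) + u * e) ^+ 2) ?sqr_ge0//; ring.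
rewrite lerD2r; case: ifPn => klK; last first.
  by rewrite /w (_ : (_ - _ = 0)%N) ?mul0r ?mul0r ?expr0n ?mulr0//; lia.
rewrite ler_pM2l// exprMn ler_piMl ?sqr_ge0//.
by rewrite expr_le1.
Qed.

Definition mass b (M : nat) (m : R) : R := \sum_(i < M) (b i - m) ^+ 2.

Lemma mass_ge0 b M m : 0 <= mass b M m.
Proof. by apply: sumr_ge0 => i _; exact: sqr_ge0. Qed.

Let tri_sum_le K (F G H : nat -> nat -> R) (u : R) :
  (forall k l, (K < k + l)%N -> F k l = 0) ->
  (forall k l, (k + l <= K)%N -> F k l <= (if (k + l < K)%N then 2 * G k l else 0) + u * H k l) ->
  \sum_(p : 'I_K.+1 * 'I_K.+1) F p.1 p.2 <=
  2 * (\sum_(p : 'I_K.+1 * 'I_K.+1 | (p.1 + p.2 < K)%N) G p.1 p.2) +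
  u * (\sum_(p : 'I_K.+1 * 'I_K.+1 | (p.1 + p.2 <= K)%N) H p.1 p.2).
Proof.
move=> F0 FG.
rewrite (bigID (fun p : 'I_K.+1 * 'I_K.+1 => (p.1 + p.2 <= K)%N))/= [X in _ + X]big1 ?addr0; last first.
  by move=> p; rewrite -ltnNge => /F0.
rewrite !mulr_sumr [X in _ <= X + _]big_mkcond [X in _ <= X + _](bigID (fun p : 'I_K.+1 * 'I_K.+1 => (p.1 + p.2 <= K)%N))/=.
rewrite [X in _ <= _ + X + _]big1 ?addr0; last first.
  by move=> p; rewrite -ltnNge => h; rewrite ifF//; apply/negbTE; rewrite -leqNgt; exact: ltnW.
by rewrite -big_split/=; apply: ler_sum => p pK; exact: FG.
Qed.

Let tri_const (K : nat) (s t u v : R) : 0 <= v -> s <= 17 * t -> u <= K.*2.+1%:R * v ->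
  2 * s + 2 / K.+1%:R ^+ 2 * u <= 34 * t + 4 / K.+1%:R * v.
Proof.
move=> v0 st uv; have N0 : (0 : R) < K.+1%:R by rewrite ltr0n.
apply: lerD; first by rewrite (le_trans (ler_wpM2l _ st))// mulrA -natrM.
rewrite (le_trans (ler_wpM2l _ uv)) ?divr_ge0 ?sqr_ge0// mulrA ler_wpM2r//.
have -> : 4 / K.+1%:R = 2 / K.+1%:R ^+ 2 * (2 * K.+1%:R) :> R.
  by move: (K.+1%:R : R) N0 => x x0; field; rewrite gt_eqF.
by rewrite ler_wpM2l ?divr_ge0 ?sqr_ge0// -natrM ler_nat; lia.
Qed.

Lemma tri_horizontal b K m : (0 < K)%N ->
  \sum_(k < K.+1) \sum_(l < K.+2) (tri b K m k.+1 l - tri b K m k l) ^+ 2 <=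
  34 * Hs b K.*2.+1 + 4 / K.+1%:R * mass b K.*2.+1 m.
Proof.
move=> K0.
have -> : \sum_(k < K.+1) \sum_(l < K.+2) (tri b K m k.+1 l - tri b K m k l) ^+ 2 =
    \sum_(k < K.+1) \sum_(l < K.+1) (tri b K m k.+1 l - tri b K m k l) ^+ 2.
  by apply: eq_bigr => k _; rewrite big_ord_recr/= !tri_out ?subr0 ?expr0n/= ?addr0//; lia.
rewrite pair_big/=.
apply: le_trans (tri_const (mass_ge0 _ _ _) (fold_horizontal b K) (fold_mean b m K0)).
apply: (tri_sum_le (F := fun k l => (tri b K m k.+1 l - tri b K m k l) ^+ 2)
  (G := fun k l => (fold b K k.+1 l - fold b K k l) ^+ 2) (H := fun k l => (fold b K k l - m) ^+ 2)).
- by move=> k l kl; rewrite !tri_out ?subr0 ?expr0n//; lia.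
- move=> k l kl; have := step_le (fold b K k.+1 l - m) (fold b K k l - m) kl.
  by rewrite /tri addSn (_ : _ - m - (_ - m) = fold b K k.+1 l - fold b K k l)//; ring.
Qed.

Lemma tri_vertical b K m : (0 < K)%N ->
  \sum_(k < K.+2) \sum_(l < K.+1) (tri b K m k l.+1 - tri b K m k l) ^+ 2 <=
  34 * Hs b K.*2.+1 + 4 / K.+1%:R * mass b K.*2.+1 m.
Proof.
move=> K0; rewrite big_ord_recr/= [X in _ + X]big1 ?addr0; last first.
  by move=> l _; rewrite !tri_out ?subr0 ?expr0n//; lia.
rewrite pair_big/=.
apply: le_trans (tri_const (mass_ge0 _ _ _) (fold_vertical b K) (fold_mean b m K0)).
apply: (tri_sum_le (F := fun k l => (tri b K m k l.+1 - tri b K m k l) ^+ 2)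
  (G := fun k l => (fold b K k l.+1 - fold b K k l) ^+ 2) (H := fun k l => (fold b K k l - m) ^+ 2)).
- by move=> k l kl; rewrite !tri_out ?subr0 ?expr0n//; lia.
- move=> k l kl; have := step_le (fold b K k l.+1 - m) (fold b K k l - m) kl.
  by rewrite /tri addnS (_ : _ - m - (_ - m) = fold b K k l.+1 - fold b K k l)//; ring.
Qed.

(* Two adjacent sides of the square laid on a line, with the common corner at K. *)
Definition loop b c (K i : nat) : R := if (i < K)%N then c (K - i)%N else b (i - K)%N.

Lemma loop_bottom b c K k : loop b c K (K + k) = b k.
Proof. by rewrite /loop ltnNge leq_addr/= addKn. Qed.

Lemma loop_left b c K l : b 0%N = c 0%N -> (l <= K)%N -> loop b c K (K - l) = c l.
Proof.
move=> bc lK; rewrite /loop; case: ltnP => h; first by congr c; lia.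
by have -> : l = 0%N by [lia]; rewrite subn0 subnn bc.
Qed.

(** Discrete form of the corner term, the integral of [|f(x, 0) - f(0, x)| ^ 2 / x]; the mesh size
    cancels between [dx] and [x]. *)
Definition Kc b c (K : nat) : R := \sum_(q < K) (b q.+1 - c q.+1) ^+ 2 / q.+1%:R.

Lemma loop_split K (F : nat -> R) :
  \sum_(i < K.*2.+1) F i = \sum_(q < K) F (K - q.+1)%N + \sum_(p < K.+1) F (K + p)%N.
Proof.
have -> : K.*2.+1 = (K + K.+1)%N by rewrite -addnn addnS.
by rewrite big_split_ord/=; congr (_ + _); rewrite (reindex_inj rev_ord_inj).
Qed.

Lemma loop_side b c K q : (q < K)%N -> loop b c K (K - q.+1) = c q.+1.
Proof. by move=> qK; rewrite /loop ifT; [congr c|]; lia. Qed.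

Lemma mass_loop b c K m :
  mass (loop b c K) K.*2.+1 m =
  mass (fun i => c i.+1) K m + mass (fun i => b i.+1) K m + (b 0%N - m) ^+ 2.
Proof.
rewrite /mass (loop_split K (fun i => (loop b c K i - m) ^+ 2)) -addrA; congr (_ + _).
  by apply: eq_bigr => q _; rewrite loop_side.
under eq_bigr do rewrite loop_bottom.
by rewrite big_ord_recl/= addrC.
Qed.

Lemma Hs_split_pair (M : nat) b :
  Hs b M = \sum_(i < M) \sum_(j < M) (b i - b j) ^+ 2 / (i%:R - j%:R) ^+ 2.
Proof. by rewrite pair_big. Qed.

Let sqr_sub_le (x y z : R) : (x - z) ^+ 2 <= 2 * (x - y) ^+ 2 + 2 * (y - z) ^+ 2.
Proof. by rewrite -subr_ge0 (_ : _ - _ = (x - y - (y - z)) ^+ 2) ?sqr_ge0//; ring. Qed.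

Lemma Hs_recl b K : Hs b K.+1 =
  Hs (fun i => b i.+1) K + 2 * \sum_(q < K) (b 0%N - b q.+1) ^+ 2 / q.+1%:R ^+ 2.
Proof.
pose s := \sum_(q < K) (b 0%N - b q.+1) ^+ 2 / q.+1%:R ^+ 2.
rewrite Hs_split_pair big_ord_recl/= big_ord_recl/= !subrr expr0n mul0r add0r.
have -> : \sum_(i < K) (b 0%N - b (bump 0 i)) ^+ 2 / (0%:R - (bump 0 i)%:R) ^+ 2 = s.
  by apply: eq_bigr => q _; rewrite /bump/= add1n sub0r sqrrN.
under [X in _ + X = _]eq_bigr do rewrite big_ord_recl/=.
rewrite big_split/= Hs_split_pair.
have -> : \sum_(i < K) (b (bump 0 i) - b 0%N) ^+ 2 / ((bump 0 i)%:R - 0) ^+ 2 = s.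
  by apply: eq_bigr => q _; rewrite /bump/= add1n subr0 -sqrrN opprB.
rewrite -/s addrA addrC mulr_natl mulr2n; congr (_ + _).
apply: eq_bigr => i _; apply: eq_bigr => j _; rewrite /bump/= !add1n.
by rewrite -(natr1 i) -(natr1 j) (_ : i%:R + 1 - (j%:R + 1) = i%:R - j%:R :> R)//; ring.
Qed.

Let row_le b K : (0 < K)%N -> \sum_(q < K) (b 0%N - b q) ^+ 2 / q%:R ^+ 2 <= Hs b K.
Proof.
case: K => // K _; rewrite Hs_split_pair [leRHS]big_ord_recl/= -[leLHS]addr0; apply: lerD.
  by rewrite le_eqVlt; apply/orP; left; apply/eqP; apply: eq_bigr => q _; rewrite sub0r sqrrN.
by apply: sumr_ge0 => i _; apply: sumr_ge0 => j _; rewrite divr_ge0 ?sqr_ge0.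
Qed.

(** The vertex value is only known to be close to its neighbour [b 1]. Inserting [b 1] leaves the
    convergent sum of [1 / q ^ 2] and a single row of the seminorm without the vertex. *)
Lemma Hs_vertex b K : (0 < K)%N ->
  Hs b K.+1 <= 5 * Hs (fun i => b i.+1) K + 8 * (b 0%N - b 1%N) ^+ 2.
Proof.
move=> K0; rewrite Hs_recl; set H := Hs _ _.
suff : \sum_(q < K) (b 0%N - b q.+1) ^+ 2 / q.+1%:R ^+ 2 <= 2 * H + 4 * (b 0%N - b 1%N) ^+ 2.
  by move=> h; lra.
have h1 := row_le (fun i => b i.+1) K0.
have h2 := sum_inv_sqr_le K (isT : (0 < 1)%N) : _ <= _ :> R.
apply: (@le_trans _ _ (\sum_(q < K) (2 * (b 0%N - b 1%N) ^+ 2 * ((1 + q)%:R ^+ 2)^-1 +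
    2 * ((b 1%N - b q.+1) ^+ 2 / q%:R ^+ 2)))).
  apply: ler_sum => q _; rewrite add1n.
  apply: (@le_trans _ _ ((2 * (b 0%N - b 1%N) ^+ 2 + 2 * (b 1%N - b q.+1) ^+ 2) / q.+1%:R ^+ 2)).
    by rewrite ler_wpM2r ?invr_ge0 ?sqr_ge0//; exact: sqr_sub_le.
  rewrite mulrDl lerD2l -mulrA ler_pM2l//.
  have [->|q0] := posnP q; first by rewrite subrr expr0n/= !mul0r.
  by rewrite ler_wpM2l ?sqr_ge0// lef_pV2 ?posrE ?exprn_gt0 ?ltr0n// lerXn2r ?nnegrE// ler_nat.
rewrite big_split/= -!mulr_sumr addrC lerD ?ler_pM2l//.
rewrite -mulrA [leRHS](_ : _ = 2 * ((b 0%N - b 1%N) ^+ 2 * 2)); last by ring.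
by rewrite ler_pM2l// ler_wpM2l ?sqr_ge0// (le_trans h2)// divr1.
Qed.

(** In a cross term, node [q] of one side and node [p] of the other are at distance [q + p].
    Inserting [b q] gives a difference inside [b], where [q + p >= |q - p|], and [b q - c q], where
    summing [1 / (q + p) ^ 2] over [p] leaves the weight [2 / q] of [Kc]. *)
Lemma Hs_loop b c K :
  Hs (loop b c K) K.*2.+1 <= 5 * Hs b K.+1 + Hs c K.+1 + 8 * Kc b c K.
Proof.
pose g := loop b c K; pose h i j := (g i - g j) ^+ 2 / (i%:R - j%:R) ^+ 2.
have hC i j : h i j = h j i.
  by rewrite /h -(sqrrN (g i - _)) opprB -(sqrrN (i%:R - _)) opprB.
rewrite Hs_split_pair (loop_split K (fun i => \sum_(j < K.*2.+1) h i j)).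
under [X in X + _]eq_bigr => q _ do rewrite (loop_split K (h (K - q.+1)%N)).
under [X in _ + X]eq_bigr => q _ do rewrite (loop_split K (h (K + q)%N)).
rewrite !big_split/= [X in _ + _ + (X + _)]exchange_big/=.
set LL := \sum_(i < K) \sum_(j < K) _; set LR := \sum_(i < K) \sum_(j < K.+1) _.
have -> : \sum_(j < K) \sum_(i < K.+1) h (K + i)%N (K - j.+1)%N = LR.
  by apply: eq_bigr => j _; apply: eq_bigr => i _; rewrite hC.
set RR := \sum_(i < K.+1) _.
have hLL : LL <= Hs c K.+1.
  rewrite Hs_recl -[leLHS]addr0; apply: lerD; last first.
    by rewrite mulr_ge0// sumr_ge0// => q _; rewrite divr_ge0 ?sqr_ge0.
  rewrite Hs_split_pair le_eqVlt; apply/orP; left; apply/eqP.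
  apply: eq_bigr => i _; apply: eq_bigr => j _; rewrite /h /g !loop_side//; congr (_ / _).
  have := ltn_ord i; have := ltn_ord j => jK iK.
  by rewrite !natrB// -(natr1 i) -(natr1 j) -[RHS]sqrrN; congr (_ ^+ 2); ring.
have hRR : RR = Hs b K.+1.
  rewrite Hs_split_pair; apply: eq_bigr => i _; apply: eq_bigr => j _.
  by rewrite /h /g !loop_bottom !natrD; congr (_ / _ ^+ 2); ring.
have hLR : LR <= 2 * Hs b K.+1 + 4 * Kc b c K.
  apply: (@le_trans _ _ (\sum_(q < K) \sum_(p < K.+1)
     (2 * ((b q.+1 - b p) ^+ 2 / (q.+1%:R - p%:R) ^+ 2) +
      2 * (b q.+1 - c q.+1) ^+ 2 * ((q.+1 + p)%:R ^+ 2)^-1))).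
    apply: ler_sum => q _; apply: ler_sum => p _; rewrite /h /g loop_side// loop_bottom.
    have qK := ltn_ord q.
    have -> : (K - q.+1)%:R - (K + p)%:R = - (q.+1 + p)%:R :> R.
      by rewrite natrB// !natrD; ring.
    rewrite sqrrN.
    apply: (@le_trans _ _ ((2 * (b q.+1 - b p) ^+ 2 + 2 * (b q.+1 - c q.+1) ^+ 2) / (q.+1 + p)%:R ^+ 2)).
      rewrite ler_wpM2r ?invr_ge0 ?sqr_ge0// (le_trans (sqr_sub_le _ (b q.+1) _))//.
      by rewrite addrC -(sqrrN (c _ - _)) opprB.
    rewrite mulrDl lerD2r -mulrA ler_pM2l//.
    have [<-|qp] := eqVneq q.+1 (p : nat); first by rewrite subrr expr0n/= !mul0r.
    have d0 : (0 : R) < (q.+1%:R - p%:R) ^+ 2 by rewrite exprn_even_gt0//= subr_eq0 eqr_nat.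
    have d1 : (0 : R) < (q.+1 + p)%:R ^+ 2 by rewrite exprn_gt0// ltr0n.
    rewrite ler_wpM2l ?sqr_ge0// lef_pV2 ?posrE//.
    rewrite natrD -subr_ge0 (_ : _ - _ = 4 * q.+1%:R * p%:R); last by ring.
    by rewrite !mulr_ge0.
  under eq_bigr do rewrite big_split/= -!mulr_sumr.
  rewrite big_split/= -mulr_sumr; apply: lerD.
    rewrite ler_pM2l// Hs_split_pair [leRHS]big_ord_recl/= -[leLHS]add0r; apply: lerD.
      by apply: sumr_ge0 => j _; rewrite divr_ge0 ?sqr_ge0.
    by apply: ler_sum => q _; rewrite /bump/= add1n.
  rewrite /Kc mulr_sumr; apply: ler_sum => q _.
  have sq := sum_inv_sqr_le K.+1 (isT : (0 < q.+1)%N) : _ <= _ :> R.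
  rewrite (le_trans (ler_wpM2l _ sq))//; first by rewrite pmulr_rge0// sqr_ge0.
  by rewrite le_eqVlt; apply/orP; left; apply/eqP; ring.
by rewrite hRR; lra.
Qed.

Section patch.
Variables (K : nat) (K0 : (0 < K)%N) (X m : R).

Let quad (s t u v Y : R) : s <= Y -> t <= Y -> u <= Y -> v <= Y -> 4 * (s + t + u + v) <= 16 * Y.
Proof. lra. Qed.

(** Including a vertex costs [5 + 8 = 13], so the seminorm of the loop is at most
    [5 * 13 + 13 + 8 = 86] times [X], and [34 * 86 = 2924]. The mass is at most [10 + 10 + 22 = 42]
    times [X (K + 1)], and [4 * 42 = 168]. *)
Let tri_bound b c :
  Hs (fun i => b i.+1) K <= X -> Hs (fun i => c i.+1) K <= X ->
  (b 0%N - b 1%N) ^+ 2 <= X -> (c 0%N - c 1%N) ^+ 2 <= X -> Kc b c K <= X ->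
  mass (fun i => b i.+1) K m <= 10 * X * K.+1%:R ->
  mass (fun i => c i.+1) K m <= 10 * X * K.+1%:R ->
  34 * Hs (loop b c K) K.*2.+1 + 4 / K.+1%:R * mass (loop b c K) K.*2.+1 m <= 3092 * X.
Proof.
move=> hb hc vb vc kbc mb mc.
have N0 : (0 : R) < K.+1%:R by rewrite ltr0n.
have N1 : (1 : R) <= K.+1%:R by rewrite ler1n.
have h1 := Hs_vertex b K0; have h2 := Hs_vertex c K0; have h3 := Hs_loop b c K.
have X0 : 0 <= X by apply: le_trans vb; exact: sqr_ge0.
have b1 : (b 1%N - m) ^+ 2 <= 10 * X * K.+1%:R.
  apply: le_trans mb; rewrite /mass; case: (K) K0 => // k _.
  by rewrite big_ord_recl/= lerDl; apply: sumr_ge0 => i _; exact: sqr_ge0.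
have b0 := sqr_sub_le (b 0%N) (b 1%N) m.
have hm : mass (loop b c K) K.*2.+1 m <= 42 * X * K.+1%:R.
  rewrite mass_loop; have : X <= X * K.+1%:R by rewrite ler_peMr.
  move: mb mc b0 b1; rewrite -!(mulrA _ X); set Y := X * _; lra.
have {}hm : 4 / K.+1%:R * mass (loop b c K) K.*2.+1 m <= 168 * X.
  rewrite mulrAC ler_pdivrMr// (le_trans (ler_wpM2l _ hm))//.
  by rewrite !mulrA -natrM.
apply: (le_trans (lerD (lexx _) hm)); rewrite (_ : 3092 = 2924 + 168)//; last by ring.
rewrite [leRHS]mulrDl lerD2r.
have aux (t hB hC hb1 hc1 v w k : R) : hB <= 5 * hb1 + 8 * v -> hC <= 5 * hc1 + 8 * w ->
    t <= 5 * hB + hC + 8 * k -> hb1 <= X -> hc1 <= X -> v <= X -> w <= X -> k <= X ->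
    34 * t <= 2924 * X by lra.
exact: (aux _ _ _ _ _ _ _ _ h1 h2 h3).
Qed.

Definition flip x (i : nat) : R := x (K.+1 - i)%N.

Let Hs_flip x : Hs (fun i => flip x i.+1) K = Hs (fun i => x i.+1) K.
Proof.
rewrite -[RHS]Hs_rev /Hs; apply: eq_bigr => p _; rewrite /flip.
by rewrite !subSS !subnSK.
Qed.

Let mass_flip x : mass (fun i => flip x i.+1) K m = mass (fun i => x i.+1) K m.
Proof.
rewrite /mass (reindex_inj rev_ord_inj)/=; apply: eq_bigr => p _; rewrite /flip.
by rewrite subSS subKn.
Qed.

(** The weights [1 / (q + 1)] of [Kc] are at least [1 / (K + 1)], so the distance to [m] passes from
    one side to an adjacent one. *)
Lemma mass_Kc b c (t : R) : Kc b c K <= X ->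
  mass (fun i => b i.+1) K m <= t * X * K.+1%:R ->
  mass (fun i => c i.+1) K m <= (2 + 2 * t) * X * K.+1%:R.
Proof.
move=> kbc mb; have N0 : (0 : R) < K.+1%:R by rewrite ltr0n.
apply: (@le_trans _ _ (2 * (Kc b c K * K.+1%:R) + 2 * mass (fun i => b i.+1) K m)).
  rewrite /mass /Kc mulr_suml !mulr_sumr -big_split/=; apply: ler_sum => q _.
  apply: (le_trans (sqr_sub_le _ (b q.+1) _)); rewrite lerD2r ler_pM2l//.
  rewrite -(sqrrN (c _ - _)) opprB mulrAC ler_pdivlMr ?ltr0n// ler_wpM2l ?sqr_ge0//.
  by rewrite ler_nat ltnS ltnW.
rewrite (_ : _ * _ * _ = 2 * (X * K.+1%:R) + 2 * (t * X * K.+1%:R)); last by ring.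
by apply: lerD; rewrite ler_pM2l// ler_wpM2r.
Qed.

(** Discrete Poincare inequality: two nodes of a side are at distance at most [K], so every squared
    difference is at most [K ^ 2] times its quotient in [Hs]. *)
Lemma mass_mean b : m = K%:R^-1 * \sum_(i < K) b i.+1 ->
  Hs (fun i => b i.+1) K <= X -> mass (fun i => b i.+1) K m <= X * K.+1%:R.
Proof.
move=> mE hb; have K0R : (0 : R) < K%:R by rewrite ltr0n.
have X0 := le_trans (Hs_ge0 _ _) hb.
apply: (@le_trans _ _ (X * K%:R)); last by rewrite ler_wpM2l// ler_nat.
apply: le_trans (ler_wpM2r (ler0n _ _) hb).
rewrite /mass mE Hs_split_pair mulr_suml; apply: ler_sum => i _.
apply: (le_trans (sqr_mean_le (b i.+1) (fun t => b t.+1) K0)).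
rewrite mulrC ler_pdivrMr// -mulrA mulr_suml; apply: ler_sum => j _.
have [<-|ij] := eqVneq (i : nat) j; first by rewrite subrr expr0n/= !mul0r.
have ij2 : (0 : R) < (i%:R - j%:R) ^+ 2 by rewrite exprn_even_gt0//= subr_eq0 eqr_nat.
rewrite mulrAC ler_pdivlMr// ler_wpM2l ?sqr_ge0// -expr2.
have := ltn_ord i; have := ltn_ord j => jK iK.
rewrite -subr_ge0 (_ : _ - _ = (K%:R - i%:R + j%:R) * (K%:R - j%:R + i%:R)); last by ring.
have hi : (i%:R : R) <= K%:R by rewrite ler_nat ltnW.
have hj : (j%:R : R) <= K%:R by rewrite ler_nat ltnW.
by rewrite mulr_ge0// addr_ge0// subr_ge0.
Qed.

Lemma tri_loop_bottom b c i : (i <= K.+1)%N ->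
  tri (loop b c K) K m i 0 = (K.+1 - i)%N%:R / K.+1%:R * (b i - m).
Proof.
move=> iN; rewrite /tri addn0 fold_bottom loop_bottom//.
Qed.

Lemma tri_loop_left b c l : b 0%N = c 0%N -> (l <= K.+1)%N ->
  tri (loop b c K) K m 0 l = (K.+1 - l)%N%:R / K.+1%:R * (c l - m).
Proof.
move=> bc; rewrite leq_eqVlt => /predU1P[->|lK]; first by rewrite /tri add0n subnn !mul0r.
by rewrite /tri add0n fold_left loop_left.
Qed.

Variables (bot top lef rig : nat -> R).

(* A side is covered by the two triangles sitting at its ends, whose cutoffs add
   up to 1 on it. *)
Definition square_ext (i l : nat) : R := m +
  (tri (loop bot lef K) K m i l +
   tri (loop (flip bot) rig K) K m (K.+1 - i) l +
   tri (loop top (flip lef) K) K m i (K.+1 - l) +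
   tri (loop (flip top) (flip rig) K) K m (K.+1 - i) (K.+1 - l)).

Hypotheses (BL : bot 0%N = lef 0%N) (BR : bot K.+1 = rig 0%N)
  (TL : top 0%N = lef K.+1) (TR : top K.+1 = rig K.+1).

Let interp (i : nat) (x : R) : (i <= K.+1)%N ->
  m + ((K.+1 - i)%N%:R / K.+1%:R * (x - m) + i%:R / K.+1%:R * (x - m)) = x.
Proof.
move=> iN; rewrite -mulrDl -mulrDl -natrD subnK// divff ?pnatr_eq0// mul1r.
by rewrite addrC subrK.
Qed.

Lemma square_ext_bottom i : (i <= K.+1)%N -> square_ext i 0 = bot i.
Proof.
move=> iN; rewrite /square_ext subn0 !(tri_out _ _ (k := _) (l := K.+1)) ?addr0; [|lia..].
rewrite !tri_loop_bottom ?leq_subr// subKn// /flip subKn//; exact: interp.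
Qed.

Lemma square_ext_top i : (i <= K.+1)%N -> square_ext i K.+1 = top i.
Proof.
move=> iN; rewrite /square_ext subnn !(tri_out _ _ (k := _) (l := K.+1)) ?add0r; [|lia..].
rewrite !tri_loop_bottom ?leq_subr// subKn// /flip subKn//; exact: interp.
Qed.

Lemma square_ext_left l : (l <= K.+1)%N -> square_ext 0 l = lef l.
Proof.
move=> lN; rewrite /square_ext subn0 !(tri_out _ _ (k := K.+1)) ?addr0; [|lia..].
by rewrite !tri_loop_left ?leq_subr// /flip ?subn0// subKn//; exact: interp.
Qed.

Lemma square_ext_right l : (l <= K.+1)%N -> square_ext K.+1 l = rig l.
Proof.
move=> lN; rewrite /square_ext subnn !(tri_out _ _ (k := K.+1)) ?add0r ?addr0; [|lia..].
by rewrite !tri_loop_left ?leq_subr// /flip ?subn0// subKn//; exact: interp.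
Qed.

Hypotheses (mE : m = K%:R^-1 * \sum_(i < K) bot i.+1)
  (HB : Hs (fun i => bot i.+1) K <= X) (HT : Hs (fun i => top i.+1) K <= X)
  (HL : Hs (fun i => lef i.+1) K <= X) (HR : Hs (fun i => rig i.+1) K <= X)
  (B0 : (bot 0%N - bot 1%N) ^+ 2 <= X) (BN : (bot K.+1 - bot K) ^+ 2 <= X)
  (T0 : (top 0%N - top 1%N) ^+ 2 <= X) (TN : (top K.+1 - top K) ^+ 2 <= X)
  (L0 : (lef 0%N - lef 1%N) ^+ 2 <= X) (LN : (lef K.+1 - lef K) ^+ 2 <= X)
  (R0 : (rig 0%N - rig 1%N) ^+ 2 <= X) (RN : (rig K.+1 - rig K) ^+ 2 <= X)
  (KBL : Kc bot lef K <= X) (KBR : Kc (flip bot) rig K <= X)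
  (KTL : Kc top (flip lef) K <= X) (KTR : Kc (flip top) (flip rig) K <= X).

Let X0 : 0 <= X. Proof. by apply: le_trans B0; exact: sqr_ge0. Qed.

Let mass_weak x (t : R) : t <= 10 ->
  mass (fun i => x i.+1) K m <= t * X * K.+1%:R -> mass (fun i => x i.+1) K m <= 10 * X * K.+1%:R.
Proof. by move=> t10 /le_trans; apply; rewrite ler_wpM2r// ler_wpM2r. Qed.

Let massB : mass (fun i => bot i.+1) K m <= 1 * X * K.+1%:R.
Proof. by rewrite mul1r; exact: mass_mean. Qed.

Let massL := mass_Kc KBL massB.

Let KcC b c : Kc b c K = Kc c b K.
Proof. by apply: eq_bigr => q _; rewrite -sqrrN opprB. Qed.

(** The top is not adjacent to the bottom and is reached through the left side: the factors are 1 on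
    the bottom, 4 on the left and right, and 10 on top. *)
Let massT : mass (fun i => top i.+1) K m <= (2 + 2 * (2 + 2 * 1)) * X * K.+1%:R.
Proof. by apply: (@mass_Kc (flip lef)); [rewrite KcC|rewrite mass_flip; exact: massL]. Qed.

Let massR : mass (fun i => rig i.+1) K m <= (2 + 2 * 1) * X * K.+1%:R.
Proof. by apply: (mass_Kc KBR); rewrite mass_flip. Qed.

Let energy b c :=
  34 * Hs (loop b c K) K.*2.+1 + 4 / K.+1%:R * mass (loop b c K) K.*2.+1 m.

Let flip0 x : flip x 0 = x K.+1. Proof. by rewrite /flip subn0. Qed.

Let flip1 x : flip x 1 = x K. Proof. by rewrite /flip subn1. Qed.

Let eBL : energy bot lef <= 3092 * X.
Proof.
apply: tri_bound => //; [apply: mass_weak massB|apply: mass_weak massL]; lra.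
Qed.

Let eBR : energy (flip bot) rig <= 3092 * X.
Proof.
apply: tri_bound => //; rewrite ?Hs_flip ?flip0 ?flip1 ?mass_flip//.
  by apply: mass_weak massB; lra.
by apply: mass_weak massR; lra.
Qed.

Let eTL : energy top (flip lef) <= 3092 * X.
Proof.
apply: tri_bound => //; rewrite ?Hs_flip ?flip0 ?flip1 ?mass_flip//.
  by apply: mass_weak massT; lra.
by apply: mass_weak massL; lra.
Qed.

Let eTR : energy (flip top) (flip rig) <= 3092 * X.
Proof.
apply: tri_bound => //; rewrite ?Hs_flip ?flip0 ?flip1 ?mass_flip//.
  by apply: mass_weak massT; lra.
by apply: mass_weak massR; lra.
Qed.

(** The triangles at the right-hand corners are parametrised by [K + 1 - i], so their increments
    appear reversed; [sqr4'] does the same for the top corners. *)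
Let sqr4 (a b c d a' b' c' d' : R) : (a' + b' + c' + d' - (a + b + c + d)) ^+ 2 <=
  4 * ((a' - a) ^+ 2 + (b - b') ^+ 2 + (c' - c) ^+ 2 + (d - d') ^+ 2).
Proof.
pose x := a' - a; pose y := b' - b; pose z := c' - c; pose t := d' - d.
rewrite -subr_ge0 (_ : _ - _ = (x - y) ^+ 2 + (x - z) ^+ 2 + (x - t) ^+ 2 +
  (y - z) ^+ 2 + (y - t) ^+ 2 + (z - t) ^+ 2); last by rewrite /x /y /z /t; ring.
by rewrite !addr_ge0 ?sqr_ge0.
Qed.

Let sqr4' (a b c d a' b' c' d' : R) : (a' + b' + c' + d' - (a + b + c + d)) ^+ 2 <=
  4 * ((a' - a) ^+ 2 + (b' - b) ^+ 2 + (c - c') ^+ 2 + (d - d') ^+ 2).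
Proof.
by rewrite (le_trans (sqr4 _ _ _ _ _ _ _ _))// -(sqrrN (b - _)) opprB -(sqrrN (c - _)) opprB.
Qed.

(** One factor 4 comes from squaring a sum of four terms, the other from adding four triangle
    energies of at most [3092 X] each. *)
Lemma square_ext_horizontal :
  \sum_(i < K.+1) \sum_(l < K.+2) (square_ext i.+1 l - square_ext i l) ^+ 2 <= 16 * (3092 * X).
Proof.
pose D b c k l := (tri (loop b c K) K m k.+1 l - tri (loop b c K) K m k l) ^+ 2.
apply: (@le_trans _ _ (\sum_(i < K.+1) \sum_(l < K.+2) 4 * (D bot lef i l +
   D (flip bot) rig (K.+1 - i.+1)%N l + D top (flip lef) i (K.+2 - l.+1)%N +
   D (flip top) (flip rig) (K.+1 - i.+1)%N (K.+2 - l.+1)%N))).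
  apply: ler_sum => i _; apply: ler_sum => l _; rewrite /square_ext opprD addrACA subrr add0r.
  rewrite -(subnSK (ltn_ord i)).
  by rewrite /D !subSS; exact: sqr4.
under eq_bigr do rewrite -mulr_sumr.
rewrite -mulr_sumr; under eq_bigr do rewrite !big_split/=.
rewrite !big_split/=.
have r1 (F : nat -> nat -> R) : \sum_(i < K.+1) \sum_(l < K.+2) F (K.+1 - i.+1)%N l =
    \sum_(i < K.+1) \sum_(l < K.+2) F i l.
  by rewrite [RHS](reindex_inj rev_ord_inj).
have r2 (F : nat -> nat -> R) : \sum_(i < K.+1) \sum_(l < K.+2) F i (K.+2 - l.+1)%N =
    \sum_(i < K.+1) \sum_(l < K.+2) F i l.
  by apply: eq_bigr => i _; rewrite [RHS](reindex_inj rev_ord_inj).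
rewrite (r1 (D (flip bot) rig)) (r2 (D top (flip lef))).
rewrite (r2 (fun i l => D (flip top) (flip rig) (K.+1 - i.+1)%N l)) (r1 (D (flip top) (flip rig))).
have t1 := le_trans (tri_horizontal (loop bot lef K) m K0) eBL.
have t2 := le_trans (tri_horizontal (loop (flip bot) rig K) m K0) eBR.
have t3 := le_trans (tri_horizontal (loop top (flip lef) K) m K0) eTL.
have t4 := le_trans (tri_horizontal (loop (flip top) (flip rig) K) m K0) eTR.
exact: quad.
Qed.

Lemma square_ext_vertical :
  \sum_(i < K.+2) \sum_(l < K.+1) (square_ext i l.+1 - square_ext i l) ^+ 2 <= 16 * (3092 * X).
Proof.
pose D b c k l := (tri (loop b c K) K m k l.+1 - tri (loop b c K) K m k l) ^+ 2.
apply: (@le_trans _ _ (\sum_(i < K.+2) \sum_(l < K.+1) 4 * (D bot lef i l +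
   D (flip bot) rig (K.+2 - i.+1)%N l + D top (flip lef) i (K.+1 - l.+1)%N +
   D (flip top) (flip rig) (K.+2 - i.+1)%N (K.+1 - l.+1)%N))).
  apply: ler_sum => i _; apply: ler_sum => l _; rewrite /square_ext opprD addrACA subrr add0r.
  rewrite -(subnSK (ltn_ord l)).
  by rewrite /D !subSS; exact: sqr4'.
under eq_bigr do rewrite -mulr_sumr.
rewrite -mulr_sumr; under eq_bigr do rewrite !big_split/=.
rewrite !big_split/=.
have r1 (F : nat -> nat -> R) : \sum_(i < K.+2) \sum_(l < K.+1) F (K.+2 - i.+1)%N l =
    \sum_(i < K.+2) \sum_(l < K.+1) F i l.
  by rewrite [RHS](reindex_inj rev_ord_inj).
have r2 (F : nat -> nat -> R) : \sum_(i < K.+2) \sum_(l < K.+1) F i (K.+1 - l.+1)%N =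
    \sum_(i < K.+2) \sum_(l < K.+1) F i l.
  by apply: eq_bigr => i _; rewrite [RHS](reindex_inj rev_ord_inj).
rewrite (r1 (D (flip bot) rig)) (r2 (D top (flip lef))).
rewrite (r2 (fun i l => D (flip top) (flip rig) (K.+2 - i.+1)%N l)) (r1 (D (flip top) (flip rig))).
have t1 := le_trans (tri_vertical (loop bot lef K) m K0) eBL.
have t2 := le_trans (tri_vertical (loop (flip bot) rig K) m K0) eBR.
have t3 := le_trans (tri_vertical (loop top (flip lef) K) m K0) eTL.
have t4 := le_trans (tri_vertical (loop (flip top) (flip rig) K) m K0) eTR.
exact: quad.
Qed.

End patch.
End discrete_square.

(** * Measure and integration tools *)

Section planar_measurability.
Context {R : realType}.

(** The product sigma-algebra contains the open sets because each is a countable union of squares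
    with rational centres and radii [1 / (n + 1)]. A radius below [e / 2] keeps a square containing
    the point inside its [e]-ball. *)
Lemma open_measurable2 (O : set (R^o * R^o)) : open O -> measurable (O : set (R * R)).
Proof.
move=> oO.
pose bx (i : rat * rat * nat) : set (R * R) :=
  ball (ratr i.1.1 : R) i.2.+1%:R^-1 `*` ball (ratr i.1.2 : R) i.2.+1%:R^-1.
pose I := [set i | bx i `<=` (O : set (R * R))].
have -> : (O : set (R * R)) = \bigcup_(i in I) bx i.
  apply/seteqP; split => [[x y] Oxy|x [i Ii]]; last exact: Ii.
  have : nbhs ((x, y) : R^o * R^o) O by exact: open_nbhs_nbhs.
  rewrite -nbhs_ballE => -[e /= e0 eO].
  have [n _ /(_ n (leqnn n)) ne] := near_infty_natSinv_lt (PosNum (divr_gt0 e0 (ltr0n R 2))).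
  have {}ne : n.+1%:R^-1 < e / 2 by exact: ne.
  have n0 : (0 : R) < n.+1%:R^-1 by rewrite invr_gt0.
 move: ne n0;  set t : R := n.+1%:R^-1 => ne n0.
  have xx (z : R) : z - t < z + t by lra.
  have [p] := rat_in_itvoo (xx x); have [q] := rat_in_itvoo (xx y).
  rewrite !in_itv /= => /andP[q1 q2] /andP[p1 p2].
  exists ((p, q), n) => /=.
    move=> [a b] [/= pa qb]; apply: eO; split => /=.
      by move: pa; rewrite -/t /ball /= !ltr_norml; lra.
    by move: qb; rewrite -/t /ball /= !ltr_norml; lra.
  split => /=; rewrite -/t /ball /= ltr_norml; lra.
rewrite bigcup_mkcond; apply: countable_bigcupT_measurable => // i.
case: ifPn => // _; apply: measurableX; exact: measurable_ball.
Qed.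

Lemma continuous_measurable2 (F : R^o * R^o -> R) : continuous F ->
  measurable_fun [set: R * R] (F : R * R -> R).
Proof.
move=> /continuousP cF.
apply: (measurability _ (RGenOpens.measurableE R)).
move=> _ [_ [a [b ->] <-]]; rewrite setTI; apply: open_measurable2.
exact/cF/interval_open.
Qed.

End planar_measurability.

(** * Translations, reflections and Tonelli's theorem on rectangles *)

Section change_of_variable.
Context {R : realType}.
Local Notation mu := (@lebesgue_measure R).
Local Open Scope ereal_scope.

Lemma measurable_shift (c : R) : measurable_fun [set: R] (fun x => c + x)%R.
Proof. exact: measurable_funD. Qed.

Lemma measurable_refl (c : R) : measurable_fun [set: R] (fun x => c - x)%R.
Proof. exact: measurable_funB. Qed.

Lemma lebesgue_measure_shift (c : R) (A : set R) : measurable A ->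
  pushforward mu ((fun x => c + x)%R : _ -> measurableTypeR R) A = mu A.
Proof.
move=> mA; pose ms := isMeasurableFun.Build _ _ (measurableTypeR R) (measurableTypeR R) _
  (measurable_shift c).
pose phi : {mfun measurableTypeR R >-> measurableTypeR R} := HB.pack (fun x : R => c + x)%R ms.
apply/esym.
apply: (@lebesgue_measure_unique _ (pushforward mu phi)) => //= _ [[a b]] _ <-.
rewrite /pushforward/= (_ : _ @^-1` _ = `](a - c)%R, (b - c)%R]%classic).
  rewrite !lebesgue_measure_itv/= !lte_fin ltrD2r.
  by case: ifP => // _; rewrite -!EFinB; congr EFin; ring.
by apply/seteqP; split => x; rewrite /= !in_itv/= => /andP[? ?]; apply/andP; split; lra.
Qed.

Lemma lebesgue_measure_refl (c : R) (A : set R) : measurable A ->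
  pushforward mu ((fun x => c - x)%R : _ -> measurableTypeR R) A = mu A.
Proof.
move=> mA.
have mB : measurable ((fun x => c + x)%R @^-1` A).
  by rewrite -[X in measurable X]setTI; exact: measurable_shift.
rewrite -(lebesgue_measure_shift c mA) -[RHS](lebesgue_measureN mB).
by [].
Qed.

Lemma ge0_integral_shift (c : R) (D : set R) (f : R -> \bar R) :
  measurable D -> measurable_fun D f -> (forall x, D x -> 0 <= f x) ->
  \int[mu]_(x in (fun x => c + x)%R @^-1` D) f (c + x)%R = \int[mu]_(x in D) f x.
Proof.
move=> mD mf f0.
have /= <- := @ge0_integral_pushforward _ _ (measurableTypeR R) (measurableTypeR R) _ _
  (measurable_shift c) lebesgue_measure D f mD mf
  (fun y yD => f0 y (set_mem yD)).
apply: eq_measure_integral; first exact: measurable_shift.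
by move=> ? A mA _; exact: lebesgue_measure_shift.
Qed.

Lemma ge0_integral_refl (c : R) (D : set R) (f : R -> \bar R) :
  measurable D -> measurable_fun D f -> (forall x, D x -> 0 <= f x) ->
  \int[mu]_(x in (fun x => c - x)%R @^-1` D) f (c - x)%R = \int[mu]_(x in D) f x.
Proof.
move=> mD mf f0.
have /= <- := @ge0_integral_pushforward _ _ (measurableTypeR R) (measurableTypeR R) _ _
  (measurable_refl c) lebesgue_measure D f mD mf
  (fun y yD => f0 y (set_mem yD)).
apply: eq_measure_integral; first exact: measurable_refl.
by move=> ? A mA _; exact: lebesgue_measure_refl.
Qed.

Lemma shift_itv (c a b : R) :
  (fun x => c + x)%R @^-1` `[(c + a)%R, (c + b)%R] = `[a, b]%classic.
Proof. by apply/seteqP; split => x; rewrite /= !in_itv/= !lerD2l. Qed.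

Lemma refl_itv (c a b : R) :
  (fun x => c - x)%R @^-1` `[(c - b)%R, (c - a)%R] = `[a, b]%classic.
Proof.
apply/seteqP; split => x; rewrite /= !in_itv/= => /andP[? ?]; apply/andP; split; lra.
Qed.

Lemma ge0_integral_prod (A B : set R) (f : R * R -> \bar R) :
  measurable A -> measurable B -> measurable_fun (A `*` B) f ->
  (forall z, (A `*` B) z -> 0 <= f z) ->
  \int[@leb2 R]_(z in A `*` B) f z = \int[mu]_(x in A) \int[mu]_(y in B) f (x, y).
Proof.
move=> mA mB mf f0.
have mAB : measurable (A `*` B) by exact: measurableX.
rewrite integral_mkcond /leb2 fubini_tonelli1; last 2 first.
- exact: (measurable_restrictT f mAB).1 mf.
- by move=> z; apply: erestrict_ge0.
rewrite [RHS]integral_mkcond; apply: eq_integral => x _.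
rewrite /fubini_F /= [RHS]patchE; case: ifPn => xA.
  rewrite [RHS]integral_mkcond; apply: eq_integral => y _.
  by rewrite !patchE in_setX xA.
rewrite integral0_eq// => y _.
by rewrite patchE in_setX (negbTE xA).
Qed.

Lemma ge0_integral_prod2 (A B : set R) (f : R * R -> \bar R) :
  measurable A -> measurable B -> measurable_fun (A `*` B) f ->
  (forall z, (A `*` B) z -> 0 <= f z) ->
  \int[@leb2 R]_(z in A `*` B) f z = \int[mu]_(y in B) \int[mu]_(x in A) f (x, y).
Proof.
move=> mA mB mf f0.
have mAB : measurable (A `*` B) by exact: measurableX.
rewrite integral_mkcond /leb2 fubini_tonelli2; last 2 first.
- exact: (measurable_restrictT f mAB).1 mf.
- by move=> z; apply: erestrict_ge0.
rewrite [RHS]integral_mkcond; apply: eq_integral => y _.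
rewrite /fubini_G /= [RHS]patchE; case: ifPn => yB.
  rewrite [RHS]integral_mkcond; apply: eq_integral => x _.
  by rewrite !patchE in_setX yB andbT.
rewrite integral0_eq// => x _.
by rewrite patchE in_setX (negbTE yB) andbF.
Qed.

End change_of_variable.

(** * Cauchy-Schwarz and Hardy inequalities on an interval *)

Section one_variable.
Context {R : realType}.
Local Notation mu := (@lebesgue_measure R).
Implicit Types (v g : R -> R) (a b : R).

Lemma continuous_at_integrable a b g : {in `[a, b], forall x, {for x, continuous g}} ->
  mu.-integrable `[a, b] (EFin \o g).
Proof.
move=> cg; apply: continuous_compact_integrable; first exact: segment_compact.
by apply: continuous_in_subspaceT => x /set_mem; exact: cg.
Qed.

Lemma measurable_invr : measurable_fun [set: R] (@GRing.inv R).
Proof.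
rewrite -(setUv [set 0 : R]); apply/measurable_funU => //; first exact: measurableC.
split; first exact: measurable_fun_set1.
apply: open_continuous_measurable_fun; first exact/closed_openC/closed_eq.
by move=> x /set_mem /eqP x0; exact: inv_continuous.
Qed.

Lemma integral_cst_itv a b k : a <= b ->
  (\int[mu]_(x in `[a, b]) k%:E = (k * (b - a))%:E)%E.
Proof.
move=> ab; rewrite integral_cst//= lebesgue_measure_itv/= lte_fin.
by move: ab; rewrite le_eqVlt => /predU1P[->|->]; rewrite ?ltxx ?subrr ?mule0 ?mulr0.
Qed.

Lemma integrable_EFinZ (D : set R) k g : measurable D ->
  mu.-integrable D (EFin \o g) -> mu.-integrable D (EFin \o (fun x => k * g x)).
Proof. by move=> mD ig; have h := integrableZl _ k ig; exact: (h mD). Qed.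

Lemma integrable_EFinB (D : set R) v g : measurable D ->
  mu.-integrable D (EFin \o v) -> mu.-integrable D (EFin \o g) ->
  mu.-integrable D (EFin \o (fun x => v x - g x)).
Proof. by move=> mD iv ig; have h := integrableB _ iv ig; exact: (h mD). Qed.

Lemma FTC2_itv a b v g : a <= b ->
  {in `[a, b], forall x : R, is_derive x 1 v (g x)} ->
  {in `[a, b], forall x, {for x, continuous g}} ->
  \int[mu]_(x in `[a, b]) g x = v b - v a.
Proof.
rewrite le_eqVlt => /predU1P[-> _ _|ab dv cg].
  by rewrite set_itv1 Rintegral_set1 subrr.
have cv x : x \in `[a, b] -> {for x, continuous v}.
  by move=> /dv [dvx _]; exact/differentiable_continuous/derivable1_diffP.
rewrite /Rintegral (@continuous_FTC2 _ g v)//.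
- by apply: continuous_in_subspaceT => x /set_mem; exact: cg.
- split.
  + by move=> x xab; case: (dv x (subset_itv_oo_cc xab)).
  + by apply: cvg_at_right_filter; apply: cv; rewrite in_itv/= lexx ltW.
  + by apply: cvg_at_left_filter; apply: cv; rewrite in_itv/= lexx andbT ltW.
- by move=> x xab; rewrite derive1E; case: (dv x (subset_itv_oo_cc xab)).
Qed.

Lemma EFin_Rintegral (D : set R) g : mu.-integrable D (EFin \o g) -> measurable D ->
  (\int[mu]_(x in D) g x)%:E = (\int[mu]_(x in D) (g x)%:E)%E.
Proof. by move=> ig mD; rewrite /Rintegral fineK//; exact: integrable_fin_num. Qed.

(** Cauchy-Schwarz against the constant 1, from the nonnegativity of the integral of [(g - c) ^ 2]
    where [c] is the mean of [g]. An infinite right-hand side is treated apart, so that square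
    integrability need not be assumed. *)
Lemma sqr_Rintegral_le a b g : a < b -> mu.-integrable `[a, b] (EFin \o g) ->
  (((\int[mu]_(x in `[a, b]) g x) ^+ 2)%:E <=
   (b - a)%:E * \int[mu]_(x in `[a, b]) ((g x) ^+ 2)%:E)%E.
Proof.
move=> ab ig; have ba : 0 < b - a by rewrite subr_gt0.
have mI : measurable (`[a, b] : set R) by exact: measurable_itv.
have mg : measurable_fun `[a, b] g by move/integrableP: ig => [/measurable_EFinP].
have J0 : (0 <= \int[mu]_(x in `[a, b]) ((g x) ^+ 2)%:E)%E.
  by apply: integral_ge0 => x _; rewrite lee_fin sqr_ge0.
have [Joo|Jfin] := eqVneq (\int[mu]_(x in `[a, b]) ((g x) ^+ 2)%:E)%E +oo%E.
  by rewrite Joo gt0_muley ?lte_fin// leey.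
have ig2 : mu.-integrable `[a, b] (EFin \o (fun x => g x ^+ 2)).
  apply/integrableP; split; first exact/measurable_EFinP/measurable_funX.
  rewrite (_ : integral _ _ _ = \int[mu]_(x in `[a, b]) ((g x) ^+ 2)%:E)%E.
    by rewrite lt_neqAle Jfin leey.
  by apply: eq_integral => x _ /=; rewrite ger0_norm ?sqr_ge0.
rewrite -EFin_Rintegral// -EFinM lee_fin.
set J := (X in _ <= _ * X); set G := (X in X ^+ 2 <= _).
pose c := G / (b - a).
have icst k : mu.-integrable `[a, b] (EFin \o cst k).
  by apply: continuous_at_integrable => x _; exact: cst_continuous.
have : 0 <= \int[mu]_(x in `[a, b]) ((g x ^+ 2 - (c *+ 2) * g x) + c ^+ 2).
  apply: Rintegral_ge0 => x _.
  have -> : g x ^+ 2 - c *+ 2 * g x + c ^+ 2 = (g x - c) ^+ 2 by ring.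
  exact: sqr_ge0.
have ig1 k : mu.-integrable `[a, b] (EFin \o (fun x => k * g x)) by exact: integrable_EFinZ.
have igB : mu.-integrable `[a, b] (EFin \o (fun x => g x ^+ 2 - c *+ 2 * g x)).
  exact: integrable_EFinB.
rewrite RintegralD//; last exact: icst.
rewrite RintegralB//.
rewrite RintegralZl// -/G Rintegral_cst//= -/J lebesgue_measure_itv/= lte_fin ab -EFinD/=.
have -> : J - c *+ 2 * G + c ^+ 2 * (b - a) = J - G ^+ 2 / (b - a).
  by rewrite /c; field; rewrite gt_eqF.
by rewrite subr_ge0 ler_pdivrMr// mulrC.
Qed.

Lemma sqr_increment_le a b v g : a <= b -> (forall x : R, is_derive x 1 v (g x)) ->
  continuous g ->
  (((v b - v a) ^+ 2)%:E <= (b - a)%:E * \int[mu]_(x in `[a, b]) ((g x) ^+ 2)%:E)%E.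
Proof.
move=> ab dv cg; rewrite -(FTC2_itv ab (fun x _ => dv x) (fun x _ => cg x)).
move: ab; rewrite le_eqVlt => /predU1P[->|ab].
  by rewrite set_itv1 Rintegral_set1 expr0n subrr mul0e.
by apply: sqr_Rintegral_le => //; apply: continuous_at_integrable => x _; exact: cg.
Qed.

(** Integrating the derivative [2 g v / x - (v / x) ^ 2] of [v ^ 2 / x] expresses the mixed integral
    by boundary values; expanding the nonnegative integral of [(2 g - v / x) ^ 2] then gives the
    constant 4. The boundary term at [d] has a favourable sign. *)
Lemma Hardy_itv (e d : R) v g : 0 < e -> e <= d ->
  (forall x : R, is_derive x 1 v (g x)) -> continuous g ->
  (\int[mu]_(x in `[e, d]) (v x ^+ 2 / x ^+ 2)%:E <=
   4%:E * \int[mu]_(x in `[e, d]) (g x ^+ 2)%:E + (2 * (v e ^+ 2 / e))%:E)%E.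
Proof.
move=> e0 ed dv cg.
have cv : continuous v.
  by move=> x; apply/differentiable_continuous/derivable1_diffP; case: (dv x).
have pos x : x \in `[e, d] -> x != 0.
  by rewrite in_itv/= => /andP[ex _]; rewrite gt_eqF// (lt_le_trans e0).
have cV x : x \in `[e, d] -> {for x, continuous (fun t : R => t^-1)}.
  by move=> xed; apply: inv_continuous; exact: pos.
have cvx x : x \in `[e, d] -> {for x, continuous (fun t : R => v t / t)}.
  by move=> xed; apply: continuousM; [exact: cv|exact: cV].
have dw x : x \in `[e, d] ->
    is_derive x 1 (fun t : R => v t ^+ 2 / t) (g x * (v x / x) *+ 2 - (v x / x) ^+ 2).
  move=> xed; have x0 := pos _ xed.
  have d1 : is_derive x 1 (fun t : R => t^-1) (- x ^- 2).
    have := @realfun.is_deriveV _ (id : R -> R) x 1 1 x0 (is_derive_id x _).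
    by rewrite /GRing.scale/= mulr1.
  have d2 := dv x.
  have d3 : is_derive x 1 (fun t => v t ^+ 2) (v x * g x + v x * g x).
    rewrite (_ : (fun t => _) = v * v); last by apply/funext => t; rewrite expr2.
    by apply: is_derive_eq; rewrite /GRing.scale/=.
  rewrite (_ : (fun t => _) = (fun t => v t ^+ 2) * (fun t : R => t^-1)) //.
  apply: is_derive_eq; rewrite /GRing.scale/=; field; exact: x0.
have ig : mu.-integrable `[e, d] (EFin \o (fun x => g x ^+ 2)).
  by apply: continuous_at_integrable => x _; apply: continuousM; exact: cg.
have iv : mu.-integrable `[e, d] (EFin \o (fun x => (v x / x) ^+ 2)).
  by apply: continuous_at_integrable => x xed; apply: continuousM; exact: cvx.
have cgv x : x \in `[e, d] -> {for x, continuous (fun x => g x * (v x / x) *+ 2)}.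
  move=> xed; rewrite (_ : (fun x => _) = (fun x => (g x * (v x / x)) *+ 2)) //.
  have h : {for x, continuous (fun x => g x * (v x / x))}.
    by apply: continuousM; [exact: cg|exact: cvx].
  by apply: continuousD; exact: h.
have igv : mu.-integrable `[e, d] (EFin \o (fun x => g x * (v x / x) *+ 2)).
  exact: continuous_at_integrable.
have cdw : {in `[e, d], forall x, {for x, continuous
    (fun x => g x * (v x / x) *+ 2 - (v x / x) ^+ 2)}}.
  move=> x xed; apply: continuousB; first exact: cgv.
  by apply: continuousM; exact: cvx.
have F := FTC2_itv ed dw cdw.
under eq_integral do rewrite -expr_div_n.
rewrite -!EFin_Rintegral// -EFinM -EFinD lee_fin.
rewrite RintegralB// in F.
set A := \int[mu]_(x in _) (v x / x) ^+ 2 in F *.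
set B := \int[mu]_(x in _) (g x * _ *+ 2) in F *.
set C := \int[mu]_(x in _) g x ^+ 2.
have : 0 <= \int[mu]_(x in `[e, d]) ((4 * g x ^+ 2 - 2 * (g x * (v x / x) *+ 2)) + (v x / x) ^+ 2).
  apply: Rintegral_ge0 => x _.
  rewrite (_ : _ + _ = (2 * g x - v x / x) ^+ 2); last by ring.
  exact: sqr_ge0.
have mI : measurable (`[e, d]%classic : set R) by [].
have cZ k h := @integrable_EFinZ _ k h mI.
have iB g1 g2 := @integrable_EFinB _ g1 g2 mI.
rewrite RintegralD//; last by apply: iB; exact: cZ.
rewrite RintegralB//; [|exact: cZ..].
rewrite !RintegralZl// -/A -/B -/C => h.
have vd : 0 <= v d ^+ 2 / d by rewrite divr_ge0 ?sqr_ge0// (le_trans _ ed)// ltW.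
lra.
Qed.

(** Since [v 0 = 0] and [g ^ 2 <= M], one has [v x ^ 2 <= M x ^ 2]; hence both the boundary term at
    [r] and the integral over [[0, r]] vanish as [r] tends to 0. *)
Lemma Hardy (d : R) v g : 0 <= d -> v 0 = 0 ->
  (forall x : R, is_derive x 1 v (g x)) -> continuous g ->
  (\int[mu]_(x in `[0%R, d]) (v x ^+ 2 / x ^+ 2)%:E <=
   4%:E * \int[mu]_(x in `[0%R, d]) (g x ^+ 2)%:E)%E.
Proof.
rewrite le_eqVlt => /predU1P[<- _ _ _|d0 v0 dv cg].
  rewrite set_itv1 integral_set1 mule_ge0// integral_ge0// => x _.
  by rewrite lee_fin sqr_ge0.
have cv : continuous v.
  by move=> x; apply/differentiable_continuous/derivable1_diffP; case: (dv x).
have [M M0 Mg] : exists2 M : R, 0 <= M & forall x, x \in `[0, d] -> g x ^+ 2 <= M.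
  have := @EVT_max R (fun x => g x ^+ 2) 0 d (ltW d0).
  case; first by apply: continuous_subspaceT => x; apply: continuousM; exact: cg.
  move=> c cd H; exists (g c ^+ 2) => //; exact: sqr_ge0.
have vM x : x \in `[0, d] -> v x ^+ 2 <= x ^+ 2 * M.
  rewrite in_itv/= => /andP[x0 xd].
  have := sqr_increment_le x0 dv cg; rewrite v0 !subr0 => h.
  rewrite -lee_fin; apply: (le_trans h).
  rewrite expr2 -mulrA EFinM lee_pmul//.
    by apply: integral_ge0 => t _; rewrite lee_fin sqr_ge0.
  apply: (@le_trans _ _ (\int[mu]_(t in `[0%R, x]) M%:E)%E).
    apply: ge0_le_integral => //.
    - by move=> t _; rewrite lee_fin sqr_ge0.
    - apply/measurable_EFinP; apply: measurable_funTS; apply: continuous_measurable_fun.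
      by move=> t; apply: continuousM; exact: cg.
    - move=> t /=; rewrite in_itv/= => /andP[t0 tx]; rewrite lee_fin Mg// in_itv/= t0.
      exact: le_trans xd.
  by rewrite integral_cst_itv// subr0 mulrC.
have mh : measurable_fun [set: R] (fun x => (v x ^+ 2 / x ^+ 2)%:E).
  apply/measurable_EFinP; under eq_fun do rewrite -expr_div_n.
  by apply: measurable_funX; apply: measurable_funM;
    [exact: continuous_measurable_fun|exact: measurable_invr].
apply/lee_addgt0Pr => e e0.
(* The two errors add up to [2 r M + r M]. *)
pose r := Num.min d (e / (3 * M + 1)).
have M1 : 0 < 3 * M + 1 by rewrite ltr_wpDl// mulr_ge0.
have r0 : 0 < r by rewrite lt_min d0 divr_gt0.
have rd : r <= d by rewrite ge_min lexx.
have re : r * (3 * M) <= e.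
  have : r <= e / (3 * M + 1) by rewrite ge_min lexx orbT.
  rewrite ler_pdivlMr// => h; apply: le_trans h; rewrite ler_pM2l//; lra.
have split : `[0, d]%classic = `[0, r]%classic `|` `]r, d]%classic.
  by rewrite -itv_bndbnd_setU// bnd_simp ltW.
rewrite {1}split ge0_integral_setU//=; last 3 first.
- exact: measurable_funTS.
- by move=> x _; rewrite lee_fin divr_ge0 ?sqr_ge0.
- by apply/disj_setPS => x [] /=; rewrite !in_itv/= => /andP[_ h] /andP[]; rewrite ltNge h.
rewrite addeC.
have H1 : (\int[mu]_(x in `]r, d]) (v x ^+ 2 / x ^+ 2)%:E <=
    4%:E * \int[mu]_(x in `[0%R, d]) (g x ^+ 2)%:E + (2 * (r * M))%:E)%E.
  apply: (@le_trans _ _ (\int[mu]_(x in `[r, d]) (v x ^+ 2 / x ^+ 2)%:E)%E).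
    apply: ge0_subset_integral => //.
    - exact: measurable_funTS.
    - by move=> x _; rewrite lee_fin divr_ge0 ?sqr_ge0.
    - exact: subset_itv_oc_cc.
  apply: (le_trans (Hardy_itv r0 rd dv cg)); apply: leeD.
    apply: lee_wpmul2l => //; apply: ge0_subset_integral => //.
    - apply/measurable_EFinP; apply: measurable_funTS; apply: continuous_measurable_fun.
      by move=> t; apply: continuousM; exact: cg.
    - by move=> x _; rewrite lee_fin sqr_ge0.
    - by move=> x /=; rewrite !in_itv/= => /andP[h ->]; rewrite andbT (le_trans _ h)// ltW.
  rewrite lee_fin ler_pM2l// ler_pdivrMr// mulrAC -expr2; apply: vM.
  by rewrite in_itv/= rd ltW.
have H2 : (\int[mu]_(x in `[0%R, r]) (v x ^+ 2 / x ^+ 2)%:E <= (r * M)%:E)%E.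
  apply: (@le_trans _ _ (\int[mu]_(t in `[0%R, r]) M%:E)%E).
    apply: ge0_le_integral => //.
    - by move=> t _; rewrite lee_fin divr_ge0 ?sqr_ge0.
    - exact: measurable_funTS.
    - move=> t /=; rewrite in_itv/= => /andP[t0 tx]; rewrite lee_fin.
      move: t0; rewrite le_eqVlt => /predU1P[<-|t0]; first by rewrite expr0n/= invr0 mulr0.
      rewrite ler_pdivrMr ?exprn_gt0// mulrC vM// in_itv/= ltW//=.
      exact: le_trans rd.
  by rewrite (integral_cst_itv _ (ltW r0)) subr0 mulrC.
apply: (le_trans (leeD H1 H2)); rewrite -addeA leeD2l// -EFinD lee_fin.
by apply: le_trans re; lra.
Qed.

End one_variable.

(** * Trace inequalities *)

Section trace_inequality.
Context {R : realType}.
Local Notation mu := (@lebesgue_measure R).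
Local Notation P2 := (R^o * R^o)%type.

Lemma continuous_section1 (F : P2 -> R) (t : R) : continuous F ->
  continuous (fun s : R => F (s, t)).
Proof.
move=> cF s; apply: (@continuous_comp R^o P2 R (fun s => (s, t)) F s); last exact: cF.
by move=> A [[A1 A2] /= [sA1 tA2] AA]; apply: filterS sA1 => u uA1; apply: AA;
  split => //=; exact: nbhs_singleton.
Qed.

Lemma continuous_section2 (F : P2 -> R) (s : R) : continuous F ->
  continuous (fun t : R => F (s, t)).
Proof.
move=> cF t; apply: (@continuous_comp R^o P2 R (fun t => (s, t)) F t); last exact: cF.
by move=> A [[A1 A2] /= [sA1 tA2] AA]; apply: filterS tA2 => u uA1; apply: AA;
  split => //=; exact: nbhs_singleton.
Qed.

(** The partial derivatives are explicit functions, so that shifted, reflected and transposed copies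
    of a [C^1] function can be carried along with their derivatives. *)
Record C1xy (w p q : P2 -> R) : Prop := {
  C1xy_d1 : forall s t : R, is_derive s 1 (fun s : R => w (s, t)) (p (s, t));
  C1xy_d2 : forall s t : R, is_derive t 1 (fun t : R => w (s, t)) (q (s, t));
  C1xy_cw : continuous w;
  C1xy_cp : continuous p;
  C1xy_cq : continuous q }.

Definition sq (d : R) : set (R * R) := `[0, d] `*` `[0, d].

Definition dirichlet (D : set (R * R)) (p q : R * R -> R) : \bar R :=
  (\int[@leb2 R]_(z in D) (p z ^+ 2 + q z ^+ 2)%:E)%E.

Lemma measurable_sq (d : R) : measurable (sq d).
Proof. exact: measurableX. Qed.

(** The distance [|x - y|] takes each value at most once on either side of [y]. *)
Lemma ge0_integral_dist_le (d y : R) (psi : R -> \bar R) :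
  measurable_fun [set: R] psi -> (forall h, 0 <= psi h)%E -> 0 <= y -> y <= d ->
  (\int[mu]_(x in `[0%R, d]) psi `|x - y|%R <=
   2%:E * \int[mu]_(h in `[0%R, d]) psi h)%E.
Proof.
move=> mpsi psi0 y0 yd.
have mabs : measurable_fun [set: R] (fun x => psi `|x - y|).
  apply: measurableT_comp => //; apply: measurableT_comp => //.
  exact: measurable_funB.
rewrite (_ : `[0, d]%classic = `[0, y]%classic `|` `]y, d]%classic); last first.
  by rewrite -itv_bndbnd_setU// bnd_simp.
rewrite ge0_integral_setU//=; last 2 first.
- exact: measurable_funTS.
- by apply/disj_setPS => x [] /=; rewrite !in_itv/= => /andP[_ h] /andP[]; rewrite ltNge h.
rewrite (_ : `[0, y]%classic `|` `]y, d]%classic = `[0, d]%classic); last first.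
  by rewrite -itv_bndbnd_setU// bnd_simp.
have mpsiD D : measurable_fun D psi by exact: measurable_funTS.
have sub a : a <= d -> (\int[mu]_(h in `[0%R, a]) psi h <= \int[mu]_(h in `[0%R, d]) psi h)%E.
  move=> ad; apply: ge0_subset_integral => //; first exact: mpsiD.
  by move=> x /=; rewrite !in_itv/= => /andP[-> h]; exact: le_trans ad.
have H1 : (\int[mu]_(x in `[0%R, y]) psi `|x - y|%R <= \int[mu]_(h in `[0%R, d]) psi h)%E.
  apply: le_trans (sub _ yd).
  rewrite -(@ge0_integral_refl _ y `[0, y] psi)//.
  rewrite -[X in (_ @^-1` `[X, _])%E](subrr y) -[X in (_ @^-1` `[_, X])%E](subr0 y) refl_itv.
  apply: ge0_le_integral => //.
  - exact: measurable_funTS.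
  - apply: measurable_funTS; apply: measurableT_comp => //; exact: measurable_funB.
  - move=> x /=; rewrite in_itv/= => /andP[_ xy].
    by rewrite distrC ger0_norm ?subr_ge0.
have H2 : (\int[mu]_(x in `]y, d]) psi `|x - y|%R <= \int[mu]_(h in `[0%R, d]) psi h)%E.
  have ady : d - y <= d by lra.
  apply: le_trans (sub _ ady).
  rewrite -(@ge0_integral_shift _ (- y) `[0, d - y] psi)//.
  rewrite -{1}(addNr y) (addrC d) shift_itv.
  apply: (@le_trans _ _ (\int[mu]_(x in `[y, d]) psi `|x - y|%R)%E).
    apply: ge0_subset_integral => //; first exact: measurable_funTS.
    exact: subset_itv_oc_cc.
  apply: ge0_le_integral => //.
  - exact: measurable_funTS.
  - apply: measurable_funTS; apply: measurableT_comp => //; exact: measurable_funD.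
  - move=> x /=; rewrite in_itv/= => /andP[yx _].
    by rewrite ger0_norm ?subr_ge0// addrC.
by rewrite mule_natl mule2n leeD.
Qed.

Lemma measurable_integral_snd (D : set R) (f : R * R -> R) :
  measurable D -> measurable_fun [set: R * R] f -> (forall z, 0 <= f z) ->
  measurable_fun [set: R] (fun x => \int[mu]_(t in D) (f (x, t))%:E)%E.
Proof.
move=> mD mf f0.
pose g (z : R * R) := (f z * \1_D z.2)%:E.
have mg : measurable_fun [set: R * R] g.
  apply/measurable_EFinP; apply: measurable_funM => //.
  by apply: measurableT_comp => //; exact: measurable_indic.
have g0 z : (0 <= g z)%E by rewrite lee_fin mulr_ge0.
have := @measurable_fun_fubini_tonelli_F _ _ _ _ _ lebesgue_measure g mg g0.
congr measurable_fun; apply/funext => x; rewrite /fubini_F [RHS]integral_mkcond.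
apply: eq_integral => t _; rewrite patchE /g /=.
by rewrite indicE; case: (t \in D); rewrite ?mulr1 ?mulr0.
Qed.

Lemma measurable_integral_fst (D : set R) (f : R * R -> R) :
  measurable D -> measurable_fun [set: R * R] f -> (forall z, 0 <= f z) ->
  measurable_fun [set: R] (fun y => \int[mu]_(t in D) (f (t, y))%:E)%E.
Proof.
move=> mD mf f0.
have mf2 : measurable_fun [set: R * R] (fun z => f (z.2, z.1)).
  apply: (measurableT_comp mf); apply: measurable_fun_pair => //.
exact: (measurable_integral_snd mD mf2).
Qed.

Variables (w p q : P2 -> R) (Cw : C1xy w p q) (d : R) (d0 : 0 < d).

Let mp2 : measurable_fun [set: R * R] (fun z => (p z ^+ 2)%:E).
Proof.
apply/measurable_EFinP; apply: measurable_funX.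
by apply: continuous_measurable2; case: Cw.
Qed.

Let mq2 : measurable_fun [set: R * R] (fun z => (q z ^+ 2)%:E).
Proof.
apply/measurable_EFinP; apply: measurable_funX.
by apply: continuous_measurable2; case: Cw.
Qed.

Let Ep : (\int[@leb2 R]_(z in sq d) (p z ^+ 2)%:E <= dirichlet (sq d) p q)%E.
Proof.
apply: ge0_le_integral => //; first exact: measurable_sq.
- by move=> z _; rewrite lee_fin sqr_ge0.
- exact: measurable_funTS.
- apply: measurable_funTS.
  by under eq_fun do rewrite EFinD; apply: emeasurable_funD.
- by move=> z _; rewrite lee_fin lerDl sqr_ge0.
Qed.

Let Eq : (\int[@leb2 R]_(z in sq d) (q z ^+ 2)%:E <= dirichlet (sq d) p q)%E.
Proof.
apply: ge0_le_integral => //; first exact: measurable_sq.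
- by move=> z _; rewrite lee_fin sqr_ge0.
- exact: measurable_funTS.
- apply: measurable_funTS.
  by under eq_fun do rewrite EFinD; apply: emeasurable_funD.
- by move=> z _; rewrite lee_fin lerDr sqr_ge0.
Qed.

Let cp1 t : continuous (fun s : R => p (s, t)).
Proof. by apply: continuous_section1; case: Cw. Qed.

Let cq2 s : continuous (fun t : R => q (s, t)).
Proof. by apply: continuous_section2; case: Cw. Qed.

Let measurable_restrict_itv (f : R -> R) (a b : R) : continuous f ->
  measurable_fun `[a, b] (fun x => (f x ^+ 2)%:E).
Proof.
move=> cf; apply/measurable_EFinP/measurable_funTS/measurable_funX.
exact: continuous_measurable_fun.
Qed.

Let cw1 : continuous (fun x : R => w (x, 0)).
Proof. by apply: continuous_section1; case: Cw. Qed.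

Let cw2 : continuous (fun x : R => w (0, x)).
Proof. by apply: continuous_section2; case: Cw. Qed.

Let integral_sub_le (f : R -> R) (a : R) : continuous f -> a <= d ->
  (\int[mu]_(x in `[0%R, a]) (f x ^+ 2)%:E <= \int[mu]_(x in `[0%R, d]) (f x ^+ 2)%:E)%E.
Proof.
move=> cf ad; apply: ge0_subset_integral => //; first exact: measurable_restrict_itv.
  by move=> x _; rewrite lee_fin sqr_ge0.
by move=> x /=; rewrite !in_itv/= => /andP[-> h]; exact: le_trans ad.
Qed.

Let mp : measurable_fun [set: R * R] p.
Proof. by apply: continuous_measurable2; case: Cw. Qed.

Let mw : measurable_fun [set: R * R] w.
Proof. by apply: continuous_measurable2; case: Cw. Qed.

(* From (x, 0) to (0, x) one goes through (x, x). *)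
Lemma trace_corner :
  (\int[mu]_(x in `[0%R, d]) ((w (x, 0%R) - w (0%R, x)) ^+ 2 / x)%:E <=
   4%:E * dirichlet (sq d) p q)%E.
Proof.
pose A x := (\int[mu]_(t in `[0%R, d]) (q (x, t) ^+ 2)%:E)%E.
pose B x := (\int[mu]_(s in `[0%R, d]) (p (s, x) ^+ 2)%:E)%E.
have A0 x : (0 <= A x)%E by apply: integral_ge0 => t _; rewrite lee_fin sqr_ge0.
have B0 x : (0 <= B x)%E by apply: integral_ge0 => t _; rewrite lee_fin sqr_ge0.
have mA : measurable_fun [set: R] A.
  apply: (@measurable_integral_snd _ (fun z => q z ^+ 2)) => //.
    exact/measurable_EFinP.
  by move=> z; exact: sqr_ge0.
have mB : measurable_fun [set: R] B.
  apply: (@measurable_integral_fst _ (fun z => p z ^+ 2)) => //.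
    exact/measurable_EFinP.
  by move=> z; exact: sqr_ge0.
apply: (@le_trans _ _ (\int[mu]_(x in `[0%R, d]) (2%:E * (A x + B x)))%E).
  apply: ge0_le_integral => //.
  - by move=> x /=; rewrite in_itv/= => /andP[x0 _]; rewrite lee_fin divr_ge0 ?sqr_ge0.
  - apply: measurable_funTS; apply/measurable_EFinP; apply: measurable_funM.
      apply: measurable_funX; apply: measurable_funB.
        exact: continuous_measurable_fun cw1.
      exact: continuous_measurable_fun cw2.
    exact: measurable_invr.
  - by apply: measurable_funTS; apply: emeasurable_funM => //; exact: emeasurable_funD.
  - move=> x /=; rewrite in_itv/= => /andP[x0 xd].
    move: (x0); rewrite le_eqVlt => /predU1P[<-|x1].
      by rewrite subrr expr0n/= mul0r mule_ge0// adde_ge0.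
    have H1 := sqr_increment_le x0 (C1xy_d2 Cw x) (@cq2 x).
    have H2 := sqr_increment_le x0 (C1xy_d1 Cw ^~ x) (@cp1 x).
    apply: (@le_trans _ _ (2%:E * (((w (x, x) - w (x, 0)) ^+ 2 / x)%:E +
        ((w (x, x) - w (0, x)) ^+ 2 / x)%:E))%E).
      rewrite -EFinD -EFinM lee_fin -mulrDl mulrA ler_pM2r ?invr_gt0//.
      set a := w (x, x) - w (x, 0); set b := w (x, x) - w (0, x).
      rewrite (_ : w (x, 0) - w (0, x) = b - a); last by rewrite /a /b; ring.
      by rewrite -subr_ge0 (_ : _ - _ = (a + b) ^+ 2) ?sqr_ge0//; ring.
    apply: lee_wpmul2l => //; apply: leeD.
      apply: le_trans (integral_sub_le (@cq2 x) xd).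
      by move: H1; rewrite subr0 -lee_pdivrMl// mulrC EFinM.
    apply: le_trans (integral_sub_le (@cp1 x) xd).
    by move: H2; rewrite subr0 -lee_pdivrMl// mulrC EFinM.
rewrite ge0_integralZl//; last 2 first.
- by apply: measurable_funTS; exact: emeasurable_funD.
- by move=> x _; rewrite adde_ge0.
rewrite ge0_integralD//; [|exact: measurable_funTS..].
have -> : (\int[mu]_(x in `[0%R, d]) A x = \int[@leb2 R]_(z in sq d) (q z ^+ 2)%:E)%E.
  by rewrite ge0_integral_prod//; [exact: measurable_funTS|move=> z _; rewrite lee_fin sqr_ge0].
have -> : (\int[mu]_(x in `[0%R, d]) B x = \int[@leb2 R]_(z in sq d) (p z ^+ 2)%:E)%E.
  by rewrite ge0_integral_prod2//; [exact: measurable_funTS|move=> z _; rewrite lee_fin sqr_ge0].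
have -> : 4%:E = (2%:E * 2%:E)%E :> \bar R by rewrite -EFinM; congr EFin; ring.
rewrite -muleA lee_wpmul2l// mule_natl mule2n; exact: leeD.
Qed.

(* From (x, 0) to (y, 0) one goes through the points (x, h) and (y, h) at height
   h = |x - y|; Hardy's inequality bounds the two vertical parts. *)
Lemma trace_edge :
  (\int[mu]_(y in `[0%R, d]) \int[mu]_(x in `[0%R, d])
      ((w (x, 0%R) - w (y, 0%R)) ^+ 2 / (x - y) ^+ 2)%:E <=
   60%:E * dirichlet (sq d) p q)%E.
Proof.
pose psi (x h : R) : R := (w (x, h) - w (x, 0)) ^+ 2 / h ^+ 2.
(* The horizontal part of the path, of length [h], costs by Cauchy-Schwarz the integral of
   [p ^ 2 / h] over the segment at height [h]. Enlarging the segment to all [s] within [h] of [y]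
   gives a bound [W (y, h)] that depends on [x] only through [h]. *)
pose k (z : (R * R) * R) : \bar R :=
  (if (0 <= z.2 <= d) && (`|z.2 - z.1.1| <= z.1.2) then (p (z.2, z.1.2)) ^+ 2 / z.1.2 else 0)%:E.
pose W (z : R * R) := (\int[mu]_s k (z, s))%E.
have psi0 x h : 0 <= psi x h by rewrite divr_ge0 ?sqr_ge0.
have k0 z : (0 <= k z)%E.
  rewrite lee_fin; case: ifP => // /andP[_ h]; rewrite divr_ge0 ?sqr_ge0//.
  exact: le_trans h.
have W0 z : (0 <= W z)%E by apply: integral_ge0.
have mk : measurable_fun [set: (R * R) * R] k.
  apply/measurable_EFinP; apply: measurable_fun_ifT => //.
  - apply: measurable_and; first apply: measurable_and.
    + by apply: measurable_fun_ler.
    + by apply: measurable_fun_ler.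
    + apply: measurable_fun_ler.
        apply: measurableT_comp => //; apply: measurable_funB => //.
        exact: measurableT_comp.
      exact: measurableT_comp.
  - apply: measurable_funM; last first.
      apply: measurableT_comp; first exact: measurable_invr.
      exact: measurableT_comp.
    apply: measurable_funX; apply: (measurableT_comp mp).
    by apply: measurable_fun_pair => //; exact: measurableT_comp.
have mW : measurable_fun [set: R * R] W.
  exact: (@measurable_fun_fubini_tonelli_F _ _ _ _ _ lebesgue_measure k mk k0).
have mdist : measurable_fun [set: R * R] (fun z => `|z.1 - z.2|).
  by apply: measurableT_comp => //; apply: measurable_funB.
have mpsi : measurable_fun [set: R * R] (fun z => (psi z.1 z.2)%:E).
  apply/measurable_EFinP; apply: measurable_funM; last first.
    apply: measurableT_comp; first exact: measurable_invr.
    exact: measurable_funX.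
  apply: measurable_funX; apply: measurable_funB.
    by apply: (measurableT_comp mw); exact: measurable_fun_pair.
  by apply: (measurableT_comp mw); exact: measurable_fun_pair.
pose F (z : R * R) : \bar R := ((w (z.1, 0%R) - w (z.2, 0%R)) ^+ 2 / (z.1 - z.2) ^+ 2)%:E.
pose G1 (z : R * R) : \bar R := (psi z.1 `|z.1 - z.2|)%:E.
pose G2 (z : R * R) : \bar R := (psi z.2 `|z.1 - z.2|)%:E.
pose G3 (z : R * R) : \bar R := W (z.2, `|z.1 - z.2|).
have mG1 : measurable_fun [set: R * R] G1.
  apply: (measurableT_comp mpsi (f := fun z : R * R => (psi z.1 z.2)%:E)
    (g := fun z : R * R => (z.1, `|z.1 - z.2|))).
  exact: measurable_fun_pair.
have mG2 : measurable_fun [set: R * R] G2.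
  apply: (measurableT_comp mpsi (f := fun z : R * R => (psi z.1 z.2)%:E)
    (g := fun z : R * R => (z.2, `|z.1 - z.2|))).
  exact: measurable_fun_pair.
have mG3 : measurable_fun [set: R * R] G3.
  by apply: (measurableT_comp mW); exact: measurable_fun_pair.
have mF : measurable_fun [set: R * R] F.
  apply/measurable_EFinP; apply: measurable_funM; last first.
    apply: measurableT_comp; first exact: measurable_invr.
    by apply: measurable_funX; apply: measurable_funB.
  apply: measurable_funX; apply: measurable_funB.
    by apply: (measurableT_comp mw); exact: measurable_fun_pair.
  by apply: (measurableT_comp mw); exact: measurable_fun_pair.
have F0 z : (0 <= F z)%E by rewrite lee_fin divr_ge0 ?sqr_ge0.
have FG z : sq d z -> (F z <= 3%:E * (G1 z + G2 z + G3 z))%E.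
  case: z => x y [/=]; rewrite !in_itv/= => /andP[x0 xd] /andP[y0 yd].
  have [xy|xy] := eqVneq x y.
    apply: (@le_trans _ _ 0%E); first by rewrite /F /= xy !subrr expr0n/= mul0r.
    apply: mule_ge0 => //; apply: adde_ge0; last exact: W0.
    by apply: adde_ge0; rewrite lee_fin; exact: psi0.
  set h := `|x - y|; have h0 : 0 < h by rewrite normr_gt0 subr_eq0.
  have hd : h <= d by rewrite ler_norml; lra.
  have key lo hi : 0 <= lo -> lo < hi -> hi <= d -> hi - lo = h ->
      (forall s, lo <= s <= hi -> `|s - y| <= h) ->
      (((w (hi, h) - w (lo, h)) ^+ 2 / h ^+ 2)%:E <= W (y, h))%E.
    move=> lo0 lohi hid hlo sy.
    have := sqr_increment_le (ltW lohi) (C1xy_d1 Cw ^~ h) (@cp1 h).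
    rewrite hlo -lee_pdivrMl// => H.
    have -> : (w (hi, h) - w (lo, h)) ^+ 2 / h ^+ 2 =
        h^-1 * (h^-1 * (w (hi, h) - w (lo, h)) ^+ 2).
      by field; rewrite gt_eqF.
    rewrite EFinM; apply: (@le_trans _ _ (h^-1%:E *
        \int[mu]_(s in `[lo, hi]) ((p (s, h) ^+ 2)%:E))%E).
      by rewrite lee_wpmul2l// lee_fin invr_ge0 ltW.
    rewrite -ge0_integralZl//; last 3 first.
    - exact: measurable_restrict_itv.
    - by move=> s _; rewrite lee_fin sqr_ge0.
    - by rewrite lee_fin invr_ge0 ltW.
    apply: (@le_trans _ _ (\int[mu]_(s in `[lo, hi]) k ((y, h), s))%E).
      rewrite le_eqVlt; apply/orP; left; apply/eqP; apply: eq_integral => s.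
      rewrite inE /= in_itv/= => /andP[los shi].
      rewrite /k /= (le_trans lo0 los) (le_trans shi hid)/= sy ?los//.
      by rewrite -EFinM mulrC.
    apply: ge0_subset_integral => //.
    by apply: (measurableT_comp mk); exact: measurable_fun_pair.
  have H3 : (((w (x, h) - w (y, h)) ^+ 2 / h ^+ 2)%:E <= G3 (x, y))%E.
    case: (ltgtP x y) xy => // xy _.
    - rewrite -sqrrN opprB; apply: key => //.
        by rewrite /h ltr0_norm ?subr_lt0// opprB.
      by move=> s /andP[? ?]; rewrite /h (ltr0_norm (x := x - y)) ?subr_lt0// ler_norml; lra.
    - apply: key => //; first by rewrite /h gtr0_norm ?subr_gt0.
      by move=> s /andP[? ?]; rewrite /h (gtr0_norm (x := x - y)) ?subr_gt0// ler_norml; lra.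
  apply: (@le_trans _ _ (3%:E * (G1 (x, y) + G2 (x, y) + ((w (x, h) - w (y, h)) ^+ 2 / h ^+ 2)%:E))%E); last first.
    by rewrite lee_wpmul2l// leeD2l.
  rewrite /F /G1 /G2 /psi /= -/h -!EFinD -EFinM lee_fin.
  have -> : (x - y) ^+ 2 = h ^+ 2 by rewrite /h real_normK ?num_real.
  rewrite -!mulrDl mulrA ler_pM2r ?invr_gt0 ?exprn_gt0//.
  set a := w (x, h) - w (x, 0); set b := w (y, h) - w (y, 0); set m := w (x, h) - w (y, h).
  rewrite (_ : w (x, 0) - w (y, 0) = b - a + m); last by rewrite /a /b /m; ring.
  rewrite -subr_ge0 (_ : _ - _ = (a + b) ^+ 2 + (a + m) ^+ 2 + (b - m) ^+ 2); last by ring.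
  by rewrite !addr_ge0 ?sqr_ge0.
rewrite -(@ge0_integral_prod2 _ _ _ F)//; last exact: measurable_funTS.
apply: (@le_trans _ _ (\int[@leb2 R]_(z in sq d) (3%:E * (G1 z + G2 z + G3 z)))%E).
  apply: ge0_le_integral => //; first exact: measurable_sq.
  - exact: measurable_funTS.
  - apply: measurable_funTS; apply: emeasurable_funM => //.
    by apply: emeasurable_funD => //; exact: emeasurable_funD.
have G10 z : (0 <= G1 z)%E by rewrite lee_fin.
have G30 z : (0 <= G3 z)%E by exact: W0.
have G20 z : (0 <= G2 z)%E by rewrite lee_fin.
have mG12 : measurable_fun [set: R * R] (fun z => G1 z + G2 z)%E by exact: emeasurable_funD.
rewrite ge0_integralZl//; last 3 first.
- exact: measurable_sq.
- by apply: measurable_funTS; exact: emeasurable_funD.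
- by move=> x _; apply: adde_ge0; [exact: adde_ge0|exact: W0].
have msq := @measurable_sq d.
rewrite ge0_integralD//; [|by move=> x _; exact: adde_ge0|exact: measurable_funTS..].
rewrite ge0_integralD//; [|exact: measurable_funTS..].
have Hpsi x : (\int[mu]_(h in `[0%R, d]) (psi x h)%:E <=
    4%:E * \int[mu]_(t in `[0%R, d]) (q (x, t) ^+ 2)%:E)%E.
  apply: (Hardy (v := fun h => w (x, h) - w (x, 0)) (g := fun h => q (x, h))) => //.
  - exact: ltW.
  - by rewrite subrr.
  - move=> t; have D := C1xy_d2 Cw x t.
    rewrite -[X in is_derive _ _ _ X]subr0; apply: is_deriveB.
have mpsix x : measurable_fun [set: R] (fun h => (psi x h)%:E).
  by apply: (measurableT_comp mpsi (f := fun z : R * R => (psi z.1 z.2)%:E)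
    (g := fun h : R => (x, h))); exact: measurable_fun_pair.
have H1 x : x \in `[0, d] -> (\int[mu]_(y in `[0%R, d]) G1 (x, y) <=
    8%:E * \int[mu]_(t in `[0%R, d]) (q (x, t) ^+ 2)%:E)%E.
  rewrite in_itv/= => /andP[x0 xd].
  rewrite /G1 /=; under eq_integral do rewrite distrC.
  apply: (le_trans (ge0_integral_dist_le (mpsix x) _ x0 xd)).
    by move=> h; rewrite lee_fin.
  have -> : 8%:E = (2%:E * 4%:E)%E :> \bar R by rewrite -EFinM; congr EFin; ring.
  by rewrite -muleA lee_wpmul2l.
have H2 y : y \in `[0, d] -> (\int[mu]_(x in `[0%R, d]) G2 (x, y) <=
    8%:E * \int[mu]_(t in `[0%R, d]) (q (y, t) ^+ 2)%:E)%E.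
  rewrite in_itv/= => /andP[x0 xd].
  apply: (le_trans (ge0_integral_dist_le (mpsix y) _ x0 xd)).
    by move=> h; rewrite lee_fin.
  have -> : 8%:E = (2%:E * 4%:E)%E :> \bar R by rewrite -EFinM; congr EFin; ring.
  by rewrite -muleA lee_wpmul2l.
have mA : measurable_fun [set: R] (fun x => \int[mu]_(t in `[0%R, d]) (q (x, t) ^+ 2)%:E)%E.
  apply: (@measurable_integral_snd _ (fun z => q z ^+ 2)) => //.
    exact/measurable_EFinP.
  by move=> z; exact: sqr_ge0.
have IA : (\int[mu]_(x in `[0%R, d]) (8%:E * \int[mu]_(t in `[0%R, d]) (q (x, t) ^+ 2)%:E) <=
    8%:E * dirichlet (sq d) p q)%E.
  rewrite ge0_integralZl//; last 2 first.
  - exact: measurable_funTS.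
  - by move=> x _; apply: integral_ge0 => t _; rewrite lee_fin sqr_ge0.
  rewrite lee_wpmul2l// (le_trans _ Eq)//.
  by rewrite ge0_integral_prod//; [exact: measurable_funTS|move=> z _; rewrite lee_fin sqr_ge0].
have mI1 (G : R * R -> \bar R) : measurable_fun [set: R * R] G -> (forall z, 0 <= G z)%E ->
    measurable_fun [set: R] (fun x => \int[mu]_(y in `[0%R, d]) G (x, y))%E.
  move=> mG G0.
  have := @measurable_fun_fubini_tonelli_F _ _ _ _ _ lebesgue_measure
    (G \_ ([set: R] `*` `[0, d])) _ _.
  rewrite (_ : fubini_F _ _ = (fun x => \int[mu]_(y in `[0%R, d]) G (x, y))%E).
    apply; last by move=> z; apply: erestrict_ge0.
    by apply: (measurable_restrictT _ _).1; [exact: measurableX|exact: measurable_funTS].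
  apply/funext => x; rewrite /fubini_F [RHS]integral_mkcond; apply: eq_integral => y _.
  by rewrite !patchE in_setX in_setT.
have mI2 (G : R * R -> \bar R) : measurable_fun [set: R * R] G -> (forall z, 0 <= G z)%E ->
    measurable_fun [set: R] (fun y => \int[mu]_(x in `[0%R, d]) G (x, y))%E.
  move=> mG G0.
  apply: (mI1 (fun z => G (z.2, z.1))) => //.
  by apply: (measurableT_comp mG); exact: measurable_fun_pair.
have I1 : (\int[@leb2 R]_(z in sq d) G1 z <= 8%:E * dirichlet (sq d) p q)%E.
  apply: le_trans IA.
  rewrite ge0_integral_prod//; last exact: measurable_funTS.
  apply: ge0_le_integral => //.
  - by move=> x _; apply: integral_ge0.
  - by apply: measurable_funTS; exact: mI1.
  - by apply: measurable_funTS; exact: emeasurable_funM.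
have I2 : (\int[@leb2 R]_(z in sq d) G2 z <= 8%:E * dirichlet (sq d) p q)%E.
  apply: le_trans IA.
  rewrite ge0_integral_prod2//; last exact: measurable_funTS.
  apply: ge0_le_integral => //.
  - by move=> x _; apply: integral_ge0.
  - by apply: measurable_funTS; exact: mI2.
  - by apply: measurable_funTS; exact: emeasurable_funM.
have I3 : (\int[@leb2 R]_(z in sq d) G3 z <= 4%:E * dirichlet (sq d) p q)%E.
  apply: (@le_trans _ _ (2%:E * \int[@leb2 R]_(z in sq d) W z)%E).
    rewrite (ge0_integral_prod2 (f := G3))//; last exact: measurable_funTS.
    rewrite (ge0_integral_prod (f := W))//; last exact: measurable_funTS.
    rewrite -ge0_integralZl//; last 2 first.
    - by apply: measurable_funTS; exact: mI1.
    - by move=> x _; apply: integral_ge0.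
    apply: ge0_le_integral => //.
    - by move=> x _; apply: integral_ge0.
    - by apply: measurable_funTS; exact: mI2.
    - by apply: measurable_funTS; apply: emeasurable_funM => //; exact: mI1.
    - move=> y /=; rewrite in_itv/= => /andP[y0 yd].
      apply: (ge0_integral_dist_le (psi := fun h => W (y, h))) => //.
      by apply: (measurableT_comp mW); exact: measurable_fun_pair.
  have -> : 4%:E = (2%:E * 2%:E)%E :> \bar R by rewrite -EFinM; congr EFin; ring.
  rewrite -muleA lee_wpmul2l//.
  rewrite (ge0_integral_prod2 (f := W))//; last exact: measurable_funTS.
  apply: (@le_trans _ _ (\int[mu]_(h in `[0%R, d]) \int[mu]_(s in `[0%R, d]) (2 * p (s, h) ^+ 2)%:E)%E).
    apply: ge0_le_integral => //.
    - by move=> x _; apply: integral_ge0.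
    - by apply: measurable_funTS; exact: mI2.
    - apply: measurable_funTS; apply: (mI2 (fun z => (2 * p z ^+ 2)%:E)).
        by apply/measurable_EFinP; apply: measurable_funM => //; exact: measurable_funX.
      by move=> z; rewrite lee_fin mulr_ge0 ?sqr_ge0.
    - move=> h /=; rewrite in_itv/= => /andP[h0 hd].
      have mkh : measurable_fun [set: R * R] (fun z => k ((z.1, h), z.2)).
        apply: (measurableT_comp mk); apply: measurable_fun_pair => //.
        exact: measurable_fun_pair.
      rewrite /W -(ge0_integral_prod (B := setT) (f := fun z : R * R => k ((z.1, h), z.2)))//; last exact: measurable_funTS.
      rewrite (ge0_integral_prod2 (B := setT) (f := fun z : R * R => k ((z.1, h), z.2)))//; last exact: measurable_funTS.
      rewrite [leRHS]integral_mkcond.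
      apply: ge0_le_integral => //.
      + by move=> s _; apply: integral_ge0.
      + exact: (mI2 (fun z : R * R => k ((z.1, h), z.2))).
      + apply/(measurable_restrictT _ _).1 => //; apply/measurable_EFinP.
        apply: measurable_funTS; apply: measurable_funM => //.
        apply: measurable_funX; apply: continuous_measurable_fun; exact: cp1.
      + move=> s _ /=; rewrite patchE; case: ifPn => [|sd]; last first.
          rewrite integral0_eq// => y _; rewrite /k /= ifF//.
          by move: sd; rewrite notin_setE /= in_itv/= => /negP/negbTE ->.
        rewrite inE /= in_itv/= => sd.
        (* For fixed [s] and [h] the admissible [y] lie in an interval of length [2 h], which
           cancels the [1 / h] of the kernel. *)
        apply: (@le_trans _ _ (\int[mu]_(y in `[(s - h)%R, (s + h)%R]) (p (s, h) ^+ 2 / h)%:E)%E).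
          rewrite [leRHS]integral_mkcond.
          rewrite (_ : ((fun=> (p (s, h) ^+ 2 / h)%:E) \_ `[s - h, s + h]) = (fun y => k ((y, h), s))).
            apply: ge0_subset_integral => //.
            apply: (measurableT_comp mkh (f := fun z : R * R => k ((z.1, h), z.2)) (g := fun y : R => (y, s))).
            exact: measurable_fun_pair.
          apply/funext => y; rewrite patchE /k /= sd /=.
          rewrite (_ : (y \in `[s - h, s + h]%classic) = (`|s - y| <= h)); first by case: ifP.
          by apply/idP/idP; rewrite inE /= in_itv/= ler_norml => /andP[? ?]; apply/andP; split; lra.
        rewrite integral_cst_itv; last by lra.
        have [->|h1] := eqVneq h 0; first by rewrite invr0 mulr0 mul0r lee_fin mulr_ge0 ?sqr_ge0.
        by rewrite lee_fin (_ : _ * _ = 2 * p (s, h) ^+ 2)//; field.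
  rewrite -(ge0_integral_prod2 (f := fun z => (2 * p z ^+ 2)%:E))//; last 2 first.
  - by apply: measurable_funTS; apply/measurable_EFinP; apply: measurable_funM => //; exact: measurable_funX.
  - by move=> z _; rewrite lee_fin mulr_ge0 ?sqr_ge0.
  under eq_integral do rewrite EFinM.
  rewrite ge0_integralZl//; last 2 first.
  - exact: measurable_funTS.
  - by move=> z _; rewrite lee_fin sqr_ge0.
  by rewrite lee_wpmul2l.
(* The 3 comes from splitting the path into three pieces. Each 8 is Hardy's constant 4 times the two
   points at a given distance; the 4 is this same factor 2 times the 2 left by [2 h / h]. *)
have -> : 60%:E = (3%:E * (8%:E + 8%:E + 4%:E))%E :> \bar R.
  by rewrite -!EFinD -EFinM; congr EFin; ring.
rewrite -muleA; apply: lee_wpmul2l => //; rewrite !ge0_muleDl// ?adde_ge0//.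
by apply: leeD => //; exact: leeD.
Qed.

End trace_inequality.

(** * Lower semicontinuity of weighted integrals and the partition of the plane into squares *)

Section integral_tools.
Context {R : realType}.
Local Notation mu := (@lebesgue_measure R).
Local Notation P2 := (R^o * R^o)%type.

Lemma le_cvg0 (x C : \bar R) (r : nat -> \bar R) : r n @[n --> \oo] --> 0%E ->
  (forall n, x <= C + r n)%E -> (x <= C)%E.
Proof.
move=> r0 xC; case: C xC => [C| |] xC; last 2 first.
- exact: leey.
- have r1 : \forall n \near \oo, r n \is a fin_num by move/fine_cvgP : r0 => [].
  have [n _ /(_ n (leqnn n)) rn] := r1.
  by move: (xC n); rewrite -(fineK rn).
have h : (C%:E + r n)%E @[n --> \oo] --> (C%:E + 0)%E.
  by apply: cvgeD => //; exact: cvg_cst.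
rewrite -[leRHS]adde0 -(cvg_lim _ h)//; apply: lime_ge; last exact: nearW.
by apply/cvg_ex; exists (C%:E + 0)%E.
Qed.

(* Truncating the weight at M makes the left-hand side continuous for the L^2
   convergence of An; then M goes to infinity. *)
Lemma weighted_integral_lsc d (T : measurableType d) (m : {measure set T -> \bar R})
    (D : set T) (wt A : T -> R) (An : nat -> T -> R) (C : \bar R) (r : nat -> \bar R) :
  measurable D -> measurable_fun D wt -> (forall x, D x -> 0 <= wt x) ->
  measurable_fun D A -> (forall n, measurable_fun D (An n)) ->
  (\int[m]_(x in D) ((An n x - A x) ^+ 2)%:E)%E @[n --> \oo] --> 0%E ->
  r n @[n --> \oo] --> 0%E -> (0 <= C)%E -> (forall n, 0 <= r n)%E ->
  (forall n, \int[m]_(x in D) ((An n x) ^+ 2 * wt x)%:E <= C + r n)%E ->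
  (\int[m]_(x in D) ((A x) ^+ 2 * wt x)%:E <= 2%:E * C)%E.
Proof.
move=> mD mwt wt0 mA mAn AnA r0 C0 rge0 bnd.
pose wM (M : nat) x := Num.min (wt x) M%:R.
have wM0 M x : D x -> 0 <= wM M x by move=> Dx; rewrite le_min wt0//=.
have mwM M : measurable_fun D (wM M) by apply: measurable_minr.
have mB M (B : T -> R) : measurable_fun D B -> measurable_fun D (fun x => (B x ^+ 2 * wM M x)%:E).
  move=> mB; apply/measurable_EFinP; apply: measurable_funM => //.
  exact: measurable_funX.
have key M : (\int[m]_(x in D) ((A x) ^+ 2 * wM M x)%:E <= 2%:E * C)%E.
  pose s n := (2%:E * r n + (2 * M%:R)%:E * \int[m]_(x in D) ((An n x - A x) ^+ 2)%:E)%E.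
  have s0 : s n @[n --> \oo] --> 0%E.
    rewrite -[X in _ --> X]adde0; apply: cvgeD => //.
      by rewrite -[X in _ --> X](mule0 2%:E); apply: cvgeZl.
    by rewrite -[X in _ --> X](mule0 (2 * M%:R)%:E); apply: cvgeZl.
  apply: (le_cvg0 s0) => n.
  apply: (@le_trans _ _ (\int[m]_(x in D) ((2 * (An n x ^+ 2 * wt x))%:E +
      ((2 * M%:R) * (An n x - A x) ^+ 2)%:E))%E).
    apply: ge0_le_integral => //.
    - by move=> x Dx; rewrite lee_fin mulr_ge0 ?sqr_ge0 ?wM0.
    - exact: mB.
    - under eq_fun do rewrite -EFinD; apply/measurable_EFinP; apply: measurable_funD.
        apply: measurable_funM => //; apply: measurable_funM => //; exact: measurable_funX.
      apply: measurable_funM => //; apply: measurable_funX; exact: measurable_funB.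
    - move=> x Dx; rewrite -EFinD lee_fin.
      have h1 : wM M x <= wt x by rewrite ge_min lexx.
      have h2 : wM M x <= M%:R by rewrite ge_min lexx orbT.
      have h3 := wM0 M x Dx.
      apply: (@le_trans _ _ (2 * (An n x ^+ 2 * wM M x) + 2 * (wM M x * (An n x - A x) ^+ 2))).
        rewrite -subr_ge0 (_ : _ - _ = wM M x * (An n x *+ 2 - A x) ^+ 2); last by ring.
        by rewrite mulr_ge0 ?sqr_ge0.
      apply: lerD; first by rewrite ler_pM2l// ler_wpM2l ?sqr_ge0.
      by rewrite -mulrA ler_pM2l// ler_wpM2r ?sqr_ge0.
  rewrite ge0_integralD//; last 4 first.
  - by move=> x Dx; rewrite lee_fin mulr_ge0// mulr_ge0 ?sqr_ge0 ?wt0//.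
  - apply/measurable_EFinP; apply: measurable_funM => //; apply: measurable_funM => //.
    exact: measurable_funX.
  - by move=> x Dx; rewrite lee_fin mulr_ge0 ?sqr_ge0// mulr_ge0//.
  - apply/measurable_EFinP; apply: measurable_funM => //.
    by apply: measurable_funX; exact: measurable_funB.
  under eq_integral do rewrite EFinM.
  under [X in (_ + X)%E]eq_integral do rewrite EFinM.
  rewrite ge0_integralZl//; last 2 first.
  - by apply/measurable_EFinP; apply: measurable_funM => //; exact: measurable_funX.
  - by move=> x Dx; rewrite lee_fin mulr_ge0 ?sqr_ge0 ?wt0//.
  rewrite ge0_integralZl//; last 2 first.
  - by apply/measurable_EFinP; apply: measurable_funX; exact: measurable_funB.
  - by move=> x Dx; rewrite lee_fin sqr_ge0.
  rewrite /s addeA leeD2r// -ge0_muleDr//.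
  exact: lee_wpmul2l.
have : (\int[m]_(x in D) ((A x) ^+ 2 * wM n x)%:E)%E @[n --> \oo] -->
    (\int[m]_(x in D) limn (fun n => ((A x) ^+ 2 * wM n x)%:E))%E.
  apply: cvg_monotone_convergence => //.
  - by move=> n; exact: mB.
  - by move=> n x Dx; rewrite lee_fin mulr_ge0 ?sqr_ge0 ?wM0.
  - move=> x Dx n1 n2 n12; rewrite lee_fin ler_wpM2l ?sqr_ge0//.
    by rewrite le_min ge_min lexx/= ge_min ler_nat n12 orbT.
have -> : (\int[m]_(x in D) limn (fun n => ((A x) ^+ 2 * wM n x)%:E) =
    \int[m]_(x in D) ((A x) ^+ 2 * wt x)%:E)%E.
  apply: eq_integral => x _; apply/cvg_lim => //.
  apply: cvg_near_cst; exists (Num.bound `|wt x|) => // n /= nb.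
  rewrite /wM min_l//; apply: le_trans (_ : (Num.bound `|wt x|)%:R <= _); last by rewrite ler_nat.
  by apply: (le_trans (ler_norm _)); apply: ltW; apply: archi_boundP.
move=> h; rewrite -(cvg_lim _ h)//; apply: lime_le; last exact: nearW.
by apply/cvg_ex; eexists; exact: h.
Qed.

(** Half-open, so that the squares partition the plane and integrals over them add up exactly. *)
Definition square (d : R) (jk : int * int) : set (R * R) :=
  `[jk.1%:~R * d, (jk.1 + 1)%:~R * d[ `*` `[jk.2%:~R * d, (jk.2 + 1)%:~R * d[.

Lemma measurable_square d jk : measurable (square d jk).
Proof. exact: measurableX. Qed.

Lemma itv_floor (d x : R) (j : int) : 0 < d ->
  (x \in `[j%:~R * d, (j + 1)%:~R * d[) = (Num.floor (x / d) == j).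
Proof.
move=> d0; rewrite in_itv/= -ler_pdivlMr// -ltr_pdivrMr//.
apply/idP/eqP => [h|<-]; first exact: floor_def.
by rewrite floor_le floorD1_gt.
Qed.

Lemma square_floor (d : R) jk z : 0 < d -> square d jk z ->
  jk = (Num.floor (z.1 / d), Num.floor (z.2 / d)).
Proof.
by case: jk => j k d0 [/= h1 h2]; congr pair; apply/esym/eqP; rewrite -itv_floor.
Qed.

(** Countable additivity is indexed by [nat]: the pairs are enumerated by [pickle], and the codes of
    no pair contribute the empty set. *)
Lemma integral_squares (d : R) (e : R * R -> \bar R) : 0 < d ->
  measurable_fun [set: R * R] e -> (forall z, 0 <= e z)%E ->
  (\int[@leb2 R]_z e z = \esum_(jk in [set: int * int]) \int[@leb2 R]_(z in square d jk) e z)%E.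
Proof.
move=> d0 me e0.
pose F (n : nat) : set (R * R) := if @pickle_inv (int * int)%type n is Some jk then square d jk else set0.
have mF n : measurable (F n).
  by rewrite /F; case: pickle_inv => [jk|]; [exact: measurable_square|exact: measurable0].
have tF : trivIset setT F.
  apply/trivIsetP => m n _ _ mn; rewrite /F.
  case Em : (pickle_inv m) => [a|]; last by rewrite set0I.
  case En : (pickle_inv n) => [b|]; last by rewrite setI0.
  apply/seteqP; split => // z [/(square_floor d0) za /(square_floor d0) zb].
  have am := @pickle_invK (int * int)%type m; have bn := @pickle_invK (int * int)%type n.
  by move: am bn mn; rewrite Em En /= za zb => -> ->; rewrite eqxx.
have UF : \bigcup_n F n = setT.
  apply/seteqP; split => // z _.
  have : square d (Num.floor (z.1 / d), Num.floor (z.2 / d)) z.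
    by split; rewrite /square/= itv_floor.
  move: (Num.floor (z.1 / d), Num.floor (z.2 / d)) => jk zjk.
  by exists (pickle jk); [exact: I|rewrite /F pickleK_inv].
rewrite -{1}UF ge0_integral_bigcup//; last by rewrite UF.
rewrite nneseries_esumT; last by move=> n; apply: integral_ge0.
rewrite (esumID (range (@pickle (int * int)%type)))//; last by move=> n _; apply: integral_ge0.
rewrite !setTI [X in (_ + X)%E]esum1 ?adde0; last first.
  move=> n /= nr; rewrite /F; case En : (pickle_inv n) => [b|]; last by rewrite integral_set0.
  by exfalso; apply: nr; exists b => //; have := @pickle_invK (int * int)%type n; rewrite En.
rewrite esum_image; last by move=> x y _ _; exact: (pcan_inj pickleK).
by apply: eq_esum => jk _; rewrite /F pickleK_inv.
Qed.

End integral_tools.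

(** * The four arms and the four squares at a node of the graph *)

Section graph_arms.
Context {R : realType}.
Local Notation mu := (@lebesgue_measure R).
Local Notation P2 := (R^o * R^o)%type.

(* s tells whether the coordinate is reflected: the two values of s and of t give
   the four squares around a node. *)
Definition aff (s : bool) (j : int) (d x : R) : R :=
  if s then j%:~R * d - x else j%:~R * d + x.

(** The index of the edge, or of the row or column of squares, on the chosen side of node [j]. *)
Definition side (s : bool) (j : int) : int := if s then j - 1 else j.

Definition sgnb (s : bool) : R := if s then -1 else 1.

Lemma measurable_aff s j d : measurable_fun [set: R] (aff s j d).
Proof. by case: s; [exact: measurable_refl|exact: measurable_shift]. Qed.

Lemma integral_aff s j (d : R) (g : R -> \bar R) : measurable_fun [set: R] g ->
  (forall x, 0 <= g x)%E ->
  (\int[mu]_(x in `[0%R, d]) g (aff s j d x) =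
   \int[mu]_(x in `[((side s j)%:~R * d)%R, ((side s j + 1)%:~R * d)%R[) g x)%E.
Proof.
move=> mg g0; rewrite integral_itv_bndo_bndc; last exact: measurable_funTS.
case: s; rewrite /aff /side.
  rewrite -[RHS](@ge0_integral_refl _ (j%:~R * d))//; last exact: measurable_funTS.
  rewrite (_ : (j - 1)%:~R * d = j%:~R * d - d); last by rewrite intrD/=; ring.
  rewrite (_ : (j - 1 + 1)%:~R * d = j%:~R * d - 0); last by rewrite subrK; ring.
  by rewrite refl_itv.
rewrite -[RHS](@ge0_integral_shift _ (j%:~R * d))//; last exact: measurable_funTS.
rewrite (_ : (j + 1)%:~R * d = j%:~R * d + d); last by rewrite intrD/=; ring.
by have := shift_itv (j%:~R * d) 0 d; rewrite addr0 => ->.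
Qed.

Lemma integral_aff2 s t j k (d : R) (e : R * R -> \bar R) :
  measurable_fun [set: R * R] e -> (forall z, 0 <= e z)%E ->
  (\int[@leb2 R]_(z in sq d) e (aff s j d z.1, aff t k d z.2) =
   \int[@leb2 R]_(z in square d (side s j, side t k)) e z)%E.
Proof.
move=> me e0.
have me1 x : measurable_fun [set: R] (fun y => e (x, y)).
  by apply: (measurableT_comp me); exact: measurable_fun_pair.
rewrite ge0_integral_prod//; last first.
  apply: measurable_funTS; apply: (measurableT_comp me).
  by apply: measurable_fun_pair => //=; apply: measurableT_comp => //; exact: measurable_aff.
rewrite ge0_integral_prod//; last exact: measurable_funTS.
pose H x := (\int[mu]_(y in `[((side t k)%:~R * d)%R, ((side t k + 1)%:~R * d)%R[) e (x, y))%E.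
transitivity (\int[mu]_(x in `[0%R, d]) H (aff s j d x))%E.
  by apply: eq_integral => x _; exact: (integral_aff t k d (me1 (aff s j d x)) (fun y => e0 _)).
rewrite (integral_aff s j d (g := H))//; last first.
  by move=> x; exact: integral_ge0.
have := @measurable_fun_fubini_tonelli_F _ _ _ _ _ lebesgue_measure
  (e \_ ([set: R] `*` `[(side t k)%:~R * d, (side t k + 1)%:~R * d[)) _ _.
rewrite (_ : fubini_F _ _ = H).
  apply; last by move=> z; apply: erestrict_ge0.
  by apply: (measurable_restrictT _ _).1; [exact: measurableX|exact: measurable_funTS].
apply/funext => x; rewrite /fubini_F [RHS]integral_mkcond; apply: eq_integral => y _.
by rewrite !patchE in_setX in_setT.
Qed.

Lemma is_derive_section1 (u : P2 -> R^o) (x y : R) : differentiable u (x, y) ->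
  is_derive x 1 (fun s : R => u (s, y)) (d1 u (x, y)).
Proof.
move=> du; have duv : derivable u (x, y) (1, 0) by exact: diff_derivable.
have E : (fun h : R => h^-1 *: (((fun s : R => u (s, y)) \o shift x) (h *: 1) - u (x, y))) =
    (fun h : R => h^-1 *: ((u \o shift (x, y)) (h *: (1, 0)) - u (x, y))).
  apply/funext => h; congr (_ *: (_ - _)) => /=.
  by congr u; rewrite /= /shift /=; congr pair; rewrite /= ?add0r//; rewrite /GRing.scale/= mulr0 add0r.
by split; rewrite /derivable /derive /d1 /derive E.
Qed.

Lemma is_derive_section2 (u : P2 -> R^o) (x y : R) : differentiable u (x, y) ->
  is_derive y 1 (fun s : R => u (x, s)) (d2 u (x, y)).
Proof.
move=> du; have duv : derivable u (x, y) (0, 1) by exact: diff_derivable.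
have E : (fun h : R => h^-1 *: (((fun s : R => u (x, s)) \o shift y) (h *: 1) - u (x, y))) =
    (fun h : R => h^-1 *: ((u \o shift (x, y)) (h *: (0, 1)) - u (x, y))).
  apply/funext => h; congr (_ *: (_ - _)) => /=.
  by congr u; rewrite /= /shift /=; congr pair; rewrite /= ?add0r//; rewrite /GRing.scale/= mulr0 add0r.
by split; rewrite /derivable /derive /d2 /derive E.
Qed.

Lemma is_derive_aff s j d (x : R) : is_derive x 1 (aff s j d) (sgnb s).
Proof.
case: s; rewrite /aff /sgnb.
- by rewrite -[X in is_derive _ _ _ X]add0r; apply: is_deriveB.
- by rewrite -[X in is_derive _ _ _ X]add0r; apply: is_deriveD.
Qed.

Lemma continuous_pair_fun (f g : P2 -> R^o) : continuous f -> continuous g ->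
  continuous (fun z => (f z, g z) : P2).
Proof. by move=> cf cg z; exact: (cvg_pair (cf z) (cg z)). Qed.

Lemma continuous_aff2 s t j k (d : R) :
  continuous (fun z : P2 => (aff s j d z.1, aff t k d z.2) : P2).
Proof.
have ca b i : continuous (aff b i d : R -> R).
  by move=> x; have [H _] := is_derive_aff b i d x; exact/differentiable_continuous/derivable1_diffP.
apply: continuous_pair_fun => z.
- by apply: (@continuous_comp P2 R^o R^o fst (aff s j d)); [exact: cvg_fst|exact: ca].
- by apply: (@continuous_comp P2 R^o R^o snd (aff t k d)); [exact: cvg_snd|exact: ca].
Qed.

Lemma C1_C1xy (u : P2 -> R^o) s t j k (d : R) : C1 u ->
  C1xy (fun z => u (aff s j d z.1, aff t k d z.2))
    (fun z => sgnb s * d1 u (aff s j d z.1, aff t k d z.2))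
    (fun z => sgnb t * d2 u (aff s j d z.1, aff t k d z.2)).
Proof.
move=> [du [c1 c2]]; have ca := @continuous_aff2 s t j k d; split.
- move=> x y /=; rewrite mulrC.
  have h := is_derive_section1 (du (aff s j d x, aff t k d y)).
  have := @realfun.is_derive1_comp _ (fun x => u (x, aff t k d y)) (aff s j d) x _ _ h (is_derive_aff s j d x).
  by [].
- move=> x y /=; rewrite mulrC.
  have h := is_derive_section2 (du (aff s j d x, aff t k d y)).
  have := @realfun.is_derive1_comp _ (fun y => u (aff s j d x, y)) (aff t k d) y _ _ h (is_derive_aff t k d y).
  by [].
- move=> z; apply: (@continuous_comp P2 P2 R^o _ u); first exact: ca.
  exact: differentiable_continuous.
- move=> z; apply: (@cvgM _ _ _ _ (cst (sgnb s)) _ _ _); first exact: cvg_cst.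
  by apply: (@continuous_comp P2 P2 R^o _ (d1 u)); [exact: ca|exact: c1].
- move=> z; apply: (@cvgM _ _ _ _ (cst (sgnb t)) _ _ _); first exact: cvg_cst.
  by apply: (@continuous_comp P2 P2 R^o _ (d2 u)); [exact: ca|exact: c2].
Qed.

Lemma C1xy_swap (w p q : P2 -> R) : C1xy w p q ->
  C1xy (fun z => w (z.2, z.1)) (fun z => q (z.2, z.1)) (fun z => p (z.2, z.1)).
Proof.
have cs : continuous (fun z : P2 => (z.2, z.1) : P2).
  by apply: continuous_pair_fun => z; [exact: cvg_snd|exact: cvg_fst].
move=> [h1 h2 cw cp cq]; split => //.
- by move=> s t; exact: h2.
- by move=> s t; exact: h1.
- by move=> z; apply: (@continuous_comp P2 P2 R^o _ w); [exact: cs|exact: cw].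
- by move=> z; apply: (@continuous_comp P2 P2 R^o _ q); [exact: cs|exact: cq].
- by move=> z; apply: (@continuous_comp P2 P2 R^o _ p); [exact: cs|exact: cp].
Qed.

Definition energy_density (u : P2 -> R^o) (z : P2) : \bar R := (d1 u z ^+ 2 + d2 u z ^+ 2)%:E.

Lemma measurable_d1 (u : P2 -> R^o) : C1 u -> measurable_fun [set: R * R] (d1 u).
Proof. by move=> [_ [c1 _]]; exact: continuous_measurable2. Qed.

Lemma measurable_d2 (u : P2 -> R^o) : C1 u -> measurable_fun [set: R * R] (d2 u).
Proof. by move=> [_ [_ c2]]; exact: continuous_measurable2. Qed.

Lemma measurable_energy_density (u : P2 -> R^o) : C1 u ->
  measurable_fun [set: R * R] (energy_density u).
Proof.
move=> cu; apply/measurable_EFinP; apply: measurable_funD; apply: measurable_funX.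
  exact: measurable_d1.
exact: measurable_d2.
Qed.

Lemma energy_density_ge0 (u : P2 -> R^o) z : (0 <= energy_density u z)%E.
Proof. by rewrite lee_fin addr_ge0 ?sqr_ge0. Qed.

(** A reflection changes the sign of a partial derivative, which its square does not see. *)
Lemma dirichlet_aff (u : P2 -> R^o) s t j k (d : R) : C1 u ->
  dirichlet (sq d) (fun z => sgnb s * d1 u (aff s j d z.1, aff t k d z.2))
    (fun z => sgnb t * d2 u (aff s j d z.1, aff t k d z.2)) =
  (\int[@leb2 R]_(z in square d (side s j, side t k)) energy_density u z)%E.
Proof.
move=> cu; rewrite -integral_aff2; last 2 first.
- exact: measurable_energy_density.
- exact: energy_density_ge0.
apply: eq_integral => z _; rewrite /energy_density !exprMn.
have sg b : sgnb b ^+ 2 = 1 by case: b; rewrite /sgnb ?expr1n ?sqrrN ?expr1n.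
by rewrite !sg !mul1r.
Qed.

Lemma trace_corner_arms (u : P2 -> R^o) s t j k (d : R) : 0 < d -> C1 u ->
  (\int[mu]_(x in `[0%R, d])
     ((u (aff s j d x, k%:~R * d) - u (j%:~R * d, aff t k d x)) ^+ 2 / x)%:E <=
   4%:E * \int[@leb2 R]_(z in square d (side s j, side t k)) energy_density u z)%E.
Proof.
move=> d0 cu; rewrite -dirichlet_aff//.
have a0 b i : aff b i d 0 = i%:~R * d by case: b; rewrite /aff ?subr0 ?addr0.
have := trace_corner (C1_C1xy s t j k d cu) d.
by under eq_integral do rewrite /= !a0.
Qed.

Lemma trace_edge_h (u : P2 -> R^o) j k (d : R) : 0 < d -> C1 u ->
  (\int[mu]_(y in `[0%R, d]) \int[mu]_(x in `[0%R, d])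
     ((u (hpt d j k x) - u (hpt d j k y)) ^+ 2 / (x - y) ^+ 2)%:E <=
   60%:E * \int[@leb2 R]_(z in square d (j, k)) energy_density u z)%E.
Proof.
move=> d0 cu.
have := trace_edge (C1_C1xy false false j k d cu) d0.
rewrite (dirichlet_aff false false j k d cu).
by under eq_integral do (under eq_integral do rewrite /= /aff addr0).
Qed.

Lemma dirichlet_swap (p q : R * R -> R) (d : R) :
  measurable_fun [set: R * R] p -> measurable_fun [set: R * R] q ->
  dirichlet (sq d) (fun z => q (z.2, z.1)) (fun z => p (z.2, z.1)) = dirichlet (sq d) p q.
Proof.
move=> mp mq; pose e (z : R * R) : \bar R := (p z ^+ 2 + q z ^+ 2)%:E.
have me : measurable_fun [set: R * R] e.
  by apply/measurable_EFinP; apply: measurable_funD; exact: measurable_funX.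
have e0 z : (0 <= e z)%E by rewrite lee_fin addr_ge0 ?sqr_ge0.
have sw : measurable_fun [set: R * R] (fun z : R * R => (z.2, z.1)) by exact: measurable_fun_pair.
transitivity (\int[@leb2 R]_(z in sq d) (e \o (fun z : R * R => (z.2, z.1))) z)%E.
  by apply: eq_integral => z _; rewrite /e /= addrC.
have mes : measurable_fun [set: R * R] (e \o (fun z : R * R => (z.2, z.1))) by exact: measurableT_comp.
rewrite ge0_integral_prod//; [|exact: measurable_funTS|by move=> z _; exact: e0].
by rewrite /dirichlet (ge0_integral_prod2 (f := e))//; exact: measurable_funTS.
Qed.

Lemma trace_edge_v (u : P2 -> R^o) j k (d : R) : 0 < d -> C1 u ->
  (\int[mu]_(y in `[0%R, d]) \int[mu]_(x in `[0%R, d])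
     ((u (vpt d j k x) - u (vpt d j k y)) ^+ 2 / (x - y) ^+ 2)%:E <=
   60%:E * \int[@leb2 R]_(z in square d (j, k)) energy_density u z)%E.
Proof.
move=> d0 cu.
have cw := C1_C1xy false false j k d cu.
have := trace_edge (C1xy_swap cw) d0.
rewrite (dirichlet_swap d (p := fun z => sgnb false * d1 u (aff false j d z.1, aff false k d z.2))
  (q := fun z => sgnb false * d2 u (aff false j d z.1, aff false k d z.2))); last 2 first.
- exact: (continuous_measurable2 (C1xy_cp cw)).
- exact: (continuous_measurable2 (C1xy_cq cw)).
rewrite (dirichlet_aff false false j k d cu) /side => H; apply: le_trans H.
rewrite le_eqVlt; apply/orP; left; apply/eqP.
apply: eq_integral => y _; apply: eq_integral => x _.
by rewrite /aff addr0.
Qed.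

End graph_arms.

(** * Traces have finite norm *)

Section forward.
Context {R : realType}.
Local Notation mu := (@lebesgue_measure R).
Local Notation P2 := (R^o * R^o)%type.
Variables (d : R) (d0 : 0 < d).

Lemma cvg0_squeeze (x y : nat -> \bar R) : (forall n, 0 <= x n)%E ->
  (forall n, x n <= y n)%E -> y n @[n --> \oo] --> 0%E -> x n @[n --> \oo] --> 0%E.
Proof.
move=> x0 xy y0; apply: (@squeeze_cvge _ _ _ _ (cst 0%E) _ y) => //; last exact: cvg_cst.
by apply: nearW => n; rewrite x0 xy.
Qed.

Lemma cvg0_2D (a b : nat -> \bar R) : a n @[n --> \oo] --> 0%E ->
  b n @[n --> \oo] --> 0%E -> (2%:E * (a n + b n))%E @[n --> \oo] --> 0%E.
Proof.
move=> a0 b0; rewrite -[X in _ --> X](mule0 2%:E); apply: cvgeZl => //.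
have := @cvgeD _ _ _ _ _ _ _ _ _ a0 b0; rewrite adde0; exact.
Qed.

Lemma measurable_comp_itv dT (T : measurableType dT) (D : set T) (g : R -> R) (h : T -> R) :
  measurable_fun `[0, d] g -> measurable_fun D h ->
  (forall x, D x -> 0 <= h x <= d) -> measurable_fun D (g \o h).
Proof.
move=> mg mh hD; apply: (measurable_comp _ _ mg mh) => //.
by move=> _ [x /hD xD <-] /=; rewrite in_itv.
Qed.

(** A reflected arm is the preceding edge run backwards, whereas [gp_L2loc] speaks of edges run
    forwards. *)
Lemma arm_edge_h (g : P2 -> R) s j k :
  measurable_fun `[0, d] (fun t => g (hpt d (side s j) k t)) ->
  measurable_fun `[0, d] (fun x => g (aff s j d x, k%:~R * d)) /\
  (\int[mu]_(x in `[0%R, d]) ((g (aff s j d x, k%:~R * d)%R) ^+ 2)%:E =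
   \int[mu]_(t in `[0%R, d]) ((g (hpt d (side s j) k t)) ^+ 2)%:E)%E.
Proof.
case: s => //= mg.
have E x : g (j%:~R * d - x, k%:~R * d) = g (hpt d (j - 1) k (d - x)).
  by congr g; rewrite /hpt intrD/=; congr pair; ring.
split.
  rewrite (funext E); apply: (measurable_comp_itv (g := fun t => g (hpt d (j - 1) k t)) mg) => //.
    exact: measurable_funTS (measurable_refl d).
  by move=> x /=; rewrite in_itv/= => /andP[? ?]; apply/andP; split; lra.
under eq_integral do rewrite E.
rewrite -[RHS](@ge0_integral_refl _ d)//; last 2 first.
- by apply/measurable_EFinP; exact: measurable_funX.
- by move=> x _; rewrite lee_fin sqr_ge0.
by have := refl_itv d 0 d; rewrite subrr subr0 => ->.
Qed.

Lemma arm_edge_v (g : P2 -> R) t j k :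
  measurable_fun `[0, d] (fun s => g (vpt d j (side t k) s)) ->
  measurable_fun `[0, d] (fun x => g (j%:~R * d, aff t k d x)) /\
  (\int[mu]_(x in `[0%R, d]) ((g (j%:~R * d, aff t k d x)%R) ^+ 2)%:E =
   \int[mu]_(s in `[0%R, d]) ((g (vpt d j (side t k) s)) ^+ 2)%:E)%E.
Proof. exact: (@arm_edge_h (fun z => g (z.2, z.1)) t k j). Qed.

(** The corner term for any of the four right angles at a node. The norm contains those with
    [s = t]; the straight terms are bounded through two angles that share an arm. *)
Definition corner (f : P2 -> R) (s t : bool) (j k : int) : \bar R :=
  (\int[mu]_(x in `[0%R, d])
     ((f (aff s j d x, k%:~R * d)%R - f (j%:~R * d, aff t k d x)%R) ^+ 2 / x)%:E)%E.

Lemma integral_sym_itv (g : R -> \bar R) : measurable_fun `[- d, d] g ->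
  (forall x, 0 <= g x)%E ->
  (\int[mu]_(x in `[(- d)%R, d]) g x =
   \int[mu]_(x in `[0%R, d]) g x + \int[mu]_(x in `[0%R, d]) g (- x)%R)%E.
Proof.
move=> mg g0.
have E : `[- d, d]%classic = `[- d, 0]%classic `|` `]0, d]%classic.
  by rewrite -itv_bndbnd_setU// bnd_simp ?oppr_le0 ltW.
rewrite E ge0_integral_setU//=; last 2 first.
- by rewrite -E.
- by apply/disj_setPS => x [] /=; rewrite !in_itv/= => /andP[_ h] /andP[]; rewrite ltNge h.
rewrite addeC integral_itv_obnd_cbnd; last first.
  by apply: measurable_funS mg => //; rewrite E; exact: subsetUr.
congr (_ + _)%E; rewrite -(@ge0_integral_refl _ 0)//; last first.
  by apply: measurable_funS mg => //; rewrite E; exact: subsetUl.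
have := refl_itv (0 : R) 0 d; rewrite sub0r subr0 => ->.
by apply: eq_integral => x _; rewrite sub0r.
Qed.

Lemma measurable_corner (f : P2 -> R) s t j k : gp_L2loc d f ->
  measurable_fun `[0, d] (fun x => ((f (aff s j d x, k%:~R * d) - f (j%:~R * d, aff t k d x)) ^+ 2 / x)).
Proof.
move=> fL; apply: measurable_funM; last exact: measurable_funTS measurable_invr.
apply: measurable_funX; apply: measurable_funB.
  by apply: (arm_edge_h _).1; case: (fL (side s j) k).
by apply: (arm_edge_v _).1; case: (fL j (side t k)).
Qed.

(** The integral splits at 0: positive [x] gives the right and upper arms, negative [x] the left and
    lower ones. *)
Lemma corner_sum (f : P2 -> R) j k : gp_L2loc d f ->
  (\int[mu]_(x in `[(- d)%R, d])
        ((f (hpt d j k x) - f (vpt d j k x)) ^+ 2 / `|x|)%:E =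
   corner f false false j k + corner f true true j k)%E.
Proof.
move=> fL.
have m1 := measurable_corner false false j k fL.
have m2 := measurable_corner true true j k fL.
pose g x := ((f (hpt d j k x) - f (vpt d j k x)) ^+ 2 / `|x|).
have mg : measurable_fun `[- d, d] g.
  have -> : `[- d, d]%classic = `[- d, 0]%classic `|` `[0, d]%classic.
    apply/seteqP; split => x; rewrite /= !in_itv/=.
      by move=> /andP[x1 x2]; have [h|/ltW h] := leP x 0; [left|right]; apply/andP.
    by move=> [|] /andP[x1 x2]; apply/andP; split => //; lra.
  apply/measurable_funU => //; split.
    have -> : g = (fun x => (f (hpt d j k x) - f (vpt d j k x)) ^+ 2 / `|x|) by [].
    have E : {in `[- d, 0]%classic, (fun x => (f (aff true j d x, k%:~R * d) - f (j%:~R * d, aff true k d x)) ^+ 2 / x) \o (fun x => 0 - x) =1 g}.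
      move=> x; rewrite inE /= in_itv/= => /andP[_ x0].
      by rewrite /g /aff /hpt /vpt !sub0r !opprK ler0_norm.
    apply: eq_measurable_fun E _.
    apply: (measurable_comp_itv m2) => //; first exact: measurable_funTS (measurable_refl 0).
    by move=> x /=; rewrite in_itv/= => /andP[? ?]; apply/andP; split; lra.
  apply: eq_measurable_fun m1 => x; rewrite inE /= in_itv/= => /andP[x0 _].
  by rewrite /g /aff /hpt /vpt ger0_norm.
rewrite integral_sym_itv//; last 2 first.
- exact/measurable_EFinP.
- by move=> x; rewrite lee_fin divr_ge0 ?sqr_ge0.
congr (_ + _)%E; apply: eq_integral => x; rewrite inE /= in_itv/= => /andP[x0 _].
- by rewrite /aff /hpt /vpt ger0_norm.
- by rewrite /aff /hpt /vpt normrN ger0_norm.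
Qed.

(** The right and left arms are compared through the upper arm, on which both angles rest. *)
Lemma corner_straight_h (f : P2 -> R) j k : gp_L2loc d f ->
  (\int[mu]_(x in `[0%R, d])
        ((f (hpt d j k x) - f (hpt d j k (- x)%R)) ^+ 2 / x)%:E <=
   2%:E * (corner f false false j k + corner f true false j k))%E.
Proof.
move=> fL.
have m1 := measurable_corner false false j k fL.
have m2 := measurable_corner true false j k fL.
have c0 s t x : `[0, d]%classic x ->
  (0 <= ((f (aff s j d x, k%:~R * d)%R - f (j%:~R * d, aff t k d x)%R) ^+ 2 / x)%:E)%E.
  by rewrite /= in_itv/= => /andP[x0 _]; rewrite lee_fin divr_ge0 ?sqr_ge0.
rewrite /corner -ge0_integralD//; [|exact: c0|exact/measurable_EFinP|exact: c0|exact/measurable_EFinP].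
rewrite -ge0_integralZl//; last 2 first.
- by apply: emeasurable_funD; exact/measurable_EFinP.
- by move=> x xd; apply: adde_ge0; exact: c0.
apply: ge0_le_integral => //.
- by move=> x; rewrite /= in_itv/= => /andP[x0 _]; rewrite lee_fin divr_ge0 ?sqr_ge0.
- apply/measurable_EFinP; apply: measurable_funM; last exact: measurable_funTS measurable_invr.
  apply: measurable_funX; apply: measurable_funB.
    by apply: (arm_edge_h (s := false) _).1; case: (fL j k).
  by apply: (arm_edge_h (s := true) _).1; case: (fL (j - 1) k).
- by apply: emeasurable_funM => //; apply: emeasurable_funD; exact/measurable_EFinP.
- move=> x; rewrite /= in_itv/= => /andP[x0 _].
  rewrite -EFinD -EFinM lee_fin -mulrDl mulrA ler_wpM2r ?invr_ge0//.
  rewrite /aff /hpt; set a := f (_, _); set b := f (_, _); set c := f (_, _).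
  by rewrite -subr_ge0 (_ : _ - _ = (a + b - c *+ 2) ^+ 2) ?sqr_ge0//; ring.
Qed.

Lemma corner_straight_v (f : P2 -> R) j k : gp_L2loc d f ->
  (\int[mu]_(x in `[0%R, d])
        ((f (vpt d j k x) - f (vpt d j k (- x)%R)) ^+ 2 / x)%:E <=
   2%:E * (corner f false false j k + corner f false true j k))%E.
Proof.
move=> fL; have fL' : gp_L2loc d (fun z => f (z.2, z.1)).
  by move=> j' k'; have [? ? ? ?] := fL k' j'; split.
have E s t : corner (fun z => f (z.2, z.1)) s t k j = corner f t s j k.
  by apply: eq_integral => x _; rewrite /= -sqrrN opprB.
by have := corner_straight_h k j fL'; rewrite !E.
Qed.

Lemma integral_sqrD_le dT (T : measurableType dT) (m : {measure set T -> \bar R}) (D : set T)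
    (a b : T -> R) : measurable D -> measurable_fun D a -> measurable_fun D b ->
  (\int[m]_(x in D) ((a x + b x) ^+ 2)%:E <=
   2%:E * (\int[m]_(x in D) (a x ^+ 2)%:E + \int[m]_(x in D) (b x ^+ 2)%:E))%E.
Proof.
move=> mD ma mb.
have sq0 (g : T -> R) x : D x -> (0 <= (g x ^+ 2)%:E)%E by rewrite lee_fin sqr_ge0.
have msq (g : T -> R) : measurable_fun D g -> measurable_fun D (fun x => (g x ^+ 2)%:E).
  by move=> mg; apply/measurable_EFinP; exact: measurable_funX.
rewrite -ge0_integralD//; [|exact: sq0|exact: msq|exact: sq0|exact: msq].
rewrite -ge0_integralZl//; last 2 first.
- by apply: emeasurable_funD; exact: msq.
- by move=> x Dx; apply: adde_ge0; exact: sq0.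
apply: ge0_le_integral => //.
- by move=> x Dx; rewrite lee_fin sqr_ge0.
- by apply: msq; exact: measurable_funD.
- by apply: emeasurable_funM => //; apply: emeasurable_funD; exact: msq.
- move=> x Dx; rewrite -EFinD -EFinM lee_fin.
  by rewrite -subr_ge0 (_ : _ - _ = (a x - b x) ^+ 2) ?sqr_ge0//; ring.
Qed.

Variables (F G1 G2 f : P2 -> R) (HF : H1 F G1 G2) (fL : gp_L2loc d f).
Variables (Fn : nat -> P2 -> R^o) (Fn1 : forall n, C1 (Fn n)).

Let eps n := (\int[@leb2 R]_x ((d1 (Fn n) x - G1 x) ^+ 2 + (d2 (Fn n) x - G2 x) ^+ 2)%:E)%E.

Hypothesis eps0 : eps n @[n --> \oo] --> 0%E.
Hypothesis edges : forall j k : int,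
  (\int[@leb1 R]_(t in `[0%R, d]) ((Fn n (hpt d j k t) - f (hpt d j k t)) ^+ 2)%:E)%E @[n --> \oo] --> 0%E /\
  (\int[@leb1 R]_(t in `[0%R, d]) ((Fn n (vpt d j k t) - f (vpt d j k t)) ^+ 2)%:E)%E @[n --> \oo] --> 0%E.

Let S jk := (\int[@leb2 R]_(z in square d jk) (G1 z ^+ 2 + G2 z ^+ 2)%:E)%E.

Let S0 jk : (0 <= S jk)%E.
Proof. by apply: integral_ge0 => z _; rewrite lee_fin addr_ge0 ?sqr_ge0. Qed.

Let mG1 : measurable_fun [set: R * R] G1. Proof. by case: HF => _ _ []. Qed.

Let mG2 : measurable_fun [set: R * R] G2. Proof. by case: HF => _ _ []. Qed.

Let mdiff n : measurable_fun [set: R * R]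
  (fun x => ((d1 (Fn n) x - G1 x) ^+ 2 + (d2 (Fn n) x - G2 x) ^+ 2)%:E).
Proof.
apply/measurable_EFinP; apply: measurable_funD; apply: measurable_funX.
  by apply: measurable_funB => //; exact: (measurable_d1 (Fn1 n)).
by apply: measurable_funB => //; exact: (measurable_d2 (Fn1 n)).
Qed.

Let energy_le n jk : (\int[@leb2 R]_(z in square d jk) energy_density (Fn n) z <=
  2%:E * (S jk + eps n))%E.
Proof.
have mS : measurable_fun [set: R * R] (fun z => (G1 z ^+ 2 + G2 z ^+ 2)%:E).
  by apply/measurable_EFinP; apply: measurable_funD; exact: measurable_funX.
have e0 z : (0 <= ((d1 (Fn n) z - G1 z) ^+ 2 + (d2 (Fn n) z - G2 z) ^+ 2)%:E)%E.
  by rewrite lee_fin addr_ge0 ?sqr_ge0.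
have s0 z : (0 <= (G1 z ^+ 2 + G2 z ^+ 2)%:E)%E by rewrite lee_fin addr_ge0 ?sqr_ge0.
have msq := measurable_square d jk.
apply: (@le_trans _ _ (2%:E * (S jk + \int[@leb2 R]_(z in square d jk)
    ((d1 (Fn n) z - G1 z) ^+ 2 + (d2 (Fn n) z - G2 z) ^+ 2)%:E))%E); last first.
  apply: lee_wpmul2l => //; apply: leeD2l; apply: ge0_subset_integral => //; exact: mdiff.
have mSd := measurable_funTS (emeasurable_funD mS (mdiff n)).
rewrite -ge0_integralD//; [|exact: (measurable_funTS mS)|exact: (measurable_funTS (mdiff n))].
rewrite -ge0_integralZl//; last 2 first.
- exact: mSd.
- by move=> z _; exact: adde_ge0.
apply: ge0_le_integral => //.
- by move=> z _; exact: energy_density_ge0.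
- by apply: measurable_funTS; exact: (measurable_energy_density (Fn1 n)).
- by apply: emeasurable_funM => //; exact: mSd.
- move=> z _; rewrite /energy_density -EFinD -EFinM lee_fin.
  rewrite -subr_ge0 (_ : _ - _ = (d1 (Fn n) z - G1 z *+ 2) ^+ 2 + (d2 (Fn n) z - G2 z *+ 2) ^+ 2).
    by rewrite addr_ge0 ?sqr_ge0.
  by ring.
Qed.

(** One factor 2 is lost in [weighted_integral_lsc], the other in comparing the energy of [Fn n]
    with that of the limit gradient. *)
Let trace_lsc dT (T : measurableType dT) (m : {measure set T -> \bar R}) (D : set T)
    (wt A : T -> R) (An : nat -> T -> R) (c : R) jk : 0 <= c ->
  measurable D -> measurable_fun D wt -> (forall x, D x -> 0 <= wt x) ->
  measurable_fun D A -> (forall n, measurable_fun D (An n)) ->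
  (\int[m]_(x in D) ((An n x - A x) ^+ 2)%:E)%E @[n --> \oo] --> 0%E ->
  (forall n, \int[m]_(x in D) ((An n x) ^+ 2 * wt x)%:E <=
    c%:E * \int[@leb2 R]_(z in square d jk) energy_density (Fn n) z)%E ->
  (\int[m]_(x in D) ((A x) ^+ 2 * wt x)%:E <= (4 * c)%:E * S jk)%E.
Proof.
move=> c0 mD mwt wt0 mA mAn AnA bnd.
have en0 n : (0 <= eps n)%E.
  by apply: integral_ge0 => z _; rewrite lee_fin addr_ge0 ?sqr_ge0.
have -> : ((4 * c)%:E * S jk = 2%:E * ((2 * c)%:E * S jk))%E.
  by rewrite muleA -EFinM; congr (_%:E * _)%E; ring.
apply: (weighted_integral_lsc (r := fun n => ((2 * c)%:E * eps n)%E) mD mwt wt0 mA mAn AnA).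
- by rewrite -[X in _ --> X](mule0 (2 * c)%:E); apply: cvgeZl.
- by apply: mule_ge0 => //; rewrite lee_fin mulr_ge0.
- by move=> n; apply: mule_ge0 => //; rewrite lee_fin mulr_ge0.
- move=> n; apply: (le_trans (bnd n)).
  rewrite -ge0_muleDr// (mulrC 2) EFinM -muleA.
  by apply: lee_wpmul2l; rewrite ?lee_fin.
Qed.

Lemma corner_le_gradient s t j k :
  (corner f s t j k <= 16%:E * S (side s j, side t k))%E.
Proof.
have c4 : (0 : R) <= 4 by [].
pose A x := f (aff s j d x, k%:~R * d) - f (j%:~R * d, aff t k d x).
pose An n x := Fn n (aff s j d x, k%:~R * d) - Fn n (j%:~R * d, aff t k d x).
have mFh n : measurable_fun [set: R] (fun x => Fn n (aff s j d x, k%:~R * d)).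
  have /continuous_measurable2 h : continuous (Fn n : P2 -> R).
    by move=> z; apply: differentiable_continuous; case: (Fn1 n).
  apply: (measurableT_comp h (g := fun x : R => (aff s j d x, k%:~R * d))).
  by apply: measurable_fun_pair => //; exact: measurable_aff.
have mFv n : measurable_fun [set: R] (fun x => Fn n (j%:~R * d, aff t k d x)).
  have /continuous_measurable2 h : continuous (Fn n : P2 -> R).
    by move=> z; apply: differentiable_continuous; case: (Fn1 n).
  apply: (measurableT_comp h (g := fun x : R => (j%:~R * d, aff t k d x))).
  by apply: measurable_fun_pair => //; exact: measurable_aff.
have mfh := (@arm_edge_h f s j k (let: And4 h _ _ _ := fL (side s j) k in h)).1.
have mfv := (@arm_edge_v f t j k (let: And4 _ h _ _ := fL j (side t k) in h)).1.
have mFe n (p : R -> P2) : measurable_fun [set: R] (p : R -> R * R) -> measurable_fun `[0, d] (fun x => f (p x)) ->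
    measurable_fun `[0, d] (fun x => Fn n (p x) - f (p x)).
  move=> mp mfp; apply: measurable_funB => //; apply: measurable_funTS.
  have /continuous_measurable2 h : continuous (Fn n : P2 -> R).
    by move=> z; apply: differentiable_continuous; case: (Fn1 n).
  exact: (measurableT_comp h mp).
have mhpt j' k' : measurable_fun [set: R] (hpt d j' k' : R -> R * R).
  by apply: measurable_fun_pair => //; exact: (measurable_aff false).
have mvpt j' k' : measurable_fun [set: R] (vpt d j' k' : R -> R * R).
  by apply: measurable_fun_pair => //; exact: (measurable_aff false).
have -> : 16 = 4 * 4 :> R by ring.
apply: (@trace_lsc _ _ (@lebesgue_measure R) `[0, d]%classic (fun x => x^-1) A An 4 (side s j, side t k) c4) => //.
- exact: measurable_funTS measurable_invr.
- by move=> x /=; rewrite in_itv/= => /andP[x0 _]; rewrite invr_ge0.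
- exact: measurable_funB.
- by move=> n; apply: measurable_funB; [exact: (measurable_funTS (mFh n))|exact: (measurable_funTS (mFv n))].
- pose a n x := (Fn n (aff s j d x, k%:~R * d) - f (aff s j d x, k%:~R * d)).
  pose b n x := - (Fn n (j%:~R * d, aff t k d x) - f (j%:~R * d, aff t k d x)).
  have ma n : measurable_fun `[0, d] (a n).
    by apply: measurable_funB => //; exact: (measurable_funTS (mFh n)).
  have mb n : measurable_fun `[0, d] (b n).
    by apply: measurable_funN; apply: measurable_funB => //; exact: (measurable_funTS (mFv n)).
  have ia n : (\int[mu]_(x in `[0%R, d]) (a n x ^+ 2)%:E = \int[mu]_(x in `[0%R, d]) ((Fn n (hpt d (side s j) k x) - f (hpt d (side s j) k x)) ^+ 2)%:E)%E.
    apply: (@arm_edge_h (fun z => Fn n z - f z) s j k _).2.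
    by apply: (mFe _ (hpt d (side s j) k)) => //; case: (fL (side s j) k).
  have ib n : (\int[mu]_(x in `[0%R, d]) (b n x ^+ 2)%:E = \int[mu]_(x in `[0%R, d]) ((Fn n (vpt d j (side t k) x) - f (vpt d j (side t k) x)) ^+ 2)%:E)%E.
    under eq_integral do rewrite /b sqrrN.
    apply: (@arm_edge_v (fun z => Fn n z - f z) t j k _).2.
    by apply: (mFe _ (vpt d j (side t k))) => //; case: (fL j (side t k)).
  apply: (@cvg0_squeeze _ (fun n => 2%:E * (\int[mu]_(x in `[0%R, d]) (a n x ^+ 2)%:E + \int[mu]_(x in `[0%R, d]) (b n x ^+ 2)%:E))%E).
  + by move=> n; apply: integral_ge0 => x _; rewrite lee_fin sqr_ge0.
  + move=> n; have H : (\int[mu]_(x in `[0%R, d]) ((a n x + b n x) ^+ 2)%:E <= 2%:E *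
        (\int[mu]_(x in `[0%R, d]) (a n x ^+ 2)%:E + \int[mu]_(x in `[0%R, d]) (b n x ^+ 2)%:E))%E.
      by apply: integral_sqrD_le; [exact: measurable_itv|exact: ma|exact: mb].
    apply: le_trans H; rewrite le_eqVlt; apply/orP; left; apply/eqP; apply: eq_integral => x _.
    by rewrite /An /A /a /b; congr (_ ^+ 2)%:E; ring.
  + apply: cvg0_2D.
      by under eq_fun do rewrite ia; case: (edges (side s j) k).
    by under eq_fun do rewrite ib; case: (edges j (side t k)).
- by move=> n; exact: trace_corner_arms.
Qed.

Let edge_le_gradient (pt : R -> P2) jk :
  measurable_fun [set: R] (pt : R -> R * R) -> measurable_fun `[0, d] (fun x => f (pt x)) ->
  (\int[mu]_(t in `[0%R, d]) ((Fn n (pt t) - f (pt t)) ^+ 2)%:E)%E @[n --> \oo] --> 0%E ->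
  (forall n, \int[mu]_(y in `[0%R, d]) \int[mu]_(x in `[0%R, d])
     ((Fn n (pt x) - Fn n (pt y)) ^+ 2 / (x - y) ^+ 2)%:E <=
   60%:E * \int[@leb2 R]_(z in square d jk) energy_density (Fn n) z)%E ->
  (\int[mu]_(y in `[0%R, d]) \int[mu]_(x in `[0%R, d])
     ((f (pt x) - f (pt y)) ^+ 2 / (x - y) ^+ 2)%:E <= 240%:E * S jk)%E.
Proof.
move=> mpt mfp cvgF bnd.
have mFp n : measurable_fun [set: R] (fun x => Fn n (pt x)).
  have /continuous_measurable2 h : continuous (Fn n : P2 -> R).
    by move=> z; apply: differentiable_continuous; case: (Fn1 n).
  exact: (measurableT_comp h mpt).
have m1 (g : R -> R) : measurable_fun `[0, d] g -> measurable_fun (sq d) (fun z : R * R => g z.1).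
  move=> mg; apply: (measurable_comp_itv (g := g) (h := fst) mg).
    by apply: measurable_funTS; exact: measurable_fst.
  by move=> z [/= + _]; rewrite in_itv.
have m2 (g : R -> R) : measurable_fun `[0, d] g -> measurable_fun (sq d) (fun z : R * R => g z.2).
  move=> mg; apply: (measurable_comp_itv (g := g) (h := snd) mg).
    by apply: measurable_funTS; exact: measurable_snd.
  by move=> z [/= _]; rewrite in_itv.
have mw : measurable_fun (sq d) (fun z : R * R => ((z.1 - z.2) ^+ 2)^-1).
  apply: measurable_funTS; apply: (measurableT_comp measurable_invr).
  by apply: measurable_funX; apply: measurable_funB; [exact: measurable_fst|exact: measurable_snd].
pose A (z : R * R) := f (pt z.1) - f (pt z.2).
pose An n (z : R * R) := Fn n (pt z.1) - Fn n (pt z.2).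
have mA : measurable_fun (sq d) A by apply: measurable_funB; [exact: (m1 _ mfp)|exact: (m2 _ mfp)].
have mFpd n : measurable_fun `[0, d] (fun x => Fn n (pt x)) by exact: (measurable_funTS (mFp n)).
have mAn n : measurable_fun (sq d) (An n).
  by apply: measurable_funB; [exact: (m1 _ (mFpd n))|exact: (m2 _ (mFpd n))].
have toprod (B : R * R -> R) : measurable_fun (sq d) B ->
    (\int[mu]_(y in `[0%R, d]) \int[mu]_(x in `[0%R, d]) (B (x, y) ^+ 2 / (x - y) ^+ 2)%:E =
     \int[@leb2 R]_(z in sq d) (B z ^+ 2 * ((z.1 - z.2) ^+ 2)^-1)%:E)%E.
  move=> mB; rewrite ge0_integral_prod2//.
    by apply/measurable_EFinP; apply: measurable_funM => //; exact: measurable_funX.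
  by move=> z _; rewrite lee_fin mulr_ge0 ?invr_ge0 ?sqr_ge0.
rewrite (toprod A)//; have -> : 240 = 4 * 60 :> R by ring.
have c60 : (0 : R) <= 60 by [].
apply: (@trace_lsc _ _ (@lebesgue_measure R \x @lebesgue_measure R)%E (sq d) (fun z => ((z.1 - z.2) ^+ 2)^-1) A An 60 jk c60) => //.
- exact: measurable_sq.
- by move=> z _; rewrite invr_ge0 sqr_ge0.
(* [An n - A] is a function of [x] minus the same function of [y]; each has squared integral over
   the square equal to [d] times that on the edge. *)
- pose g n x := Fn n (pt x) - f (pt x).
  have mg n : measurable_fun `[0, d] (g n) by exact: measurable_funB.
  have mgN n : measurable_fun `[0, d] (fun x => - g n x) by exact: measurable_funN.
  pose a n := (\int[mu]_(t in `[0%R, d]) (g n t ^+ 2)%:E)%E.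
  have a0 n : (0 <= a n)%E by apply: integral_ge0 => t _; rewrite lee_fin sqr_ge0.
  have cst_int (c : \bar R) : (0 <= c)%E -> (\int[mu]_(x in `[0%R, d]) c = d%:E * c)%E.
    have mud : mu `[0, d]%classic = d%:E.
      by rewrite lebesgue_measure_itv/= lte_fin d0 -EFinB subr0.
    move=> cge0; have := @integral_cst _ _ _ (@lebesgue_measure R) `[0, d]%classic (measurable_itv _) c.
    by move=> ->; rewrite [X in (_ * X)%E]mud muleC.
  have sq0 (h : R * R -> R) z : sq d z -> (0 <= (h z ^+ 2)%:E)%E by rewrite lee_fin sqr_ge0.
  have msq (h : R * R -> R) : measurable_fun (sq d) h -> measurable_fun (sq d) (fun z => (h z ^+ 2)%:E).
    by move=> mh; apply/measurable_EFinP; exact: measurable_funX.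
  have i1 n : (\int[@leb2 R]_(z in sq d) (g n z.1 ^+ 2)%:E = d%:E * a n)%E.
    rewrite ge0_integral_prod2//; [|exact: (msq _ (m1 _ (mg n)))|exact: (sq0 (fun z => g n z.1))].
    by rewrite -cst_int.
  have i2 n : (\int[@leb2 R]_(z in sq d) ((- g n z.2) ^+ 2)%:E = d%:E * a n)%E.
    rewrite ge0_integral_prod//; [|exact: (msq _ (m2 _ (mgN n)))|exact: (sq0 (fun z => - g n z.2))].
    rewrite -(cst_int (a n) (a0 n)).
    apply: eq_integral => x _; apply: eq_integral => y _.
    by rewrite /= sqrrN.
  apply: (@cvg0_squeeze _ (fun n => 2%:E * (d%:E * a n + d%:E * a n))%E).
  + by move=> n; apply: integral_ge0 => x _; rewrite lee_fin sqr_ge0.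
  + move=> n; rewrite -{1}(i1 n) -(i2 n).
    have H : (\int[@leb2 R]_(z in sq d) ((g n z.1 + - g n z.2) ^+ 2)%:E <= 2%:E *
        (\int[@leb2 R]_(z in sq d) (g n z.1 ^+ 2)%:E + \int[@leb2 R]_(z in sq d) ((- g n z.2) ^+ 2)%:E))%E.
      by apply: integral_sqrD_le; [exact: measurable_sq|exact: (m1 _ (mg n))|exact: (m2 _ (mgN n))].
    apply: le_trans H; rewrite le_eqVlt; apply/orP; left; apply/eqP; apply: eq_integral => z _.
    by rewrite /An /A /g; congr (_ ^+ 2)%:E; ring.
  + have da : (d%:E * a n)%E @[n --> \oo] --> 0%E.
      by rewrite -[X in _ --> X](mule0 d%:E); apply: cvgeZl.
    exact: cvg0_2D.
- by move=> n; apply: le_trans (bnd n); rewrite (toprod (An n)).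
Qed.

(** Each term at [(j, k)] is bounded by the gradient on at most two squares, placed at fixed offsets
    from [(j, k)]. Translating the index set, every sum is at most a constant times the integral of
    [G1 ^ 2 + G2 ^ 2] over the plane. *)
Lemma H12_of_trace : H12 d f.
Proof.
split => //; pose e (z : R * R) : \bar R := (G1 z ^+ 2 + G2 z ^+ 2)%:E.
have me : measurable_fun [set: R * R] e.
  by apply/measurable_EFinP; apply: measurable_funD; exact: measurable_funX.
have e0 z : (0 <= e z)%E by rewrite lee_fin addr_ge0 ?sqr_ge0.
have [_ _ _ [g1 g2] _] := HF.
have eoo : (\int[@leb2 R]_z e z < +oo)%E.
  rewrite /e; under eq_integral do rewrite EFinD.
  rewrite ge0_integralD//.
  - exact: lte_add_pinfty.
  - by move=> z _; rewrite lee_fin sqr_ge0.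
  - by apply/measurable_EFinP; exact: measurable_funX.
  - by move=> z _; rewrite lee_fin sqr_ge0.
  - by apply/measurable_EFinP; exact: measurable_funX.
have Soo (c : R) a b : 0 <= c ->
    (\esum_(jk in [set: int * int]) (c%:E * S (jk.1 + a, jk.2 + b)%R) < +oo)%E.
  move=> c0.
  have -> : (\esum_(jk in [set: int * int]) (c%:E * S (jk.1 + a, jk.2 + b)%R) =
      \esum_(jk in [set: int * int]) (c%:E * S jk))%E.
    rewrite [RHS](reindex_esum setT setT (fun jk => (jk.1 + a, jk.2 + b)))//.
    split=> //; first by move=> [j k] [j' k'] _ _ /= [/addIr -> /addIr ->].
    by move=> [j k] _; exists (j - a, k - b) => //=; rewrite !subrK.
  have mce : measurable_fun [set: R * R] (fun z => c%:E * e z)%E by exact: emeasurable_funM.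
  have ce0 z : (0 <= c%:E * e z)%E by rewrite mule_ge0.
  have -> : (\esum_(jk in [set: int * int]) (c%:E * S jk) = \int[@leb2 R]_z (c%:E * e z))%E.
    rewrite (integral_squares d0 mce ce0); apply: eq_esum => jk _.
    by rewrite ge0_integralZl//; [exact: measurable_square|exact: (measurable_funTS me)].
  by rewrite ge0_integralZl// lte_mul_pinfty.
have Sge c jk : 0 <= c -> (0 <= c%:E * S jk)%E by move=> c0; rewrite mule_ge0.
have crn0 s t j k : (0 <= corner f s t j k)%E.
  by apply: integral_ge0 => x /=; rewrite in_itv/= => /andP[x0 _]; rewrite lee_fin divr_ge0 ?sqr_ge0.
have bound (t : int * int -> \bar R) (c : R) a1 b1 a2 b2 : 0 <= c ->
   (forall jk, t jk <= c%:E * S (jk.1 + a1, jk.2 + b1)%R + c%:E * S (jk.1 + a2, jk.2 + b2)%R)%E ->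
   (\esum_(jk in [set: int * int]) t jk < +oo)%E.
  move=> c0 tS; apply: (@le_lt_trans _ _ (\esum_(jk in [set: int * int])
    (c%:E * S (jk.1 + a1, jk.2 + b1)%R + c%:E * S (jk.1 + a2, jk.2 + b2)%R)))%E.
    by apply: le_esum => jk _; exact: tS.
  by rewrite esumD => [|jk _|jk _]; rewrite ?Sge//; exact: lte_add_pinfty (Soo _ _ _ c0) (Soo _ _ _ c0).
have mhpt j' k' : measurable_fun [set: R] (hpt d j' k' : R -> R * R).
  by apply: measurable_fun_pair => //; exact: (measurable_aff false).
have mvpt j' k' : measurable_fun [set: R] (vpt d j' k' : R -> R * R).
  by apply: measurable_fun_pair => //; exact: (measurable_aff false).
rewrite /gp_norm2; do 4 try apply: lte_add_pinfty.
- apply: (bound _ 240 0 0 0 0) => // -[j k] /=; rewrite !addr0.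
  apply: (le_trans (y := 240%:E * S (j, k))%E); last by apply: leeDl; exact: Sge.
  apply: edge_le_gradient; [exact: mhpt|by case: (fL j k)|by case: (edges j k)|].
  by move=> n; exact: trace_edge_h.
- apply: (bound _ 240 0 0 0 0) => // -[j k] /=; rewrite !addr0.
  apply: (le_trans (y := 240%:E * S (j, k))%E); last by apply: leeDl; exact: Sge.
  apply: edge_le_gradient; [exact: mvpt|by case: (fL j k)|by case: (edges j k)|].
  by move=> n; exact: trace_edge_v.
(* The angle of the right and upper arms lies in the square [(j, k)], that of the left and lower
   arms in [(j - 1, k - 1)]. The straight terms below also use the left and upper arms, in
   [(j - 1, k)], and the right and lower arms, in [(j, k - 1)]. *)
- apply: (bound _ 16 0 0 (-1) (-1)) => // -[j k] /=; rewrite !addr0 corner_sum//.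
  by apply: leeD; exact: corner_le_gradient.
- apply: (bound _ 32 0 0 (-1) 0) => // -[j k] /=; rewrite !addr0.
  apply: (le_trans (corner_straight_h _ _ fL)).
  have -> : 32%:E = (2%:E * 16%:E)%E :> \bar R by rewrite -EFinM; congr EFin; ring.
  rewrite -!muleA -ge0_muleDr ?Sge//; apply: lee_wpmul2l => //.
  by apply: leeD; exact: corner_le_gradient.
- apply: (bound _ 32 0 0 0 (-1)) => // -[j k] /=; rewrite !addr0.
  apply: (le_trans (corner_straight_v _ _ fL)).
  have -> : 32%:E = (2%:E * 16%:E)%E :> \bar R by rewrite -EFinM; congr EFin; ring.
  rewrite -!muleA -ge0_muleDr ?Sge//; apply: lee_wpmul2l => //.
  by apply: leeD; exact: corner_le_gradient.
Qed.

End forward.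

(** * Averages along an edge *)

Section averages.
Context {R : realType}.
Local Notation mu := (@lebesgue_measure R).
Variables (h : R) (h0 : 0 < h).
Implicit Types (a b : R -> R).

Lemma sum_integral_itv (s : R) (g : R -> \bar R) n : measurable_fun [set: R] g ->
  (forall x, 0 <= g x)%E ->
  (\sum_(i < n) \int[mu]_(x in `[(s + i%:R * h)%R, (s + i.+1%:R * h)%R]) g x =
   \int[mu]_(x in `[s, (s + n%:R * h)%R]) g x)%E.
Proof.
move=> mg g0; elim: n => [|n IH].
  by rewrite big_ord0 mul0r addr0 set_itv1 integral_set1.
have sn : s <= s + n%:R * h by rewrite lerDl mulr_ge0// ltW.
have snn : s + n%:R * h <= s + n.+1%:R * h by rewrite lerD2l ler_wpM2r ?ler_nat// ltW.
rewrite big_ord_recr/= IH -[X in _ + X]integral_itv_obnd_cbnd; last exact: measurable_funTS.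
rewrite -ge0_integral_setU//; last 2 first.
- exact: measurable_funTS.
- by apply/disj_setPS => x [] /=; rewrite !in_itv/= => /andP[_ hx] /andP[]; rewrite ltNge hx.
by rewrite -itv_bndbnd_setU// bnd_simp.
Qed.

(* centred at the node (i + 1) h *)
Definition window (i : nat) : set R := `[h / 2 + i%:R * h, h / 2 + i.+1%:R * h].

Definition avg a (i : nat) : R := h^-1 * \int[mu]_(x in window i) a x.

Let window_len i : h / 2 + i.+1%:R * h - (h / 2 + i%:R * h) = h.
Proof. by rewrite -(natr1 i); ring. Qed.

Let window_lt i : h / 2 + i%:R * h < h / 2 + i.+1%:R * h.
Proof. by rewrite -subr_gt0 window_len. Qed.

Lemma measurable_window i : measurable (window i). Proof. exact: measurable_itv. Qed.

Lemma avg_sqr_le a i : mu.-integrable (window i) (EFin \o a) ->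
  ((avg a i ^+ 2)%:E <= h^-1%:E * \int[mu]_(x in window i) (a x ^+ 2)%:E)%E.
Proof.
move=> ia; have := sqr_Rintegral_le (window_lt i) ia; rewrite window_len => H.
rewrite /avg exprMn EFinM; apply: (le_trans (lee_wpmul2l _ H)).
  by rewrite lee_fin sqr_ge0.
rewrite muleA -EFinM (_ : h^-1 ^+ 2 * h = h^-1)//.
by rewrite expr2 -mulrA mulVf ?mulr1// gt_eqF.
Qed.

Lemma avgB a b i : mu.-integrable (window i) (EFin \o a) ->
  mu.-integrable (window i) (EFin \o b) -> avg a i - avg b i = avg (fun x => a x - b x) i.
Proof.
by move=> ia ib; rewrite /avg RintegralB ?mulrBr//; exact: measurable_window.
Qed.

Let icst i c : mu.-integrable (window i) (EFin \o cst c).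
Proof. by apply: continuous_at_integrable => x _; exact: cst_continuous. Qed.

Lemma avg_cst c i : avg (cst c) i = c.
Proof.
rewrite /avg Rintegral_cst//= ?lebesgue_measure_itv/= ?lte_fin ?window_lt; last exact: measurable_window.
by rewrite -EFinD/= window_len mulrC -mulrA divff ?mulr1// gt_eqF.
Qed.

Lemma avg_dist_le a c i : mu.-integrable (window i) (EFin \o a) ->
  (((avg a i - c) ^+ 2)%:E <= h^-1%:E * \int[mu]_(x in window i) ((a x - c) ^+ 2)%:E)%E.
Proof.
move=> ia; rewrite -[in X in (X <= _)%E](avg_cst c i) avgB//; apply: avg_sqr_le.
exact: (integrable_EFinB (measurable_window i) ia (icst i c)).
Qed.

Variables (K : nat) (d : R) (dE : d = K.+1%:R * h).

Lemma window_sub i : (i < K)%N -> window i `<=` `[0, d].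
Proof.
move=> iK x /andP[]; rewrite !bnd_simp /= in_itv/= dE => x1 x2.
rewrite (le_trans _ x1) ?addr_ge0 ?mulr_ge0 ?divr_ge0 ?(ltW h0)//=.
rewrite (le_trans x2)// (@le_trans _ _ (h + K%:R * h))//; last by rewrite -(natr1 K); lra.
apply: lerD; first by lra.
by rewrite ler_wpM2r ?(ltW h0)// ler_nat.
Qed.

Let windows_sub : `[h / 2, h / 2 + K%:R * h] `<=` `[0, d].
Proof.
move=> x /=; rewrite !in_itv/= dE -(natr1 K) mulrDl mul1r => /andP[x1 x2].
rewrite (le_trans _ x1) ?divr_ge0 ?(ltW h0)//= (le_trans x2)// addrC lerD2l.
by rewrite ler_pdivrMr// ler_peMr ?(ltW h0)// ler1n.
Qed.

(** The inner integral of the edge term, kept as a function of [y]: it also bounds the distance from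
    [a y] to nearby averages pointwise. *)
Definition gagliardo a (y : R) : \bar R :=
  (\int[mu]_(x in `[0%R, d]) ((a x - a y) ^+ 2 / (x - y) ^+ 2)%:E)%E.

Variable a : R -> R.
Hypotheses (ma : measurable_fun [set: R] a) (ia : mu.-integrable `[0, d] (EFin \o a)).

Let ia_w i : (i < K)%N -> mu.-integrable (window i) (EFin \o a).
Proof.
by move=> iK; apply: integrableS ia => //; [exact: measurable_window|exact: window_sub].
Qed.

Let quot : R * R -> R := fun z => (a z.1 - a z.2) ^+ 2 / (z.1 - z.2) ^+ 2.

Let quot0 z : 0 <= quot z. Proof. by rewrite divr_ge0 ?sqr_ge0. Qed.

Let mquot : measurable_fun [set: R * R] quot.
Proof.
apply: measurable_funM.
  by apply: measurable_funX; apply: measurable_funB; apply: measurableT_comp.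
apply: measurableT_comp; first exact: measurable_invr.
by apply: measurable_funX; apply: measurable_funB.
Qed.

Let mquot_sec y : measurable_fun [set: R] (fun x => (quot (x, y))%:E).
Proof.
apply/measurable_EFinP; apply: (measurableT_comp mquot); exact: measurable_fun_pair.
Qed.

Lemma measurable_gagliardo : measurable_fun [set: R] (gagliardo a).
Proof. by apply: (measurable_integral_fst _ mquot quot0); exact: measurable_itv. Qed.

Lemma gagliardo_ge0 y : (0 <= gagliardo a y)%E.
Proof. by apply: integral_ge0 => x _; rewrite lee_fin; exact: (quot0 (x, y)). Qed.

Let sqr_le_quot (c x y : R) : 0 < c -> (x - y) ^+ 2 <= c -> (a x - a y) ^+ 2 <= c * quot (x, y).
Proof.
move=> c0 xyc; rewrite /quot/=.
have [->|xy] := eqVneq x y; first by rewrite subrr expr0n mul0r mulr0.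
have xy0 : 0 < (x - y) ^+ 2 by rewrite exprn_even_gt0//= subr_eq0.
by rewrite mulrCA ler_peMr ?sqr_ge0// ler_pdivlMr// mul1r.
Qed.

(** Points of the window are within [2 h] of [t], so squared differences are at most [4 h ^ 2] times
    the quotients; averaging divides by [h]. *)
Lemma avg_near i t : (i < K)%N -> i%:R * h <= t <= i.+2%:R * h ->
  (((avg a i - a t) ^+ 2)%:E <= (4 * h)%:E * gagliardo a t)%E.
Proof.
move=> iK /andP[t1 t2]; apply: (le_trans (avg_dist_le (a t) (ia_w iK))).
have -> : (4 * h)%:E = (h^-1%:E * (4 * h ^+ 2)%:E)%E.
  by rewrite -EFinM; congr EFin; field; rewrite gt_eqF.
rewrite -muleA lee_wpmul2l ?lee_fin ?invr_ge0 ?(ltW h0)//.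
apply: (@le_trans _ _ (\int[mu]_(x in window i) ((4 * h ^+ 2)%:E * (quot (x, t))%:E))%E).
  apply: ge0_le_integral => //; first exact: measurable_window.
  - by move=> x _; rewrite lee_fin sqr_ge0.
  - apply/measurable_EFinP/measurable_funTS; apply: measurable_funX; exact: measurable_funB.
  - exact: (measurable_funTS (measurable_funeM _ (mquot_sec t))).
  - move=> x; rewrite /window/= in_itv/= => /andP[x1 x2]; rewrite -EFinM lee_fin.
    apply: sqr_le_quot; first by rewrite mulr_gt0// exprn_gt0.
    have -> : 4 * h ^+ 2 = (2 * h) ^+ 2 by ring.
    have h1 : x - t <= 2 * h by move: x2 t1; rewrite -(natr1 i); lra.
    have h2 : t - x <= 2 * h by move: x1 t2; rewrite -(natr1 i.+1) -(natr1 i); lra.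
    by rewrite -subr_ge0 subr_sqr mulr_ge0//; lra.
rewrite ge0_integralZl_EFin//; last 4 first.
- exact: measurable_window.
- by move=> x _; rewrite lee_fin quot0.
- exact: (measurable_funTS (mquot_sec t)).
- by rewrite mulr_ge0// sqr_ge0.
apply: lee_wpmul2l; first by rewrite lee_fin mulr_ge0// sqr_ge0.
apply: ge0_subset_integral => //; first exact: measurable_window.
- exact: (measurable_funTS (mquot_sec t)).
- by move=> x _; rewrite lee_fin quot0.
- exact: window_sub.
Qed.

(** Jensen in both windows reduces the claim to [(x - y) ^ 2 <= 4 (i - j) ^ 2 h ^ 2] for [i <> j],
    which holds because two points differ from the distance of their windows by at most [h]. The
    products of windows then tile a part of [[0, d] ^ 2]. *)
Lemma Hs_avg :
  ((Hs (avg a) K)%:E <= 4%:E * \int[mu]_(y in `[0%R, d]) gagliardo a y)%E.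
Proof.
pose W (i j : nat) := (\int[mu]_(y in window i) \int[mu]_(x in window j) (quot (x, y))%:E)%E.
have mQ j : measurable_fun [set: R] (fun y => \int[mu]_(x in window j) (quot (x, y))%:E)%E.
  by apply: (measurable_integral_fst _ mquot quot0); exact: measurable_window.
have Q0 j y : (0 <= \int[mu]_(x in window j) (quot (x, y))%:E)%E.
  by apply: integral_ge0 => x _; rewrite lee_fin quot0.
have W0 i j : (0 <= W i j)%E by apply: integral_ge0 => y _.
have term (i j : nat) : (i < K)%N -> (j < K)%N ->
    (((avg a i - avg a j) ^+ 2 / (i%:R - j%:R) ^+ 2)%:E <= 4%:E * W i j)%E.
  move=> iK jK; have [<-|ij] := eqVneq i j.
    by rewrite !subrr expr0n mul0r mule_ge0.
  have D1 : (1 : R) <= (i%:R - j%:R) ^+ 2.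
    have [lt|lt|e] := ltngtP i j; last by rewrite e eqxx in ij.
    - have : (i.+1%:R : R) <= j%:R by rewrite ler_nat.
      by rewrite -natr1 => ?; rewrite -subr_ge0 (_ : _ - _ = (j%:R - i%:R - 1) * (j%:R - i%:R + 1)); [rewrite mulr_ge0//; lra|ring].
    - have : (j.+1%:R : R) <= i%:R by rewrite ler_nat.
      by rewrite -natr1 => ?; rewrite -subr_ge0 (_ : _ - _ = (i%:R - j%:R - 1) * (i%:R - j%:R + 1)); [rewrite mulr_ge0//; lra|ring].
  set D := (i%:R - j%:R) ^+ 2 in D1 *; have D0 : 0 < D by lra.
  have step : (((avg a i - avg a j) ^+ 2)%:E <= (4 * D)%:E * W i j)%E.
    apply: (le_trans (avg_dist_le _ (ia_w iK))).
    rewrite -lee_pdivlMl ?invr_gt0// invrK.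
    rewrite [leRHS]muleA -EFinM.
    have cE : h * (4 * D) = h^-1 * (4 * D * h ^+ 2) by field; rewrite gt_eqF.
    rewrite cE.
    rewrite /W -ge0_integralZl_EFin//; last 3 first.
    - exact: measurable_window.
    - exact: (measurable_funTS (mQ j)).
    - by rewrite -cE; apply: mulr_ge0; [exact: ltW|apply: mulr_ge0 => //; exact: ltW].
    apply: ge0_le_integral => //; first exact: measurable_window.
    - by move=> x _; rewrite lee_fin sqr_ge0.
    - apply/measurable_EFinP/measurable_funTS; apply: measurable_funX; exact: measurable_funB.
    - by apply: measurable_funTS; apply: measurable_funeM; exact: mQ.
    - move=> y yi; rewrite -sqrrN opprB.
      apply: (le_trans (avg_dist_le _ (ia_w jK))); rewrite EFinM -muleA.
      rewrite lee_wpmul2l ?lee_fin ?invr_ge0 ?(ltW h0)//.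
      rewrite -ge0_integralZl_EFin//; last 4 first.
      - exact: measurable_window.
      - by move=> x _; rewrite lee_fin quot0.
      - exact: (measurable_funTS (mquot_sec y)).
      - by apply: mulr_ge0; [apply: mulr_ge0 => //; exact: ltW|exact: sqr_ge0].
      apply: ge0_le_integral => //; first exact: measurable_window.
      - by move=> x _; rewrite lee_fin sqr_ge0.
      - apply/measurable_EFinP/measurable_funTS; apply: measurable_funX; exact: measurable_funB.
      - exact: (measurable_funTS (measurable_funeM _ (mquot_sec y))).
      - move=> x xj; rewrite -EFinM lee_fin; apply: sqr_le_quot.
          by apply: mulr_gt0; [exact: mulr_gt0|exact: exprn_gt0].
        move: yi xj; rewrite /window/= !in_itv/= -(natr1 i) -(natr1 j) => /andP[y1 y2] /andP[x1 x2].
        have -> : 4 * D * h ^+ 2 = 4 * ((i%:R - j%:R) * h) ^+ 2 by rewrite /D; ring.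
        have e1 : x - y <= h + (j%:R - i%:R) * h by lra.
        have e2 : - h + (j%:R - i%:R) * h <= x - y by lra.
        have e3 : h ^+ 2 <= ((i%:R - j%:R) * h) ^+ 2 by rewrite exprMn -/D ler_peMl ?sqr_ge0.
        move: e1 e2 e3; set u := x - y; rewrite (_ : (j%:R - i%:R) * h = - ((i%:R - j%:R) * h)); last by ring.
        set v := (i%:R - j%:R) * h => e1 e2 e3.
        have e4 : (u + v) ^+ 2 <= h ^+ 2.
          by rewrite -subr_ge0 subr_sqr mulr_ge0//; lra.
        (* Here [|u + v| <= h <= |v|]; the right-hand side equals [4 v ^ 2 - u ^ 2], written as a
           sum of nonnegative terms. *)
        rewrite -subr_ge0 (_ : _ - _ = 2 * (h ^+ 2 - (u + v) ^+ 2) + 2 * (v ^+ 2 - h ^+ 2) + (u + 2 * v) ^+ 2); last by ring.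
        by rewrite !addr_ge0 ?sqr_ge0// mulr_ge0// subr_ge0.
  rewrite mulrC EFinM lee_pdivrMl// (le_trans step)// EFinM [leRHS]muleCA -!muleA.
  by rewrite muleCA.
have mS : measurable_fun [set: R] (fun y => \sum_(j < K) \int[mu]_(x in window j) (quot (x, y))%:E)%E.
  by apply: emeasurable_sum => j _; exact: mQ.
rewrite Hs_split_pair -sumEFin.
apply: (@le_trans _ _ (\sum_(i < K) 4%:E * \int[mu]_(y in window i) gagliardo a y)%E).
  apply: lee_sum => i _; rewrite -sumEFin.
  apply: (@le_trans _ _ (\sum_(j < K) 4%:E * W i j)%E); first by apply: lee_sum => j _; exact: term.
  rewrite -ge0_sume_distrr//.
  rewrite lee_wpmul2l// /W -ge0_integral_sum//; last 2 first.
  - exact: measurable_window.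
  - by move=> j; exact: (measurable_funTS (mQ j)).
  apply: ge0_le_integral => //; first exact: measurable_window.
  - by move=> y _; exact: sume_ge0.
  - exact: (measurable_funTS mS).
  - exact: (measurable_funTS measurable_gagliardo).
  - move=> y _; rewrite /window sum_integral_itv//; last by move=> x; rewrite lee_fin quot0.
    apply: ge0_subset_integral => //; first exact: (measurable_funTS (mquot_sec y)).
    by move=> x _; rewrite lee_fin quot0.
rewrite -ge0_sume_distrr//; last by move=> i _; apply: integral_ge0 => y _; exact: gagliardo_ge0.
rewrite lee_wpmul2l// /window sum_integral_itv//; last 2 first.
- exact: measurable_gagliardo.
- exact: gagliardo_ge0.
apply: ge0_subset_integral => //; first exact: (measurable_funTS measurable_gagliardo).
by move=> y _; exact: gagliardo_ge0.
Qed.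

Lemma avg_refl i : (i < K)%N -> avg (fun x => a (d - x)) i = avg a (K - i.+1).
Proof.
move=> iK; rewrite /avg; congr (_ * fine _); rewrite !/Rintegral.
have mEa : measurable_fun [set: R] (EFin \o a) by exact/measurable_EFinP.
have wE : window i = (fun x => d - x) @^-1` window (K - i.+1).
  have e1 : d - (h / 2 + i.+1%:R * h) = h / 2 + (K - i.+1)%:R * h.
    by rewrite dE (natrB _ iK) -(natr1 K) -(natr1 i); field.
  have e2 : d - (h / 2 + i%:R * h) = h / 2 + (K - i.+1).+1%:R * h.
    by rewrite dE subnSK// (natrB _ (ltnW iK)) -(natr1 K); field.
  by rewrite /window -(refl_itv d) e1 e2.
(* The change of variable is stated for nonnegative integrands, hence the positive and negative
   parts. *)
rewrite {1}wE integralE [RHS]integralE; congr (_ - _)%E.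
  apply: etrans (ge0_integral_refl d (measurable_window (K - i.+1)) (measurable_funTS (measurable_funepos mEa)) _).
    by apply: eq_integral => x _; rewrite !funeposE.
  by move=> x _; exact: funepos_ge0.
apply: etrans (ge0_integral_refl d (measurable_window (K - i.+1)) (measurable_funTS (measurable_funeneg mEa)) _).
  by apply: eq_integral => x _; rewrite !funenegE.
by move=> x _; exact: funeneg_ge0.
Qed.

(** On [window q] one has [x <= (q + 3/2) h <= 2 (q + 1) h], so [1 / (q + 1)] is at most [2 h / x],
    and this [h] cancels the normalisation of the averages. *)
Lemma Kc_avg b : measurable_fun [set: R] b -> mu.-integrable `[0, d] (EFin \o b) ->
  ((\sum_(q < K) (avg a q - avg b q) ^+ 2 / q.+1%:R)%:E <=
   2%:E * \int[mu]_(x in `[0%R, d]) ((a x - b x) ^+ 2 / x)%:E)%E.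
Proof.
move=> mb ib.
have ib_w i : (i < K)%N -> mu.-integrable (window i) (EFin \o b).
  by move=> iK; apply: integrableS ib => //; [exact: measurable_window|exact: window_sub].
(* The absolute value makes the integrand nonnegative on the whole line, as summation over adjacent
   windows requires. *)
pose g x := (a x - b x) ^+ 2 / `|x|.
have g0 x : (0 <= (g x)%:E)%E by rewrite lee_fin divr_ge0 ?sqr_ge0.
have mg : measurable_fun [set: R] (fun x => (g x)%:E).
  apply/measurable_EFinP; apply: measurable_funM.
    by apply: measurable_funX; exact: measurable_funB.
  by apply: measurableT_comp; [exact: measurable_invr|exact: normr_measurable].
have -> : (\int[mu]_(x in `[0%R, d]) ((a x - b x) ^+ 2 / x)%:E = \int[mu]_(x in `[0%R, d]) (g x)%:E)%E.
  by apply: eq_integral => x; rewrite inE/= in_itv/= => /andP[x0 _]; rewrite /g ger0_norm.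
rewrite -sumEFin.
apply: (@le_trans _ _ (\sum_(q < K) 2%:E * \int[mu]_(x in window q) (g x)%:E)%E).
  apply: lee_sum => q _; have qK := ltn_ord q.
  have iab : mu.-integrable (window q) (EFin \o (fun x => a x - b x)).
    by apply: integrable_EFinB; [exact: measurable_window|exact: ia_w|exact: ib_w].
  rewrite avgB//; [|exact: ia_w|exact: ib_w].
  rewrite mulrC EFinM lee_pdivrMl// (le_trans (avg_sqr_le iab))//.
  rewrite lee_pdivrMl// !muleA -!EFinM -ge0_integralZl_EFin//; last 3 first.
  - exact: measurable_window.
  - exact: measurable_funTS.
  - by rewrite !mulr_ge0// ltW.
  apply: ge0_le_integral => //; first exact: measurable_window.
  - by move=> x _; rewrite lee_fin sqr_ge0.
  - by apply/measurable_EFinP/measurable_funTS; apply: measurable_funX; exact: measurable_funB.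
  - by apply: measurable_funTS; apply: measurable_funeM.
  - move=> x; rewrite /window/= in_itv/= => /andP[x1 x2]; rewrite -EFinM lee_fin /g.
    have x0 : 0 < x by apply: lt_le_trans x1; rewrite ltr_wpDr ?mulr_ge0 ?(ltW h0)// divr_gt0.
    rewrite gtr0_norm// mulrCA ler_peMr ?sqr_ge0// ler_pdivlMr// mul1r (le_trans x2)//.
    have : 0 <= q%:R * h by rewrite mulr_ge0// ltW.
    by rewrite -(natr1 q); lra.
rewrite -ge0_sume_distrr//; last by move=> i _; apply: integral_ge0.
rewrite lee_wpmul2l// /window sum_integral_itv//.
apply: ge0_subset_integral => //; exact: (measurable_funTS mg).
Qed.

End averages.

(** * Interpolation of grid functions *)

Section differentiation_tools.
Context {R : realType}.
Local Notation P2 := (R^o * R^o)%type.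

Lemma differentiable_near (V W : normedModType R) (f g : V -> W) (x : V) :
  (\forall y \near x, f y = g y) -> differentiable g x -> differentiable f x.
Proof.
move=> fg dg; have fgx : f x = g x := nbhs_singleton fg.
have cg : continuous ('d g x) by exact: diff_continuous.
have H : f \o shift x = cst (f x) + 'd g x +o_ 0 id.
  apply/eqaddoP => e e0; have /eqaddoP/(_ e e0) := diff_locally dg.
  have fg0 : \forall y \near (0 : V), f (y + x) = g (y + x).
    by move: fg; rewrite (near_shift 0)/= subr0.
  by apply: filterS2 fg0 => y /= fgy; rewrite !fctE/= fgy fgx.
apply/diff_locallyP; rewrite (diff_unique cg H); split => //.
Qed.

(** Meant for the square of the positive part: one quadratic error estimate settles all signs of [t]
    and [s + t]. *)
Lemma is_derive_quadratic (f : R -> R) (t l : R) :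
  (forall s, `|f (s + t) - f t - l * s| <= s ^+ 2) -> is_derive t 1 f l.
Proof.
move=> H.
have aux (A s : R) : s != 0 -> l - s^-1 * A = - (s^-1 * (A - l * s)) by move=> s0; field.
have cv : (fun s => s^-1 *: ((f \o shift t) (s *: 1) - f t)) @ 0^' --> l.
  apply/cvgrPdist_le => e e0.
  near=> s; have s0 : s != 0 by near: s; exact: nbhs_dnbhs_neq.
  have -> : l - s^-1 *: ((f \o shift t) (s *: 1) - f t) = - (s^-1 * (f (s + t) - f t - l * s)).
    transitivity (l - s^-1 * (f (s * 1 + t) - f t)); first by [].
    by rewrite mulr1 aux.
  rewrite normrN normrM normfV ler_pdivrMl ?normr_gt0//.
  rewrite (le_trans (H s))// -real_normK ?num_real// expr2 ler_pM2l ?normr_gt0//.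
  near: s; apply: nbhs_dnbhs; exists e => //= s; rewrite /ball/= sub0r normrN => /ltW//.
apply: DeriveDef; first by apply/cvg_ex; exists l.
exact: cvg_lim.
Unshelve. all: by end_near. Qed.

(** Names the partial derivatives, so that sums, products and local gluing compute them together
    with the regularity. *)
Definition C1_grad (u p q : P2 -> R^o) : Prop :=
  [/\ forall z, differentiable u z, d1 u = p, d2 u = q, continuous p & continuous q].

Lemma C1P (u : P2 -> R^o) : C1 u <-> C1_grad u (d1 u) (d2 u).
Proof.
split=> [[h1 [h2 h3]]|[h1 _ _ h2 h3]]; first exact: And5 h1 erefl erefl h2 h3.
exact: conj h1 (conj h2 h3).
Qed.

Lemma C1_grad_C1 (u p q : P2 -> R^o) : C1_grad u p q -> C1 u.
Proof. by case=> h1 e1 e2 h2 h3; split=> //; rewrite e1 e2. Qed.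

Lemma C1_gradD (u v p q p' q' : P2 -> R^o) : C1_grad u p q -> C1_grad v p' q' ->
  C1_grad (fun z => u z + v z) (fun z => p z + p' z) (fun z => q z + q' z).
Proof.
move=> [du e1 e2 cp cq] [dv e1' e2' cp' cq']; split.
- by move=> z; exact: differentiableD.
- by apply/funext => z; rewrite -e1 -e1'; apply: deriveD; exact: diff_derivable.
- by apply/funext => z; rewrite -e2 -e2'; apply: deriveD; exact: diff_derivable.
- by move=> z; apply: continuousD; [exact: cp|exact: cp'].
- by move=> z; apply: continuousD; [exact: cq|exact: cq'].
Qed.

Lemma C1_gradZ (c : R) (u p q : P2 -> R^o) : C1_grad u p q ->
  C1_grad (fun z => c * u z) (fun z => c * p z) (fun z => c * q z).
Proof.
move=> [du e1 e2 cp cq]; split.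
- by move=> z; exact: differentiableZ.
- by apply/funext => z; rewrite -e1; apply: deriveZ; exact: diff_derivable.
- by apply/funext => z; rewrite -e2; apply: deriveZ; exact: diff_derivable.
- by move=> z; apply: continuousM; [exact: cst_continuous|exact: cp].
- by move=> z; apply: continuousM; [exact: cst_continuous|exact: cq].
Qed.

Lemma C1_grad0 : C1_grad (fun=> 0) (fun=> 0) (fun=> 0).
Proof.
by split => [z|||z|z]; [exact: differentiable_cst| | |exact: cst_continuous..];
  apply/funext => z; exact: derive_cst.
Qed.

Lemma C1_grad_sum n (u p q : 'I_n -> P2 -> R^o) : (forall i, C1_grad (u i) (p i) (q i)) ->
  C1_grad (fun z => \sum_(i < n) u i z) (fun z => \sum_(i < n) p i z) (fun z => \sum_(i < n) q i z).
Proof.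
elim: n u p q => [|n IH] u p q H.
  have := C1_grad0; congr C1_grad; by apply/funext => z; rewrite big_ord0.
have := C1_gradD (IH _ _ _ (fun i => H (widen_ord (leqnSn n) i))) (H ord_max).
by congr C1_grad; apply/funext => z; rewrite big_ord_recr.
Qed.

Lemma C1_grad_tensor (f g f' g' : R -> R) :
  (forall t : R, is_derive t 1 f (f' t)) -> (forall t : R, is_derive t 1 g (g' t)) ->
  continuous f' -> continuous g' ->
  C1_grad (fun z => f z.1 * g z.2) (fun z => f' z.1 * g z.2) (fun z => f z.1 * g' z.2).
Proof.
move=> df dg cf' cg'.
have D1 (k k' : R -> R) : (forall t : R, is_derive t 1 k (k' t)) ->
    forall t : R, differentiable (k : R^o -> R^o) t.
  by move=> dk t; apply/derivable1_diffP; case: (dk t).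
have cont (k k' : R -> R) : (forall t : R, is_derive t 1 k (k' t)) -> continuous (k : R^o -> R^o).
  by move=> dk t; apply: differentiable_continuous; exact: D1 dk t.
have cfst : continuous (fst : P2 -> R^o) by move=> z; exact: cvg_fst.
have csnd : continuous (snd : P2 -> R^o) by move=> z; exact: cvg_snd.
have du z : differentiable (fun z : P2 => f z.1 * g z.2 : R^o) z.
  apply: differentiableM.
  - apply: (@differentiable_comp _ _ _ _ (fst : P2 -> R^o) f); last exact: D1 df _.
    exact: linear_differentiable.
  - apply: (@differentiable_comp _ _ _ _ (snd : P2 -> R^o) g); last exact: D1 dg _.
    exact: linear_differentiable.
have c1 (k : R -> R) : continuous (k : R^o -> R^o) -> continuous (fun z : P2 => k z.1).
  by move=> ck z; apply: continuous_comp; [exact: cfst|exact: ck].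
have c2 (k : R -> R) : continuous (k : R^o -> R^o) -> continuous (fun z : P2 => k z.2).
  by move=> ck z; apply: continuous_comp; [exact: csnd|exact: ck].
split => //.
- apply/funext => -[x y]; have [_ e1] := is_derive_section1 (du (x, y)).
  have [_ e2] : is_derive x 1 (fun s : R => f s * g y) (f' x * g y).
    by have dfx := df x; apply: is_derive_eq; rewrite scaler0 add0r /GRing.scale/= mulrC.
  exact: etrans (esym e1) e2.
- apply/funext => -[x y]; have [_ e1] := is_derive_section2 (du (x, y)).
  have [_ e2] : is_derive y 1 (fun s : R => f x * g s) (f x * g' y).
    exact: is_deriveZ.
  exact: etrans (esym e1) e2.
- by move=> z; apply: continuousM; [exact: c1|exact: (c2 _ (cont _ _ dg))].
- by move=> z; apply: continuousM; [exact: (c1 _ (cont _ _ df))|exact: c2].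
Qed.

(** Being [C^1] with given partial derivatives is a local property; this handles a spline whose
    formula involves the integer part of its argument. *)
Lemma C1_grad_near (u : P2 -> R^o) (p q : P2 -> R^o) :
  (forall z : P2, exists v p' q', C1_grad v p' q' /\
    \forall y \near z, [/\ u y = v y, p y = p' y & q y = q' y]) ->
  C1_grad u p q.
Proof.
move=> H; have ev z v : (\forall y \near z, u y = v y) -> forall w : P2, 'D_w u z = 'D_w v z.
  by move=> uv w; have [->|w0] := eqVneq w 0; [rewrite !derive0|exact: near_eq_derive].
split.
- move=> z; have [v [p' [q' [[dv _ _ _ _] near_z]]]] := H z.
  apply: differentiable_near (dv z); near=> y; by have [] : [/\ u y = v y, p y = p' y & q y = q' y] by near: y.
- apply/funext => z; have [v [p' [q' [[_ e1 _ _ _] near_z]]]] := H z.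
  rewrite /d1 (ev z v); last by apply: filterS near_z => y [].
  by have [_ -> _] := nbhs_singleton near_z; rewrite -e1.
- apply/funext => z; have [v [p' [q' [[_ _ e2 _ _] near_z]]]] := H z.
  rewrite /d2 (ev z v); last by apply: filterS near_z => y [].
  by have [_ _ ->] := nbhs_singleton near_z; rewrite -e2.
- move=> z; have [v [p' [q' [[_ _ _ cp _] near_z]]]] := H z.
  have := cp z; rewrite /continuous_at; have [_ <- _] := nbhs_singleton near_z.
  by apply: cvg_trans; apply: near_eq_cvg; apply: filterS near_z => y [].
- move=> z; have [v [p' [q' [[_ _ _ _ cq] near_z]]]] := H z.
  have := cq z; rewrite /continuous_at; have [_ _ <-] := nbhs_singleton near_z.
  by apply: cvg_trans; apply: near_eq_cvg; apply: filterS near_z => y [].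
Unshelve. all: by end_near. Qed.

End differentiation_tools.

(** * A [C^1] partition of unity on the line *)

Section bump.
Context {R : realType}.
Implicit Types t : R.

Let pos t : R := Num.max 0 t.

Let is_derive_pos2 t : is_derive t 1 (fun t => pos t ^+ 2) (2 * pos t).
Proof.
apply: is_derive_quadratic => s; rewrite /pos ler_norml.
by case: (leP 0 (s + t)) => h1; case: (leP 0 t) => h2; apply/andP; split; nra.
Qed.

Let continuous_pos : continuous pos.
Proof. by move=> t; apply: continuous_max; [exact: cst_continuous|exact: cvg_id]. Qed.

(* 3 t^2 - 2 t^3 on [0, 1], written with positive parts so as to be C^1 on R. *)
Definition smoothstep t : R :=
  3 * pos t ^+ 2 - 2 * (t * pos t ^+ 2) + 3 * pos (t - 1) ^+ 2 + 2 * ((t - 1) * pos (t - 1) ^+ 2).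

Definition smoothstep' t : R := 6 * (pos t - pos t ^+ 2 + pos (t - 1) + pos (t - 1) ^+ 2).

Lemma is_derive_smoothstep t : is_derive t 1 smoothstep (smoothstep' t).
Proof.
have dp := is_derive_pos2 t.
have ds : is_derive t 1 (fun t => t - 1) (1 : R).
  by apply: is_derive_eq; rewrite subr0.
have dp1 : is_derive t 1 (fun t => pos (t - 1) ^+ 2) (2 * pos (t - 1)).
  have := @is_derive1_comp _ (fun t => pos t ^+ 2) (fun t => t - 1) t _ _ (is_derive_pos2 (t - 1)) ds.
  by rewrite mulr1.
rewrite /smoothstep; apply: is_derive_eq.
rewrite /smoothstep' /GRing.scale/=.
have pE s : s * pos s = pos s ^+ 2.
  by rewrite /pos; case: (leP 0 s) => _; ring.
have := pE t; have := pE (t - 1); set A := pos t; set B := pos (t - 1) => e1 e2.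
have e1' : t * B = B ^+ 2 + B by rewrite -e1; ring.
rewrite -/A -/B; nra.
Qed.

Lemma continuous_smoothstep' : continuous smoothstep'.
Proof.
move=> t; have c1 : {for t, continuous (fun t => pos (t - 1))}.
  apply: continuous_comp; last exact: continuous_pos.
  by apply: continuousB; [exact: cvg_id|exact: cst_continuous].
change {for t, continuous (fun t => 6 * (pos t - pos t ^+ 2 + pos (t - 1) + pos (t - 1) ^+ 2))}.
apply: continuousM; first exact: cst_continuous.
apply: continuousD; last by apply: continuousM.
apply: continuousD => //; apply: continuousB; first exact: continuous_pos.
by apply: continuousM; exact: continuous_pos.
Qed.

Lemma smoothstep_mid t : 0 <= t <= 1 -> smoothstep t = 3 * t ^+ 2 - 2 * t ^+ 3.
Proof.
move=> /andP[t0 t1]; rewrite /smoothstep /pos (max_idPr t0) max_l; last by rewrite subr_le0.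
by ring.
Qed.

Lemma smoothstep'_mid t : 0 <= t <= 1 -> smoothstep' t = 6 * (t - t ^+ 2).
Proof.
move=> /andP[t0 t1]; rewrite /smoothstep' /pos (max_idPr t0) max_l; last by rewrite subr_le0.
by ring.
Qed.

Lemma smoothstep_neg t : t <= 0 -> smoothstep t = 0 /\ smoothstep' t = 0.
Proof.
move=> t0; rewrite /smoothstep /smoothstep' /pos !max_l//; last by rewrite subr_le0; lra.
by split; ring.
Qed.

Lemma smoothstep_ge1 t : 1 <= t -> smoothstep t = 1 /\ smoothstep' t = 0.
Proof.
move=> t1; rewrite /smoothstep /smoothstep' /pos !max_r; [|lra..].
by split; ring.
Qed.

(* The integer translates form a partition of unity with at most two nonzero terms
   at each point. *)
Definition cbump t : R := smoothstep (t + 1) - smoothstep t.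

Definition cbump' t : R := smoothstep' (t + 1) - smoothstep' t.

Lemma is_derive_cbump t : is_derive t 1 cbump (cbump' t).
Proof.
have ds : is_derive t 1 (fun t => t + 1) (1 : R).
  by apply: is_derive_eq; rewrite addr0.
have d1 : is_derive t 1 (fun t => smoothstep (t + 1)) (smoothstep' (t + 1)).
  have := @is_derive1_comp _ smoothstep (fun t => t + 1) t _ _ (is_derive_smoothstep (t + 1)) ds.
  by rewrite mulr1.
have d2 := is_derive_smoothstep t.
by rewrite /cbump /cbump'; apply: is_derive_eq.
Qed.

Lemma continuous_cbump' : continuous cbump'.
Proof.
move=> t; change {for t, continuous (fun t => smoothstep' (t + 1) - smoothstep' t)}.
apply: continuousB; last exact: continuous_smoothstep'.
apply: continuous_comp; last exact: continuous_smoothstep'.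
by apply: continuousD; [exact: cvg_id|exact: cst_continuous].
Qed.

Lemma cbump_out t : 1 <= `|t| -> cbump t = 0 /\ cbump' t = 0.
Proof.
rewrite /cbump /cbump' ler_normr => /orP[t1|t1].
  have [-> ->] := smoothstep_ge1 t1.
  have [-> ->] : smoothstep (t + 1) = 1 /\ smoothstep' (t + 1) = 0 by apply: smoothstep_ge1; lra.
  by rewrite !subrr.
have [-> ->] : smoothstep t = 0 /\ smoothstep' t = 0 by apply: smoothstep_neg; lra.
have [-> ->] : smoothstep (t + 1) = 0 /\ smoothstep' (t + 1) = 0 by apply: smoothstep_neg; lra.
by rewrite !subrr.
Qed.

Lemma cbump_in t : 0 <= t <= 1 ->
  [/\ cbump t = 1 - smoothstep t, cbump (t - 1) = smoothstep t,
      cbump' t = - smoothstep' t & cbump' (t - 1) = smoothstep' t].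
Proof.
move=> /andP[t0 t1]; rewrite /cbump /cbump' subrK.
have [-> ->] : smoothstep (t + 1) = 1 /\ smoothstep' (t + 1) = 0 by apply: smoothstep_ge1; lra.
have [-> ->] : smoothstep (t - 1) = 0 /\ smoothstep' (t - 1) = 0 by apply: smoothstep_neg; lra.
by split; ring.
Qed.

(** The derivative [6 (t - t ^ 2)] is largest at [t = 1/2], where it equals [3/2]. *)
Lemma smoothstep_bounds t : 0 <= t <= 1 -> 0 <= smoothstep t <= 1 /\ smoothstep' t ^+ 2 <= 9 / 4.
Proof.
move=> t01; rewrite smoothstep_mid// smoothstep'_mid//; move/andP: t01 => [t0 t1].
split.
  apply/andP; split.
    by rewrite (_ : _ - _ = t ^+ 2 * (3 - 2 * t)); [rewrite mulr_ge0 ?sqr_ge0//; lra|ring].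
  rewrite -subr_ge0 (_ : _ - _ = (1 - t) ^+ 2 * (1 + 2 * t)); last by ring.
  by rewrite mulr_ge0 ?sqr_ge0//; lra.
have h1 : 0 <= t - t ^+ 2.
  by rewrite (_ : _ - _ = t * (1 - t)); [rewrite mulr_ge0//; lra|ring].
have h2 : t - t ^+ 2 <= 1 / 4.
  by rewrite -subr_ge0 (_ : _ - _ = (t - 1 / 2) ^+ 2); [exact: sqr_ge0|field].
move: h1 h2; set v := t - t ^+ 2 => h1 h2.
rewrite -subr_ge0 (_ : _ - _ = (3 / 2 - 6 * v) * (3 / 2 + 6 * v)); last by field.
by rewrite mulr_ge0//; lra.
Qed.

End bump.

(** * [C^1] interpolation on the grid [(h Z)^2] *)

Section spline.
Context {R : realType}.
Local Notation mu := (@lebesgue_measure R).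
Local Notation P2 := (R^o * R^o)%type.
Variables (h : R) (h0 : 0 < h) (a : int -> int -> R).

Let fl (x : R) : int := Num.floor (x / h).

Definition node_bump (p : int) (x : R) : R := cbump (x / h - p%:~R).

Definition node_bump' (p : int) (x : R) : R := h^-1 * cbump' (x / h - p%:~R).

Definition supported (phi : int -> R -> R) :=
  forall p x, 1 <= `|x / h - p%:~R| -> phi p x = 0.

Lemma node_bump_supported : supported node_bump.
Proof. by move=> p x /cbump_out[]. Qed.

Lemma node_bump'_supported : supported node_bump'.
Proof. by move=> p x /cbump_out[_ e]; rewrite /node_bump' e mulr0. Qed.

Lemma is_derive_node_bump p (x : R) : is_derive x 1 (node_bump p) (node_bump' p x).
Proof.
have ds : is_derive x 1 (fun t => t / h - p%:~R) (h^-1 : R).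
  have : is_derive x 1 (fun t => h^-1 *: t - p%:~R) (h^-1 *: (1 : R) - 0 : R).
    by apply: is_deriveB.
  rewrite subr0 /GRing.scale/= mulr1; congr is_derive.
  by apply/funext => t; rewrite mulrC.
have := @is_derive1_comp _ cbump (fun t => t / h - p%:~R) x _ _ (is_derive_cbump _) ds.
by rewrite mulrC.
Qed.

Lemma continuous_node_bump' p : continuous (node_bump' p).
Proof.
move=> x; change {for x, continuous (fun t : R => h^-1 * cbump' (t / h - p%:~R))}.
apply: continuousM; first exact: cst_continuous.
apply: continuous_comp; last exact: continuous_cbump'.
apply: continuousB; last exact: cst_continuous.
by apply: continuousM; [exact: cvg_id|exact: cst_continuous].
Qed.

Let sum2 (F : nat -> R) : \sum_(i < 2) F i = F 0%N + F 1%N.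
Proof. by rewrite !big_ord_recr big_ord0/= add0r. Qed.

Let sum4 (F : nat -> R) : \sum_(i < 4) F i = F 0%N + F 1%N + F 2%N + F 3%N.
Proof. by rewrite !big_ord_recr big_ord0/= add0r. Qed.

(** If the integer part of [x / h] is within one of [m], the two nodes whose bumps can be nonzero at
    [x] are among the four from [m - 1] to [m + 2]. *)
Let window4 (phi : int -> R -> R) (c : int -> R) (m : int) x : supported phi ->
  m - 1 <= fl x <= m + 1 ->
  \sum_(i < 2) c (fl x + i%:Z) * phi (fl x + i%:Z) x =
  \sum_(i < 4) c (m - 1 + i%:Z) * phi (m - 1 + i%:Z) x.
Proof.
move=> sphi mx.
have f1 : (fl x)%:~R <= x / h by exact: floor_le.
have f2 : x / h < (fl x + 1)%:~R by exact: floorD1_gt.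
rewrite intrD in f2.
have out (p : int) : (p <= fl x - 1) \/ (fl x + 2 <= p) -> phi p x = 0.
  case=> pf; apply: sphi; rewrite ler_normr.
  - have : (p%:~R : R) <= (fl x - 1)%:~R by rewrite ler_int.
    by rewrite intrD => h1; apply/orP; left; lra.
  - have : ((fl x + 2)%:~R : R) <= p%:~R by rewrite ler_int.
    by rewrite intrD => h1; apply/orP; right; lra.
rewrite (sum2 (fun i => c (fl x + i%:Z) * phi (fl x + i%:Z) x)).
rewrite (sum4 (fun i => c (m - 1 + i%:Z) * phi (m - 1 + i%:Z) x)).
have [e|[e|e]] : fl x = m - 1 \/ fl x = m \/ fl x = m + 1 by lia.
- have z2 : phi (m - 1 + 2%:Z) x = 0 by apply: out; rewrite e; right; lia.
  have z3 : phi (m - 1 + 3%:Z) x = 0 by apply: out; rewrite e; right; lia.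
  by rewrite z2 z3 !mulr0 !addr0 e.
- have z0 : phi (m - 1 + 0%:Z) x = 0 by apply: out; rewrite e; left; lia.
  have z3 : phi (m - 1 + 3%:Z) x = 0 by apply: out; rewrite e; right; lia.
  have i1 : m - 1 + 1%:Z = m + 0%:Z by lia.
  have i2 : m - 1 + 2%:Z = m + 1%:Z by lia.
  by rewrite z0 z3 e i1 i2 !mulr0 add0r [RHS]addr0.
- have z0 : phi (m - 1 + 0%:Z) x = 0 by apply: out; rewrite e; left; lia.
  have z1 : phi (m - 1 + 1%:Z) x = 0 by apply: out; rewrite e; left; lia.
  have i2 : m - 1 + 2%:Z = m + 1 + 0%:Z by lia.
  have i3 : m - 1 + 3%:Z = m + 1 + 1%:Z by lia.
  by rewrite z0 z1 e i2 i3 !mulr0 !add0r.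
Qed.

(** The tensor product spline with node values [a]. At a given point only the bumps at the corners
    of its cell can be nonzero, so the sum over all nodes reduces to these four. *)
Definition spline2 (phi psi : int -> R -> R) (z : P2) : R :=
  \sum_(i < 2) \sum_(k < 2) a (fl z.1 + i%:Z) (fl z.2 + k%:Z) *
    (phi (fl z.1 + i%:Z) z.1 * psi (fl z.2 + k%:Z) z.2).

(** A sum over sixteen fixed nodes, equal to the spline in a whole neighbourhood of any point of the
    cell [(m, n)]; differentiability across cell boundaries follows from it. *)
Let spline4 (phi psi : int -> R -> R) (m n : int) (z : P2) : R :=
  \sum_(i < 4) \sum_(k < 4) a (m - 1 + i%:Z) (n - 1 + k%:Z) *
    (phi (m - 1 + i%:Z) z.1 * psi (n - 1 + k%:Z) z.2).

Let spline24 phi psi m n z : supported phi -> supported psi ->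
  m - 1 <= fl z.1 <= m + 1 -> n - 1 <= fl z.2 <= n + 1 ->
  spline2 phi psi z = spline4 phi psi m n z.
Proof.
move=> sphi spsi mz nz; rewrite /spline2 /spline4.
transitivity (\sum_(i < 2) (\sum_(k < 4) a (fl z.1 + i%:Z) (n - 1 + k%:Z) *
    psi (n - 1 + k%:Z) z.2) * phi (fl z.1 + i%:Z) z.1).
  apply: eq_bigr => i _; rewrite -(window4 (a (fl z.1 + i%:Z)) spsi nz) mulr_suml.
  by apply: eq_bigr => k _; ring.
rewrite (window4 (fun p => \sum_(k < 4) a p (n - 1 + k%:Z) * psi (n - 1 + k%:Z) z.2) sphi mz).
apply: eq_bigr => i _; rewrite mulr_suml; by apply: eq_bigr => k _; ring.
Qed.

Let near_fl (z : P2) : \forall y \near z,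
  fl z.1 - 1 <= fl y.1 <= fl z.1 + 1 /\ fl z.2 - 1 <= fl y.2 <= fl z.2 + 1.
Proof.
have key (x y : R) : `|x - y| < h -> fl x - 1 <= fl y <= fl x + 1.
  rewrite ltr_norml => /andP[xy1 xy2].
  have e1 : y / h < x / h + 1 by rewrite -(divff (lt0r_neq0 h0)) -mulrDl ltr_pM2r ?invr_gt0//; lra.
  have e2 : x / h < y / h + 1 by rewrite -(divff (lt0r_neq0 h0)) -mulrDl ltr_pM2r ?invr_gt0//; lra.
  have fx1 : (fl x)%:~R <= x / h by exact: floor_le.
  have fx2 : x / h < (fl x + 1)%:~R by exact: floorD1_gt.
  have fy1 : (fl y)%:~R <= y / h by exact: floor_le.
  have fy2 : y / h < (fl y + 1)%:~R by exact: floorD1_gt.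
  have g1 : (fl y < fl x + 2)%R.
    by rewrite -(ltr_int R) intrD; move: fx2; rewrite intrD; lra.
  have g2 : (fl x < fl y + 2)%R.
    by rewrite -(ltr_int R) intrD; move: fy2; rewrite intrD; lra.
  by apply/andP; split; lia.
by exists (ball z.1 h, ball z.2 h) => /=; [split; exact: nbhsx_ballx|move=> y [/= /key ? /key ?]].
Qed.

Lemma C1_grad_spline :
  C1_grad (spline2 node_bump node_bump) (spline2 node_bump' node_bump) (spline2 node_bump node_bump').
Proof.
have sb := node_bump_supported; have sb' := node_bump'_supported.
apply: C1_grad_near => z.
exists (spline4 node_bump node_bump (fl z.1) (fl z.2)), (spline4 node_bump' node_bump (fl z.1) (fl z.2)),
  (spline4 node_bump node_bump' (fl z.1) (fl z.2)); split.
  apply: C1_grad_sum => i; apply: C1_grad_sum => k; apply: C1_gradZ.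
  apply: C1_grad_tensor; [exact: is_derive_node_bump..|exact: continuous_node_bump'|exact: continuous_node_bump'].
by apply: filterS (near_fl z) => y [y1 y2]; split; exact: spline24.
Qed.

Let in_cell (m : int) (x : R) : fl x = m -> 0 <= x / h - m%:~R <= 1.
Proof.
move=> <-; have f1 : (fl x)%:~R <= x / h by exact: floor_le.
have : x / h < (fl x + 1)%:~R by exact: floorD1_gt.
by rewrite intrD => f2; apply/andP; split; lra.
Qed.

Let cell_values (m : int) (x : R) : fl x = m -> let s := smoothstep (x / h - m%:~R) in
  let s' := smoothstep' (x / h - m%:~R) in
  [/\ node_bump (m + 0) x = 1 - s, node_bump (m + 1) x = s,
      node_bump' (m + 0) x = - (h^-1 * s') & node_bump' (m + 1) x = h^-1 * s'].
Proof.
move=> /in_cell /cbump_in[e1 e2 e3 e4] s s'.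
have em : x / h - (m + 1)%:~R = x / h - m%:~R - 1 by rewrite intrD; ring.
by rewrite /node_bump /node_bump' addr0 e1 e3 em e2 e4; split; rewrite ?mulrN.
Qed.

Let spline2E phi psi (m n : int) z : fl z.1 = m -> fl z.2 = n ->
  spline2 phi psi z =
  a m n * (phi (m + 0) z.1 * psi (n + 0) z.2) + a m (n + 1) * (phi (m + 0) z.1 * psi (n + 1) z.2) +
  (a (m + 1) n * (phi (m + 1) z.1 * psi (n + 0) z.2) + a (m + 1) (n + 1) * (phi (m + 1) z.1 * psi (n + 1) z.2)).
Proof.
move=> <- <-; rewrite /spline2.
rewrite (sum2 (fun i => \sum_(k < 2) a (fl z.1 + i%:Z) (fl z.2 + k%:Z) *
  (phi (fl z.1 + i%:Z) z.1 * psi (fl z.2 + k%:Z) z.2))).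
rewrite (sum2 (fun k => a (fl z.1 + 0%:Z) (fl z.2 + k%:Z) *
  (phi (fl z.1 + 0%:Z) z.1 * psi (fl z.2 + k%:Z) z.2))).
rewrite (sum2 (fun k => a (fl z.1 + 1%:Z) (fl z.2 + k%:Z) *
  (phi (fl z.1 + 1%:Z) z.1 * psi (fl z.2 + k%:Z) z.2))).
by rewrite !addr0.
Qed.

Let convex_sqr (s A B : R) : 0 <= s <= 1 -> ((1 - s) * A + s * B) ^+ 2 <= A ^+ 2 + B ^+ 2.
Proof.
move=> /andP[s0 s1]; rewrite -subr_ge0.
rewrite (_ : _ - _ = (1 - s) * s * (A - B) ^+ 2 + s * A ^+ 2 + (1 - s) * B ^+ 2); last by ring.
have s1' : 0 <= 1 - s by rewrite subr_ge0.
apply: addr_ge0; last by apply: mulr_ge0 => //; exact: sqr_ge0.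
apply: addr_ge0; last by apply: mulr_ge0 => //; exact: sqr_ge0.
by apply: mulr_ge0; [exact: mulr_ge0|exact: sqr_ge0].
Qed.

Let scaled_le (c q A B s : R) : q ^+ 2 <= 9 / 4 -> 0 <= s <= 1 ->
  (c * (q * ((1 - s) * A + s * B))) ^+ 2 <= c ^+ 2 * (9 / 4) * (A ^+ 2 + B ^+ 2).
Proof.
move=> q94 s01; have := convex_sqr A B s01; set v := (1 - s) * A + s * B => hv.
rewrite (_ : (c * (q * v)) ^+ 2 = c ^+ 2 * (q ^+ 2 * v ^+ 2)); last by ring.
rewrite -[leRHS]mulrA; apply: ler_wpM2l; first exact: sqr_ge0.
by apply: ler_pM => //; exact: sqr_ge0.
Qed.

Definition cell_energy (m n : int) : R :=
  (a (m + 1) n - a m n) ^+ 2 + (a (m + 1) (n + 1) - a m (n + 1)) ^+ 2 +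
  ((a m (n + 1) - a m n) ^+ 2 + (a (m + 1) (n + 1) - a (m + 1) n) ^+ 2).

(** In a cell the derivative in [x] is [smoothstep' / h] times a convex combination of the two
    horizontal differences, and likewise in [y]; the square of [smoothstep'] is at most [9 / 4]. *)
Lemma spline_cell_energy z :
  spline2 node_bump' node_bump z ^+ 2 + spline2 node_bump node_bump' z ^+ 2 <=
  9 / 4 / h ^+ 2 * cell_energy (fl z.1) (fl z.2).
Proof.
have [b1 b2 b3 b4] := cell_values (erefl (fl z.1)).
have [c1 c2 c3 c4] := cell_values (erefl (fl z.2)).
rewrite !(spline2E _ _ (erefl (fl z.1)) (erefl (fl z.2))) b1 b2 b3 b4 c1 c2 c3 c4.
have [] := smoothstep_bounds (in_cell (erefl (fl z.1))).
have [] := smoothstep_bounds (in_cell (erefl (fl z.2))).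
set s := smoothstep _; set s' := smoothstep' _; set t := smoothstep _; set t' := smoothstep' _.
move=> s01 s'1 t01 t'1.
rewrite /cell_energy; set a00 := a (fl z.1) (fl z.2); set a01 := a (fl z.1) (fl z.2 + 1).
set a10 := a (fl z.1 + 1) (fl z.2); set a11 := a (fl z.1 + 1) (fl z.2 + 1).
have -> : 9 / 4 / h ^+ 2 = h^-1 ^+ 2 * (9 / 4) by rewrite exprVn mulrC.
rewrite [leRHS]mulrDr; apply: lerD.
  rewrite [X in X ^+ 2](_ : _ = h^-1 * (t' * ((1 - s) * (a10 - a00) + s * (a11 - a01)))); last by ring.
  exact: scaled_le.
rewrite [X in X ^+ 2](_ : _ = h^-1 * (s' * ((1 - t) * (a01 - a00) + t * (a11 - a10)))); last by ring.
exact: scaled_le.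
Qed.

Let fl_node (m : int) : fl (m%:~R * h) = m.
Proof. by rewrite /fl mulfK ?gt_eqF// intrKfloor. Qed.

(** On a grid line the spline is a convex combination of the two neighbouring node values. *)
Lemma spline_hline (x c : R) (n : int) :
  (spline2 node_bump node_bump (x, n%:~R * h) - c) ^+ 2 <=
  (a (fl x) n - c) ^+ 2 + (a (fl x + 1) n - c) ^+ 2.
Proof.
have [b1 b2 _ _] := cell_values (erefl (fl x)).
have [c1 c2 _ _] := cell_values (fl_node n).
rewrite (@spline2E _ _ _ _ (x, n%:~R * h) (erefl (fl x)) (fl_node n)) b1 b2 c1 c2.
have [s01 _] := smoothstep_bounds (in_cell (erefl (fl x))).
rewrite /= mulfK ?gt_eqF// subrr (proj1 (smoothstep_neg (lexx 0))).
set s := smoothstep _ in s01 *.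
apply: le_trans (convex_sqr _ _ s01); rewrite le_eqVlt; apply/orP; left; apply/eqP.
by congr (_ ^+ 2); ring.
Qed.

Lemma spline_vline (y c : R) (m : int) :
  (spline2 node_bump node_bump (m%:~R * h, y) - c) ^+ 2 <=
  (a m (fl y) - c) ^+ 2 + (a m (fl y + 1) - c) ^+ 2.
Proof.
have [b1 b2 _ _] := cell_values (fl_node m).
have [c1 c2 _ _] := cell_values (erefl (fl y)).
rewrite (@spline2E _ _ _ _ (m%:~R * h, y) (fl_node m) (erefl (fl y))) b1 b2 c1 c2.
have [s01 _] := smoothstep_bounds (in_cell (erefl (fl y))).
rewrite /= mulfK ?gt_eqF// subrr (proj1 (smoothstep_neg (lexx 0))).
set s := smoothstep _ in s01 *.
apply: le_trans (convex_sqr _ _ s01); rewrite le_eqVlt; apply/orP; left; apply/eqP.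
by congr (_ ^+ 2); ring.
Qed.

End spline.

(** * Assembling the squares into one grid function *)

Section grid.
Context {R : realType}.
Local Notation mu := (@lebesgue_measure R).
Local Notation P2 := (R^o * R^o)%type.
Variables (h : R) (h0 : 0 < h) (K : nat) (V : int -> int -> nat -> nat -> R).
Let N : int := K.+1%:Z.
Let d : R := K.+1%:R * h.
Hypothesis VR : forall j k l, (l <= K.+1)%N -> V j k K.+1 l = V (j + 1) k 0 l.
Hypothesis VT : forall j k i, (i <= K.+1)%N -> V j k i K.+1 = V j (k + 1) i 0.

(* V j k i l is the value at the node (i, l) of the square (j, k), so the grid node
   (p, q) is shared by up to four squares. *)
Definition grid (p q : int) : R :=
  V (p %/ N)%Z (q %/ N)%Z `|(p %% N)%Z|%N `|(q %% N)%Z|%N.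

Let grid_small j k (i l : nat) : (i < K.+1)%N -> (l < K.+1)%N ->
  grid (j * N + i%:Z) (k * N + l%:Z) = V j k i l.
Proof.
move=> iN lN; rewrite /grid !divzMDl// !modzMDl !divz_nat !modz_nat !divn_small// !modn_small//.
by rewrite !addr0.
Qed.

(** Division by [N] assigns a node with [i = K + 1] or [l = K + 1] to the next square; the
    compatibility hypotheses [VR] and [VT] bring it back. *)
Lemma gridE j k (i l : nat) : (i <= K.+1)%N -> (l <= K.+1)%N ->
  grid (j * N + i%:Z) (k * N + l%:Z) = V j k i l.
Proof.
have step m : m * N + K.+1%:Z = (m + 1) * N + 0%:Z by rewrite mulrDl mul1r addr0.
rewrite leq_eqVlt => /predU1P[->|iN]; rewrite leq_eqVlt => /predU1P[->|lN].
- by rewrite !step grid_small// VR// VT.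
- by rewrite step grid_small// VR// ltnW.
- by rewrite step grid_small// VT// ltnW.
- exact: grid_small.
Qed.

Definition grid_fun : P2 -> R^o := spline2 h grid (node_bump h) (node_bump h).

Lemma C1_grid_fun : C1 grid_fun.
Proof. exact: C1_grad_C1 (C1_grad_spline h0 grid). Qed.

Let d0 : 0 < d. Proof. by rewrite mulr_gt0. Qed.

Let floor_cell (j : int) (t : R) : 0 <= t < d ->
  exists i : nat, [/\ (i < K.+1)%N, i%:R * h <= t < i.+1%:R * h &
    Num.floor ((j%:~R * d + t) / h) = j * N + i%:Z].
Proof.
move=> /andP[t0 td]; have th0 : 0 <= t / h by rewrite divr_ge0// ltW.
exists (Num.truncn (t / h)); have /andP[t1 t2] := truncn_itv th0; split.
- rewrite -(ltr_nat R) (le_lt_trans t1)// ltr_pdivrMr//.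
- by rewrite -ler_pdivlMr// t1 -ltr_pdivrMr.
- have -> : (j%:~R * d + t) / h = (j * N)%:~R + t / h.
    by rewrite intrM /d; field; rewrite gt_eqF.
  rewrite floorDzr ?intr_int// intrKfloor; congr (_ + _).
  by apply: floor_def; rewrite t1/= (_ : (_ + 1)%:~R = (Num.truncn (t / h)).+1%:R :> R)// -natr1 intrD.
Qed.

Lemma grid_fun_hedge j k (t c : R) : 0 <= t < d -> exists i : nat,
  [/\ (i < K.+1)%N, i%:R * h <= t <= i.+1%:R * h &
    (grid_fun (hpt d j k t) - c) ^+ 2 <= (V j k i 0 - c) ^+ 2 + (V j k i.+1 0 - c) ^+ 2].
Proof.
move=> td; have [i [iN /andP[t1 t2] fE]] := floor_cell j td; exists i; split => //.
  by rewrite t1 ltW.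
have := spline_hline h0 grid (j%:~R * d + t) c (k * N).
rewrite fE -addrA -[_ + 1](_ : i.+1%:Z = _); last by rewrite -addn1 PoszD.
rewrite -(addr0 (k * N)) (gridE j k (l := 0))// ?(gridE j k (l := 0))//; last exact: ltnW.
have -> : (k * N + 0)%:~R * h = k%:~R * d by rewrite addr0 intrM -mulrA.
by [].
Qed.

Lemma grid_fun_vedge j k (t c : R) : 0 <= t < d -> exists i : nat,
  [/\ (i < K.+1)%N, i%:R * h <= t <= i.+1%:R * h &
    (grid_fun (vpt d j k t) - c) ^+ 2 <= (V j k 0 i - c) ^+ 2 + (V j k 0 i.+1 - c) ^+ 2].
Proof.
move=> td; have [i [iN /andP[t1 t2] fE]] := floor_cell k td; exists i; split => //.
  by rewrite t1 ltW.
have := spline_vline h0 grid (k%:~R * d + t) c (j * N).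
rewrite fE -addrA -[_ + 1](_ : i.+1%:Z = _); last by rewrite -addn1 PoszD.
rewrite -(addr0 (j * N)) (gridE j k (i := 0))// ?(gridE j k (i := 0))//; last exact: ltnW.
have -> : (j * N + 0)%:~R * h = j%:~R * d by rewrite addr0 intrM -mulrA.
by [].
Qed.

Lemma leb2_square (e : R) (jk : int * int) : 0 < e -> @leb2 R (square e jk) = (e ^+ 2)%:E.
Proof.
move=> e0; rewrite /leb2 /leb1 product_measure1E//=.
rewrite !lebesgue_measure_itv/= !lte_fin.
have lt (j : int) : j%:~R * e < (j + 1)%:~R * e by rewrite ltr_pM2r// ltr_int ltrDl.
by rewrite !lt -!EFinD -EFinM !intrD; congr EFin; ring.
Qed.

(** A cell has area [h ^ 2], which cancels the [h ^ 2] of the energy bound. Its four sides give four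
    sums of squared differences, each at most [E], hence [9 / 4 * 4 E]. *)
Lemma grid_fun_energy j k (E : R) :
  \sum_(i < K.+1) \sum_(l < K.+2) (V j k i.+1 l - V j k i l) ^+ 2 <= E ->
  \sum_(i < K.+2) \sum_(l < K.+1) (V j k i l.+1 - V j k i l) ^+ 2 <= E ->
  (\int[@leb2 R]_(z in square d (j, k)) energy_density grid_fun z <= (9 * E)%:E)%E.
Proof.
move=> HE VE; have [du e1 e2 _ _] := C1_grad_spline h0 grid.
pose Q (p : 'I_K.+1 * 'I_K.+1) := square h (j * N + p.1%:Z, k * N + p.2%:Z).
pose c (p : 'I_K.+1 * 'I_K.+1) := 9 / 4 / h ^+ 2 * cell_energy grid (j * N + p.1%:Z) (k * N + p.2%:Z).
have ce0 m n : 0 <= cell_energy grid m n by rewrite /cell_energy !addr_ge0 ?sqr_ge0.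
have c0 p : 0 <= c p by rewrite mulr_ge0// divr_ge0 ?sqr_ge0.
have mQ p : measurable (Q p) by exact: measurable_square.
have m1Q p : measurable_fun [set: R * R] (fun z => (\1_(Q p) z)%:E).
  by apply/measurable_EFinP; exact: measurable_indic.
have mcQ p : measurable_fun [set: R * R] (fun z => (c p * \1_(Q p) z)%:E).
  by apply/measurable_EFinP; apply: measurable_funM => //; exact: measurable_indic.
apply: (@le_trans _ _ (\int[@leb2 R]_z \sum_(p : 'I_K.+1 * 'I_K.+1) (c p * \1_(Q p) z)%:E)%E).
  rewrite integral_mkcond; apply: ge0_le_integral => //.
  - by move=> z _; rewrite patchE; case: ifP => // _; exact: energy_density_ge0.
  - apply/(measurable_restrictT _ (measurable_square d (j, k))).
    exact: (measurable_funTS (measurable_energy_density C1_grid_fun)).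
  - by apply: emeasurable_sum => p _; exact: mcQ.
  - move=> z _; rewrite patchE; case: ifPn => [|_]; last first.
      by apply: sume_ge0 => p _; rewrite lee_fin mulr_ge0.
    rewrite inE => -[/=]; rewrite !in_itv/= => /andP[z1 z2] /andP[z3 z4].
    have t1 : 0 <= z.1 - j%:~R * d < d.
      by move: z2; rewrite intrD mulrDl mul1r subr_ge0 ltrBlDl => ->; rewrite z1.
    have t2 : 0 <= z.2 - k%:~R * d < d.
      by move: z4; rewrite intrD mulrDl mul1r subr_ge0 ltrBlDl => ->; rewrite z3.
    have [i [iN _]] := floor_cell j t1; rewrite subrKC => fi.
    have [l [lN _]] := floor_cell k t2; rewrite subrKC => fl.
    pose p : 'I_K.+1 * 'I_K.+1 := (Ordinal iN, Ordinal lN).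
    rewrite (bigD1 p)//= -[leLHS]adde0; apply: leeD; last first.
      by apply: sume_ge0 => q _; rewrite lee_fin mulr_ge0.
    have zQ : Q p z by split; rewrite /= itv_floor//= ?fi ?fl.
    rewrite lee_fin indicE mem_set// mulr1.
    have := @spline_cell_energy R h grid z; rewrite fi fl.
    by rewrite /energy_density e1 e2.
rewrite ge0_integral_sum//; last by move=> p z _; rewrite lee_fin mulr_ge0.
rewrite (eq_bigr (fun p => (c p * h ^+ 2)%:E)); last first.
  move=> p _; under eq_integral do rewrite EFinM.
  rewrite ge0_integralZl_EFin//; last first.
    exact: m1Q.
  have -> : (\int[@leb2 R]_z (\1_(Q p) z)%:E = @leb2 R (Q p))%E.
    have := integral_indic (@lebesgue_measure R \x @lebesgue_measure R)%E measurableT (mQ p).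
    by rewrite setIT.
  by rewrite leb2_square// -EFinM.
rewrite sumEFin lee_fin.
rewrite (eq_bigr (fun p : 'I_K.+1 * 'I_K.+1 => 9 / 4 * cell_energy grid (j * N + p.1%:Z) (k * N + p.2%:Z))); last first.
  by move=> p _; rewrite /c; field; rewrite gt_eqF.
rewrite -mulr_sumr.
pose X i l := (V j k i.+1 l - V j k i l) ^+ 2; pose Y i l := (V j k i l.+1 - V j k i l) ^+ 2.
have cellE (p : 'I_K.+1 * 'I_K.+1) : cell_energy grid (j * N + p.1%:Z) (k * N + p.2%:Z) =
    X p.1 p.2 + X p.1 p.2.+1 + (Y p.1 p.2 + Y p.1.+1 p.2).
  have s1 m (i : nat) : m * N + i%:Z + 1 = m * N + i.+1%:Z by rewrite -addn1 PoszD addrA.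
  have h1 := ltn_ord p.1; have h2 := ltn_ord p.2.
  by rewrite /cell_energy !s1 !gridE// ltnW.
rewrite (eq_bigr _ (fun p _ => cellE p)) !big_split/=.
have pb (F : nat -> nat -> R) :
    \sum_(p : 'I_K.+1 * 'I_K.+1) F p.1 p.2 = \sum_(i < K.+1) \sum_(l < K.+1) F i l.
  by rewrite pair_big.
rewrite (pb X) (pb (fun i l => X i l.+1)) (pb Y) (pb (fun i l => Y i.+1 l)).
have X1 : \sum_(i < K.+1) \sum_(l < K.+1) X i l <= E.
  apply: le_trans HE; apply: ler_sum => i _; rewrite [leRHS]big_ord_recr/= lerDl; exact: sqr_ge0.
have X2 : \sum_(i < K.+1) \sum_(l < K.+1) X i l.+1 <= E.
  apply: le_trans HE; apply: ler_sum => i _; rewrite [leRHS]big_ord_recl/= -[leLHS]add0r.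
  by apply: lerD => //; exact: sqr_ge0.
have Y1 : \sum_(i < K.+1) \sum_(l < K.+1) Y i l <= E.
  apply: le_trans VE; rewrite [leRHS]big_ord_recr/= lerDl; apply: sumr_ge0 => l _; exact: sqr_ge0.
have Y2 : \sum_(i < K.+1) \sum_(l < K.+1) Y i.+1 l <= E.
  apply: le_trans VE; rewrite [leRHS]big_ord_recl/= -[leLHS]add0r.
  by apply: lerD => //; apply: sumr_ge0 => l _; exact: sqr_ge0.
by lra.
Qed.

End grid.

(** * Distance from the interpolation to the trace along an edge *)

Section edge_error.
Context {R : realType}.
Local Notation mu := (@lebesgue_measure R).
Variables (h : R) (h0 : 0 < h) (K : nat) (K0 : (0 < K)%N) (d : R) (dE : d = K.+1%:R * h).
Variables (a u : R -> R) (x : nat -> R) (X : R).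
Hypotheses (ma : measurable_fun [set: R] a) (ia : mu.-integrable `[0, d] (EFin \o a))
  (muu : measurable_fun [set: R] u) (xE : forall i, (i < K)%N -> x i.+1 = avg h a i)
  (x0X : (x 0%N - x 1%N) ^+ 2 <= X) (xNX : (x K.+1 - x K) ^+ 2 <= X)
  (aX : (\int[mu]_(y in `[0%R, d]) gagliardo d a y <= X%:E)%E).
Hypothesis ux : forall t, 0 <= t < d -> exists i : nat,
  [/\ (i < K.+1)%N, i%:R * h <= t <= i.+1%:R * h &
    (u t - a t) ^+ 2 <= (x i - a t) ^+ 2 + (x i.+1 - a t) ^+ 2].

Let X0 : 0 <= X. Proof. exact: le_trans (sqr_ge0 _) x0X. Qed.

Let sqr_sub_le (p q r : R) : (p - r) ^+ 2 <= 2 * (p - q) ^+ 2 + 2 * (q - r) ^+ 2.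
Proof. by rewrite -subr_ge0 (_ : _ - _ = (p - q - (q - r)) ^+ 2) ?sqr_ge0//; ring. Qed.

Let node_near i t : (i < K)%N -> i%:R * h <= t <= i.+2%:R * h ->
  (((x i.+1 - a t) ^+ 2)%:E <= (4 * h)%:E * gagliardo d a t)%E.
Proof. by move=> iK ht; rewrite xE//; exact: (avg_near h0 dE ma ia). Qed.

Let G t := ((4 * h)%:E * gagliardo d a t)%E.

Let G0 t : (0 <= G t)%E.
Proof. by rewrite mule_ge0 ?lee_fin ?mulr_ge0 ?(ltW h0)//; exact: gagliardo_ge0. Qed.

Let I0 : set R := `[0, h].

Let I1 : set R := `[K%:R * h, K.+1%:R * h].

(** Interior nodes carry averages of [a], close to [a t] by [avg_near]. The two end nodes carry
    values chosen at the vertices and are compared with their neighbours at cost [2 X], on one cell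
    each. The integral is [16 h X + 2 h X + 2 h X]. *)
Let bound t := ((16 * h)%:E * gagliardo d a t + ((2 * X) * \1_I0 t)%:E + ((2 * X) * \1_I1 t)%:E)%E.

Let node_far (p q r : R) (g : \bar R) : (0 <= g)%E -> (p - q) ^+ 2 <= X ->
  (((q - r) ^+ 2)%:E <= g)%E -> (((p - r) ^+ 2)%:E <= 2%:E * g + (2 * X)%:E)%E.
Proof.
move=> g0 pq qr; apply: (@le_trans _ _ (2%:E * ((q - r) ^+ 2)%:E + (2 * X)%:E)%E).
  rewrite -EFinM -EFinD lee_fin (le_trans (sqr_sub_le p q r))// addrC lerD2l ler_pM2l//.
by rewrite leeD2r// lee_wpmul2l.
Qed.

Let pointwise t : 0 <= t < d -> (((u t - a t) ^+ 2)%:E <= bound t)%E.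
Proof.
move=> td; have [i [iN /andP[t1 t2] H]] := ux td.
have left : (((x i - a t) ^+ 2)%:E <= 2%:E * G t + ((2 * X) * \1_I0 t)%:E)%E.
  case: i iN t1 t2 {H} => [|i] iN t1 t2.
    rewrite indicE mem_set ?mulr1; last by move: t1 t2; rewrite /I0/= in_itv/= mul0r mul1r => -> ->.
    apply: (node_far (q := x 1%N)) => //; apply: node_near => //; rewrite t1 (le_trans t2)//.
    by rewrite ler_wpM2r ?ler_nat// ltW.
  apply: (@le_trans _ _ (G t)).
    by apply: node_near => //; rewrite t2 andbT (le_trans _ t1)// ler_wpM2r ?ler_nat// ltW.
  rewrite -[leLHS]adde0; apply: leeD; last by rewrite lee_fin !mulr_ge0.
  by rewrite mule_natl mule2n leeDl.
have right : (((x i.+1 - a t) ^+ 2)%:E <= 2%:E * G t + ((2 * X) * \1_I1 t)%:E)%E.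
  move: iN; rewrite ltnS leq_eqVlt => /predU1P[iK|iK].
    rewrite indicE mem_set ?mulr1; last by rewrite /I1/= in_itv/= -iK t1.
    rewrite iK; apply: (node_far (q := x K)) => //.
    have Kp : (K.-1 < K)%N by rewrite prednK.
    have := @node_near K.-1 t Kp; rewrite prednK//; apply.
    by move: t1 t2; rewrite iK => t1 ->; rewrite andbT (le_trans _ t1)// ler_wpM2r ?(ltW h0)// ler_nat leq_pred.
  apply: (@le_trans _ _ (G t)).
    by apply: node_near => //; rewrite t1 (le_trans t2)// ler_wpM2r ?ler_nat// ltW.
  rewrite -[leLHS]adde0; apply: leeD; last by rewrite lee_fin !mulr_ge0.
  by rewrite mule_natl mule2n leeDl.
apply: (@le_trans _ _ (((x i - a t) ^+ 2)%:E + ((x i.+1 - a t) ^+ 2)%:E)%E).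
  by rewrite -EFinD lee_fin.
apply: (le_trans (leeD left right)); rewrite /bound.
rewrite addeACA addeA.
rewrite (_ : (2%:E * G t + 2%:E * G t = (16 * h)%:E * gagliardo d a t)%E)//.
rewrite -ge0_muleDl// /G muleA -EFinD -EFinM; congr ((_)%:E * _)%E; ring.
Qed.

Lemma edge_error : (\int[mu]_(t in `[0%R, d]) ((u t - a t) ^+ 2)%:E <= (20 * (h * X))%:E)%E.
Proof.
have mI : measurable (`[0, d[ : set R) by exact: measurable_itv.
have d0 : 0 <= d by rewrite dE mulr_ge0// ltW.
have msq : measurable_fun [set: R] (fun t => ((u t - a t) ^+ 2)%:E).
  by apply/measurable_EFinP; apply: measurable_funX; exact: measurable_funB.
have mG : measurable_fun [set: R] (gagliardo d a) by exact: measurable_gagliardo.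
have mind (A : set R) : measurable A -> measurable_fun [set: R] (fun t => ((2 * X) * \1_A t)%:E).
  by move=> mA; apply/measurable_EFinP; apply: measurable_funM => //; exact: measurable_indic.
have X2 : 0 <= 2 * X by rewrite mulr_ge0.
have mI0 : measurable I0 by exact: measurable_itv.
have mI1 : measurable I1 by exact: measurable_itv.
have h16 : 0 <= 16 * h by rewrite mulr_ge0// ltW.
have g1 t : (0 <= (16 * h)%:E * gagliardo d a t)%E by rewrite mule_ge0//; exact: gagliardo_ge0.
have g2 A t : (0 <= ((2 * X) * \1_A t)%:E)%E by rewrite lee_fin mulr_ge0.
have mg1 : measurable_fun [set: R] (fun t => (16 * h)%:E * gagliardo d a t)%E by exact: measurable_funeM.
have indic_le (A : set R) : measurable A -> (mu A <= h%:E)%E ->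
    (\int[mu]_(t in `[0%R, d[) ((2 * X) * \1_A t)%:E <= (2 * X * h)%:E)%E.
  move=> mA Ah; under eq_integral do rewrite EFinM.
  rewrite ge0_integralZl_EFin//; last first.
    by apply/measurable_EFinP; exact: (measurable_funTS (measurable_indic mA)).
  rewrite integral_indic// [leRHS]EFinM lee_wpmul2l//; apply: le_trans Ah.
  by apply: le_measure; rewrite ?inE//; exact: measurableI.
rewrite -integral_itv_bndo_bndc; last exact: (measurable_funTS msq).
apply: (@le_trans _ _ (\int[mu]_(t in `[0%R, d[) bound t)%E).
  apply: ge0_le_integral => //.
  - by move=> t _; rewrite lee_fin sqr_ge0.
  - exact: (measurable_funTS msq).
  - exact: (measurable_funTS (emeasurable_funD (emeasurable_funD mg1 (mind _ mI0)) (mind _ mI1))).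
rewrite /bound ge0_integralD//; last 3 first.
- by move=> t _; rewrite adde_ge0.
- exact: (measurable_funTS (emeasurable_funD mg1 (mind _ mI0))).
- exact: (measurable_funTS (mind _ mI1)).
rewrite ge0_integralD//; last 2 first.
- exact: (measurable_funTS mg1).
- exact: (measurable_funTS (mind _ mI0)).
have -> : 20 * (h * X) = 16 * h * X + 2 * X * h + 2 * X * h by ring.
rewrite !EFinD; apply: leeD; first apply: leeD.
- rewrite ge0_integralZl_EFin//; last 2 first.
  + by move=> t _; exact: gagliardo_ge0.
  + exact: (measurable_funTS mG).
  rewrite [leRHS]EFinM lee_wpmul2l// integral_itv_bndo_bndc//; exact: (measurable_funTS mG).
- by apply: indic_le => //; rewrite lebesgue_measure_itv/= lte_fin h0 oppr0 adde0.
- apply: indic_le => //; rewrite lebesgue_measure_itv/= lte_fin ltr_pM2r// ltr_nat ltnSn.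
  by rewrite -EFinD lee_fin -mulrBl -natr1 addrC addKr mul1r.
Qed.

End edge_error.

(** * Approximate extensions *)

Section extension.
Context {R : realType}.
Local Notation mu := (@lebesgue_measure R).
Local Notation P2 := (R^o * R^o)%type.

Lemma esum_scale_le (T : choiceType) (c : R) (a : T -> \bar R) : 0 <= c ->
  (forall i, 0 <= a i)%E ->
  (\esum_(i in [set: T]) (c%:E * a i) <= c%:E * \esum_(i in [set: T]) a i)%E.
Proof.
move=> c0 a0; apply: ge_ereal_sup => _ [A [fA _] <-].
rewrite -ge0_mule_fsumr//; apply: lee_wpmul2l => //.
by apply: ereal_sup_ubound; exists A.
Qed.

(** On a set of finite measure, [|g| <= 1 + g ^ 2] suffices. *)
Lemma sqr_integrable dT (T : measurableType dT) (m : {measure set T -> \bar R})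
    (D : set T) (g : T -> R) : measurable D -> (m D < +oo)%E ->
  measurable_fun D g -> (\int[m]_(t in D) ((g t) ^+ 2)%:E < +oo)%E ->
  m.-integrable D (EFin \o g).
Proof.
move=> mD Doo mg goo.
have mg2 : measurable_fun D (fun t => ((g t) ^+ 2)%:E) by exact/measurable_EFinP/measurable_funX.
apply/integrableP; split; first exact/measurable_EFinP.
apply: (@le_lt_trans _ _ (\int[m]_(t in D) (1%:E + ((g t) ^+ 2)%:E))%E).
  apply: ge0_le_integral => //.
  - by apply: measurableT_comp => //; exact/measurable_EFinP.
  - by apply: emeasurable_funD => //; exact: measurable_cst.
  - move=> t _ /=; rewrite lee_fin -[in leRHS]real_normK ?num_real//.
    set x := `|g t|; have : 0 <= (x - 1 / 2) ^+ 2 by exact: sqr_ge0.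
    by rewrite -subr_ge0 => h; rewrite (_ : _ - _ = (x - 1 / 2) ^+ 2 + 3 / 4);
      [rewrite addr_ge0 ?sqr_ge0//|field].
rewrite ge0_integralD//; last by move=> t _; rewrite lee_fin sqr_ge0.
by rewrite integral_cst// mul1e; exact: lte_add_pinfty.
Qed.

Lemma sum5_ge (a1 a2 a3 a4 a5 : \bar R) :
  (0 <= a1)%E -> (0 <= a2)%E -> (0 <= a3)%E -> (0 <= a4)%E -> (0 <= a5)%E ->
  let b := (a1 + a2 + a3 + a4 + a5)%E in
  [/\ (0 <= b)%E, (a1 <= b)%E, (a2 <= b)%E & [/\ (a3 <= b)%E, (a4 <= b)%E & (a5 <= b)%E]].
Proof.
move=> h1 h2 h3 h4 h5 b.
have b2 : (0 <= a1 + a2)%E by exact: adde_ge0.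
have b3 : (0 <= a1 + a2 + a3)%E by exact: adde_ge0.
have b4 : (0 <= a1 + a2 + a3 + a4)%E by exact: adde_ge0.
have e1 : (a1 + a2 <= a1 + a2 + a3)%E by exact: leeDl.
have e2 : (a1 + a2 + a3 <= a1 + a2 + a3 + a4)%E by exact: leeDl.
have e3 : (a1 + a2 + a3 + a4 <= b)%E by exact: leeDl.
split; [exact: adde_ge0| | |split; last exact: leeDr].
- by apply: le_trans (le_trans e2 e3); apply: le_trans e1; exact: leeDl.
- by apply: le_trans (le_trans e2 e3); apply: le_trans e1; exact: leeDr.
- by apply: le_trans (le_trans e2 e3); exact: leeDr.
- by apply: le_trans e3; exact: leeDr.
Qed.

Variables (d : R) (d0 : 0 < d) (f : P2 -> R) (fL : gp_L2loc d f).

Local Notation I := `[0%R, d]%classic.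

Let mI : measurable (I : set R). Proof. exact: measurable_itv. Qed.

(** Extended by zero, because the results on averages ask for measurability on the whole line. *)
Let eh j k : R -> R := (fun t => f (hpt d j k t)) \_ I.

Let ev j k : R -> R := (fun t => f (vpt d j k t)) \_ I.

Let ehE j k t : 0 <= t <= d -> eh j k t = f (hpt d j k t).
Proof. by move=> td; rewrite /eh patchE mem_set//= in_itv. Qed.

Let evE j k t : 0 <= t <= d -> ev j k t = f (vpt d j k t).
Proof. by move=> td; rewrite /ev patchE mem_set//= in_itv. Qed.

Let meh j k : measurable_fun [set: R] (eh j k).
Proof. by have [mf _ _ _] := fL j k; apply/(measurable_restrictT _ mI). Qed.

Let mev j k : measurable_fun [set: R] (ev j k).
Proof. by have [_ mf _ _] := fL j k; apply/(measurable_restrictT _ mI). Qed.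

Let muI : (mu I < +oo)%E.
Proof. by rewrite lebesgue_measure_itv/= lte_fin d0 -EFinD ltey. Qed.

Let ieh j k : mu.-integrable I (EFin \o eh j k).
Proof.
apply: (@sqr_integrable _ _ mu I (eh j k) mI muI (measurable_funTS (meh j k))).
have [_ _ f2 _] := fL j k; apply: le_lt_trans f2.
rewrite le_eqVlt; apply/orP; left; apply/eqP; apply: eq_integral => t; rewrite inE/= in_itv/= => td.
by rewrite ehE.
Qed.

Let iev j k : mu.-integrable I (EFin \o ev j k).
Proof.
apply: (@sqr_integrable _ _ mu I (ev j k) mI muI (measurable_funTS (mev j k))).
have [_ _ _ f2] := fL j k; apply: le_lt_trans f2.
rewrite le_eqVlt; apply/orP; left; apply/eqP; apply: eq_integral => t; rewrite inE/= in_itv/= => td.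
by rewrite evE.
Qed.

(** [T1] to [T5] are the five contributions of the index [(j, k)] to the norm; [T3] is already split
    into its two right angles. *)
Let T1 j k := (\int[mu]_(y in I) gagliardo d (eh j k) y)%E.
Let T2 j k := (\int[mu]_(y in I) gagliardo d (ev j k) y)%E.
Let T3 j k := (corner d f false false j k + corner d f true true j k)%E.
Let T4 j k := (\int[@leb1 R]_(x in I) ((f (hpt d j k x) - f (hpt d j k (- x)%R)) ^+ 2 / x)%:E)%E.
Let T5 j k := (\int[@leb1 R]_(x in I) ((f (vpt d j k x) - f (vpt d j k (- x)%R)) ^+ 2 / x)%:E)%E.

Let quot_ge0 (g1 g2 : R -> R) :
  (0 <= \int[mu]_(x in I) ((g1 x - g2 x) ^+ 2 / x)%:E)%E.
Proof.
apply: integral_ge0 => x; rewrite /= in_itv/= => /andP[x0 _].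
by rewrite lee_fin divr_ge0// sqr_ge0.
Qed.

Let T1_ge0 j k : (0 <= T1 j k)%E.
Proof. by apply: integral_ge0 => y _; exact: gagliardo_ge0. Qed.

Let T2_ge0 j k : (0 <= T2 j k)%E.
Proof. by apply: integral_ge0 => y _; exact: gagliardo_ge0. Qed.

Let cff_ge0 j k : (0 <= corner d f false false j k)%E. Proof. exact: quot_ge0. Qed.

Let ctt_ge0 j k : (0 <= corner d f true true j k)%E. Proof. exact: quot_ge0. Qed.

Let T3_ge0 j k : (0 <= T3 j k)%E. Proof. exact: (adde_ge0 (cff_ge0 j k) (ctt_ge0 j k)). Qed.

Let T4_ge0 j k : (0 <= T4 j k)%E. Proof. exact: quot_ge0. Qed.

Let T5_ge0 j k : (0 <= T5 j k)%E. Proof. exact: quot_ge0. Qed.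

Let S (jk : int * int) := (T1 jk.1 jk.2 + T2 jk.1 jk.2 + T3 jk.1 jk.2 + T4 jk.1 jk.2 + T5 jk.1 jk.2)%E.

Let S_ge jk := sum5_ge (T1_ge0 jk.1 jk.2) (T2_ge0 jk.1 jk.2) (T3_ge0 jk.1 jk.2)
  (T4_ge0 jk.1 jk.2) (T5_ge0 jk.1 jk.2).

Let S_ge0 jk : (0 <= S jk)%E. Proof. by have [le _ _ _] := S_ge jk; exact: le. Qed.

Let esum_S : (\esum_(jk in [set: int * int]) S jk)%E = gp_norm2 d f.
Proof.
have A2 jk := adde_ge0 (T1_ge0 jk.1 jk.2) (T2_ge0 jk.1 jk.2).
have A3 jk := adde_ge0 (A2 jk) (T3_ge0 jk.1 jk.2).
have A4 jk := adde_ge0 (A3 jk) (T4_ge0 jk.1 jk.2).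
rewrite /S (esumD (fun jk _ => A4 jk) (fun jk _ => T5_ge0 jk.1 jk.2)).
rewrite (esumD (fun jk _ => A3 jk) (fun jk _ => T4_ge0 jk.1 jk.2)).
rewrite (esumD (fun jk _ => A2 jk) (fun jk _ => T3_ge0 jk.1 jk.2)).
rewrite (esumD (fun jk _ => T1_ge0 jk.1 jk.2) (fun jk _ => T2_ge0 jk.1 jk.2)).
have E1 : (\esum_(jk in [set: int * int]) T1 jk.1 jk.2 = \esum_(jk in [set: int * int])
     \int[@leb1 R]_(y in `[0%R, d]) \int[@leb1 R]_(x in `[0%R, d])
        ((f (hpt d jk.1 jk.2 x) - f (hpt d jk.1 jk.2 y)) ^+ 2 / (x - y) ^+ 2)%:E)%E.
  apply: eq_esum => jk _; apply: eq_integral => y; rewrite inE/= in_itv/= => yd.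
  by apply: eq_integral => x; rewrite inE/= in_itv/= => xd; rewrite !ehE.
have E2 : (\esum_(jk in [set: int * int]) T2 jk.1 jk.2 = \esum_(jk in [set: int * int])
     \int[@leb1 R]_(y in `[0%R, d]) \int[@leb1 R]_(x in `[0%R, d])
        ((f (vpt d jk.1 jk.2 x) - f (vpt d jk.1 jk.2 y)) ^+ 2 / (x - y) ^+ 2)%:E)%E.
  apply: eq_esum => jk _; apply: eq_integral => y; rewrite inE/= in_itv/= => yd.
  by apply: eq_integral => x; rewrite inE/= in_itv/= => xd; rewrite !evE.
have E3 : (\esum_(jk in [set: int * int]) T3 jk.1 jk.2 = \esum_(jk in [set: int * int])
     \int[@leb1 R]_(x in `[(- d)%R, d])
        ((f (hpt d jk.1 jk.2 x) - f (vpt d jk.1 jk.2 x)) ^+ 2 / `|x|)%:E)%E.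
  by apply: eq_esum => jk _; rewrite /T3 -(corner_sum d0).
by exact: (f_equal2 adde (f_equal2 adde (f_equal2 adde (f_equal2 adde E1 E2) E3) erefl) erefl).
Qed.

Hypothesis norm_fin : (gp_norm2 d f < +oo)%E.

Let S_fin jk : (S jk < +oo)%E.
Proof.
apply: le_lt_trans norm_fin; rewrite -esum_S.
apply: esum_ge; exists [set jk]; first by split; [exact: finite_set1|].
by rewrite fsbig_set1.
Qed.

Let s jk : R := fine (S jk).

Let sE jk : (s jk)%:E = S jk.
Proof. by rewrite fineK// ge0_fin_numE ?S_fin ?S_ge0. Qed.

Let s_ge0 jk : 0 <= s jk. Proof. exact: fine_ge0. Qed.

Let S1 jk : (T1 jk.1 jk.2 <= (s jk)%:E)%E.
Proof. by rewrite sE; have [_ le _ _] := S_ge jk; exact: le. Qed.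

Let S2 jk : (T2 jk.1 jk.2 <= (s jk)%:E)%E.
Proof. by rewrite sE; have [_ _ le _] := S_ge jk; exact: le. Qed.

Let S3 jk : (T3 jk.1 jk.2 <= (s jk)%:E)%E.
Proof. by rewrite sE; have [_ _ _ [le _ _]] := S_ge jk; exact: le. Qed.

Let S4 jk : (T4 jk.1 jk.2 <= (s jk)%:E)%E.
Proof. by rewrite sE; have [_ _ _ [_ le _]] := S_ge jk; exact: le. Qed.

Let S5 jk : (T5 jk.1 jk.2 <= (s jk)%:E)%E.
Proof. by rewrite sE; have [_ _ _ [_ _ le]] := S_ge jk; exact: le. Qed.

Section mesh.
Variables (K : nat) (K0 : (0 < K)%N).

Let h : R := d / K.+1%:R.

Let h0 : 0 < h. Proof. by rewrite divr_gt0. Qed.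

Let dE : d = K.+1%:R * h. Proof. by rewrite /h mulrC divfK// pnatr_eq0. Qed.

(** Averages on the right, upper, left and lower arms of a node, all numbered outwards from it. *)
Let aR jk := avg h (eh jk.1 jk.2).
Let aU jk := avg h (ev jk.1 jk.2).
Let aL (jk : int * int) (q : nat) : R := avg h (eh (jk.1 - 1) jk.2) (K - q.+1).
Let aD (jk : int * int) (q : nat) : R := avg h (ev jk.1 (jk.2 - 1)) (K - q.+1).

Let gap (a b : nat -> R) : R := \sum_(q < K) (a q - b q) ^+ 2 / q.+1%:R.

Let gap_tri (a b c : nat -> R) : gap a c <= 2 * gap a b + 2 * gap b c.
Proof.
rewrite !mulr_sumr -big_split/=; apply: ler_sum => q _.
rewrite !mulrA -mulrDl ler_wpM2r ?invr_ge0//.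
by rewrite -subr_ge0 (_ : _ - _ = (a q - b q - (b q - c q)) ^+ 2) ?sqr_ge0//; ring.
Qed.

Let gapC (a b : nat -> R) : gap a b = gap b a.
Proof. by apply: eq_bigr => q _; rewrite -sqrrN opprB. Qed.

(** The first term of [gap] has weight 1, so [gap] also controls the two averages nearest to the
    vertex. *)
Let gap0 (a b : nat -> R) : (a 0%N - b 0%N) ^+ 2 <= gap a b.
Proof.
rewrite /gap; case: (K) K0 => // k _; rewrite big_ord_recl/= divr1 lerDl.
by apply: sumr_ge0 => q _; rewrite divr_ge0 ?sqr_ge0.
Qed.

Let refl_arm (g : R -> R) : measurable_fun [set: R] g -> mu.-integrable I (EFin \o g) ->
  measurable_fun [set: R] (fun x => g (d - x)) /\ mu.-integrable I (EFin \o (fun x => g (d - x))).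
Proof.
move=> mg ig; have mr : measurable_fun [set: R] (fun x => g (d - x)).
  by apply: (measurableT_comp mg); exact: measurable_refl.
split; first exact: mr.
apply/integrableP; split.
  by apply/measurable_EFinP; exact: (measurable_funTS mr).
have /integrableP[_ goo] := ig; apply: le_lt_trans goo.
have mag : measurable_fun [set: R] (fun x => `|(g x)%:E|)%E.
  by apply: measurableT_comp => //; exact/measurable_EFinP.
have := @ge0_integral_refl R d I (fun x => `|(g x)%:E|)%E mI (measurable_funTS mag) (fun x _ => abse_ge0 _).
have -> : (fun x => d - x) @^-1` I = I by have := refl_itv d 0 d; rewrite subr0 subrr.
by move=> <-; exact: lexx.
Qed.

Let avg_arm (g : R -> R) q : measurable_fun [set: R] g -> (q < K)%N ->
  avg h g (K - q.+1) = avg h (fun x => g (d - x)) q.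
Proof. by move=> mg qK; rewrite (avg_refl dE)// ltn_ord. Qed.

Let gap_le (a b : nat -> R) (g1 g2 : R -> R) (T : \bar R) (c : R) :
  measurable_fun [set: R] g1 -> mu.-integrable I (EFin \o g1) ->
  measurable_fun [set: R] g2 -> mu.-integrable I (EFin \o g2) ->
  (forall q, (q < K)%N -> a q = avg h g1 q) -> (forall q, (q < K)%N -> b q = avg h g2 q) ->
  (\int[mu]_(x in I) ((g1 x - g2 x) ^+ 2 / x)%:E = T)%E -> (T <= c%:E)%E ->
  gap a b <= 2 * c.
Proof.
move=> m1 i1 m2 i2 aE bE TE Tc; rewrite -lee_fin.
apply: (@le_trans _ _ (2%:E * T)%E); last by rewrite EFinM lee_wpmul2l.
apply: le_trans (le_trans (Kc_avg h0 dE m1 i1 m2 i2) _); last by rewrite TE.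
by rewrite lee_fin; apply: ler_sum => q _; rewrite aE// bE.
Qed.

Let gapRU jk : gap (aR jk) (aU jk) <= 2 * s jk.
Proof.
apply: (gap_le (T := corner d f false false jk.1 jk.2) (meh jk.1 jk.2) (ieh _ _) (mev jk.1 jk.2) (iev _ _)).
- by move=> q qK; rewrite /aR.
- by move=> q qK; rewrite /aU.
- apply: eq_integral => x; rewrite inE/= in_itv/= => xd; by rewrite ehE// evE.
- by apply: le_trans (S3 jk); rewrite leeDl.
Qed.

Let gapLD jk : gap (aL jk) (aD jk) <= 2 * s jk.
Proof.
have [m1 i1] := refl_arm (meh (jk.1 - 1) jk.2) (ieh _ _).
have [m2 i2] := refl_arm (mev jk.1 (jk.2 - 1)) (iev _ _).
apply: (gap_le (T := corner d f true true jk.1 jk.2) m1 i1 m2 i2).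
- by move=> q qK; rewrite /aL avg_arm.
- by move=> q qK; rewrite /aD avg_arm.
- apply: eq_integral => x; rewrite inE/= in_itv/= => /andP[x0 xd].
  rewrite ehE; last by rewrite subr_ge0 xd gerBl.
  rewrite evE; last by rewrite subr_ge0 xd gerBl.
  rewrite /hpt /vpt /aff !intrD.
  by congr (((f (_, _) - f (_, _)) ^+ 2 / _)%:E); ring.
- by apply: le_trans (S3 jk); rewrite leeDr.
Qed.

Let gapRL jk : gap (aR jk) (aL jk) <= 2 * s jk.
Proof.
have [m1 i1] := refl_arm (meh (jk.1 - 1) jk.2) (ieh _ _).
apply: (gap_le (T := T4 jk.1 jk.2) (meh jk.1 jk.2) (ieh _ _) m1 i1).
- by move=> q qK; rewrite /aR.
- by move=> q qK; rewrite /aL avg_arm.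
- apply: eq_integral => x; rewrite inE/= in_itv/= => /andP[x0 xd].
  rewrite ehE ?x0// ehE; last by rewrite subr_ge0 xd gerBl.
  rewrite /hpt !intrD.
  by congr (((f (_, _) - f (_, _)) ^+ 2 / _)%:E); ring.
- exact: S4.
Qed.

Let gapUD jk : gap (aU jk) (aD jk) <= 2 * s jk.
Proof.
have [m1 i1] := refl_arm (mev jk.1 (jk.2 - 1)) (iev _ _).
apply: (gap_le (T := T5 jk.1 jk.2) (mev jk.1 jk.2) (iev _ _) m1 i1).
- by move=> q qK; rewrite /aU.
- by move=> q qK; rewrite /aD avg_arm.
- apply: eq_integral => x; rewrite inE/= in_itv/= => /andP[x0 xd].
  rewrite evE ?x0// evE; last by rewrite subr_ge0 xd gerBl.
  rewrite /vpt !intrD.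
  by congr (((f (_, _) - f (_, _)) ^+ 2 / _)%:E); ring.
- exact: S5.
Qed.

(** The norm compares directly only four of the six pairs of arms. The angles left-up and right-down
    are reached through a third arm, with constant [2 * 2 + 2 * 2]. *)
Let gapLU jk : gap (aL jk) (aU jk) <= 8 * s jk.
Proof.
have := gap_tri (aL jk) (aR jk) (aU jk); have := gapRL jk; have := gapRU jk.
by rewrite (gapC (aL jk) (aR jk)); lra.
Qed.

Let gapRD jk : gap (aR jk) (aD jk) <= 8 * s jk.
Proof.
by have := gap_tri (aR jk) (aU jk) (aD jk); have := gapUD jk; have := gapRU jk; lra.
Qed.

(** The vertex value is chosen as the first average on the right arm. The first step of a horizontal
    side is then 0, and the steps from the vertex into the other arms are bounded by [gap0]. *)
Let node jk := aR jk 0%N.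

Let hnode (j k : int) (i : nat) : R :=
  if i == 0%N then node (j, k) else if i == K.+1 then node (j + 1, k) else aR (j, k) i.-1.

Let vnode (j k : int) (i : nat) : R :=
  if i == 0%N then node (j, k) else if i == K.+1 then node (j, k + 1) else aU (j, k) i.-1.

Let hnodeS j k i : (i < K)%N -> hnode j k i.+1 = aR (j, k) i.
Proof. by move=> iK; rewrite /hnode/= eqSS ltn_eqF. Qed.

Let vnodeS j k i : (i < K)%N -> vnode j k i.+1 = aU (j, k) i.
Proof. by move=> iK; rewrite /vnode/= eqSS ltn_eqF. Qed.

Let hnodeN j k : hnode j k K.+1 = node (j + 1, k).
Proof. by rewrite /hnode/= eqxx. Qed.

Let vnodeN j k : vnode j k K.+1 = node (j, k + 1).
Proof. by rewrite /vnode/= eqxx. Qed.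

Let hnode_flip j k q : (q < K)%N -> flip K (hnode j k) q.+1 = aL (j + 1, k) q.
Proof. by move=> qK; rewrite /flip subSS -subnSK// hnodeS ?ltn_subrL// /aL /aR/= addrK. Qed.

Let vnode_flip j k q : (q < K)%N -> flip K (vnode j k) q.+1 = aD (j, k + 1) q.
Proof. by move=> qK; rewrite /flip subSS -subnSK// vnodeS ?ltn_subrL// /aD /aU/= addrK. Qed.

(** Collects the norm terms at the four vertices of the square; the factor 16 absorbs the constants
    2, 4 and 8 of the individual bounds. *)
Let X jk := 16 * (s jk + s (jk.1 + 1, jk.2) + s (jk.1, jk.2 + 1) + s (jk.1 + 1, jk.2 + 1)).

Let XB j k : 16 * s (j, k) <= X (j, k) /\ 16 * s (j + 1, k) <= X (j, k) /\
  16 * s (j, k + 1) <= X (j, k) /\ 16 * s (j + 1, k + 1) <= X (j, k).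
Proof.
rewrite /X/=; have := s_ge0 (j, k); have := s_ge0 (j + 1, k); have := s_ge0 (j, k + 1).
by have := s_ge0 (j + 1, k + 1); repeat split; lra.
Qed.

Let Hs_h j k : Hs (fun i => hnode j k i.+1) K <= 4 * s (j, k).
Proof.
rewrite -lee_fin; apply: (@le_trans _ _ (Hs (aR (j, k)) K)%:E).
  rewrite lee_fin le_eqVlt; apply/orP; left; apply/eqP; apply: eq_bigr => p _.
  by rewrite !hnodeS.
apply: (le_trans (Hs_avg h0 dE (meh j k) (ieh j k))).
by rewrite EFinM lee_wpmul2l//; exact: (S1 (j, k)).
Qed.

Let Hs_v j k : Hs (fun i => vnode j k i.+1) K <= 4 * s (j, k).
Proof.
rewrite -lee_fin; apply: (@le_trans _ _ (Hs (aU (j, k)) K)%:E).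
  rewrite lee_fin le_eqVlt; apply/orP; left; apply/eqP; apply: eq_bigr => p _.
  by rewrite !vnodeS.
apply: (le_trans (Hs_avg h0 dE (mev j k) (iev j k))).
by rewrite EFinM lee_wpmul2l//; exact: (S2 (j, k)).
Qed.

Let hnode_first j k : hnode j k 0%N - hnode j k 1%N = 0.
Proof. by rewrite hnodeS// subrr. Qed.

Let last_node : K = K.-1.+1. Proof. by rewrite prednK. Qed.

Let hnode_last j k : (hnode j k K.+1 - hnode j k K) ^+ 2 <= 2 * s (j + 1, k).
Proof.
have e : hnode j k K = aR (j, k) K.-1 by rewrite {1}last_node hnodeS// prednK.
rewrite hnodeN e; apply: le_trans (gapRL (j + 1, k)).
by apply: le_trans (gap0 _ _); rewrite /aL/= addrK subn1.
Qed.

Let vnode_first j k : (vnode j k 0%N - vnode j k 1%N) ^+ 2 <= 2 * s (j, k).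
Proof. rewrite vnodeS//; exact: le_trans (gap0 _ _) (gapRU (j, k)). Qed.

Let vnode_last j k : (vnode j k K.+1 - vnode j k K) ^+ 2 <= 8 * s (j, k + 1).
Proof.
have e : vnode j k K = aU (j, k) K.-1 by rewrite {1}last_node vnodeS// prednK.
rewrite vnodeN e; apply: le_trans (gapRD (j, k + 1)).
by apply: le_trans (gap0 _ _); rewrite /aD/= addrK subn1.
Qed.

Let Kc_gap (x y a b : nat -> R) (c : R) :
  (forall q, (q < K)%N -> x q.+1 = a q) -> (forall q, (q < K)%N -> y q.+1 = b q) ->
  gap a b <= c -> Kc x y K <= c.
Proof.
move=> xa yb; apply: le_trans; rewrite le_eqVlt; apply/orP; left; apply/eqP.
by apply: eq_bigr => q _; rewrite xa// yb.
Qed.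

Let V (j k : int) := square_ext K (K%:R^-1 * \sum_(i < K) hnode j k i.+1)
  (hnode j k) (hnode j (k + 1)) (vnode j k) (vnode (j + 1) k).

Let VR j k l : (l <= K.+1)%N -> V j k K.+1 l = V (j + 1) k 0 l.
Proof.
move=> lK; rewrite /V square_ext_right// ?square_ext_left//.
by rewrite hnodeN.
Qed.

Let VT j k i : (i <= K.+1)%N -> V j k i K.+1 = V j (k + 1) i 0.
Proof. by move=> iK; rewrite /V square_ext_top// ?square_ext_bottom. Qed.

Let VB j k i : (i <= K.+1)%N -> V j k i 0 = hnode j k i.
Proof. by move=> iK; rewrite /V square_ext_bottom. Qed.

Let VL j k i : (i <= K.+1)%N -> V j k 0 i = vnode j k i.
Proof. by move=> iK; rewrite /V square_ext_left//; rewrite vnodeN. Qed.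

Let V_energy j k :
  \sum_(i < K.+1) \sum_(l < K.+2) (V j k i.+1 l - V j k i l) ^+ 2 <= 16 * (3092 * X (j, k)) /\
  \sum_(i < K.+2) \sum_(l < K.+1) (V j k i l.+1 - V j k i l) ^+ 2 <= 16 * (3092 * X (j, k)).
Proof.
have [x1 [x2 [x3 x4]]] := XB j k.
have p1 := s_ge0 (j, k); have p2 := s_ge0 (j + 1, k).
have p3 := s_ge0 (j, k + 1); have p4 := s_ge0 (j + 1, k + 1).
have weak (t u v : R) c : 0 <= c -> c <= 16 -> u <= c * v -> 0 <= v -> 16 * v <= t -> u <= t.
  move=> c0 c16 uv v0; apply: le_trans; apply: (le_trans uv); exact: ler_wpM2r.
have n4 : (0 : R) <= 4 /\ (4 : R) <= 16 by split; [exact: ler0n|rewrite ler_nat].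
have n2 : (0 : R) <= 2 /\ (2 : R) <= 16 by split; [exact: ler0n|rewrite ler_nat].
have n8 : (0 : R) <= 8 /\ (8 : R) <= 16 by split; [exact: ler0n|rewrite ler_nat].
have c1 := weak _ _ _ _ n4.1 n4.2 (Hs_h j k) p1 x1.
have c2 := weak _ _ _ _ n4.1 n4.2 (Hs_h j (k + 1)) p3 x3.
have c3 := weak _ _ _ _ n4.1 n4.2 (Hs_v j k) p1 x1.
have c4 := weak _ _ _ _ n4.1 n4.2 (Hs_v (j + 1) k) p2 x2.
have X0 : 0 <= X (j, k) by apply: le_trans x1; rewrite mulr_ge0.
have c5 : (hnode j k 0%N - hnode j k 1%N) ^+ 2 <= X (j, k) by rewrite hnode_first expr0n.
have c6 := weak _ _ _ _ n2.1 n2.2 (hnode_last j k) p2 x2.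
have c7 : (hnode j (k + 1) 0%N - hnode j (k + 1) 1%N) ^+ 2 <= X (j, k) by rewrite hnode_first expr0n.
have c8 := weak _ _ _ _ n2.1 n2.2 (hnode_last j (k + 1)) p4 x4.
have c9 := weak _ _ _ _ n2.1 n2.2 (vnode_first j k) p1 x1.
have c10 := weak _ _ _ _ n8.1 n8.2 (vnode_last j k) p3 x3.
have c11 := weak _ _ _ _ n2.1 n2.2 (vnode_first (j + 1) k) p2 x2.
have c12 := weak _ _ _ _ n8.1 n8.2 (vnode_last (j + 1) k) p4 x4.
have c13 : Kc (hnode j k) (vnode j k) K <= X (j, k).
  apply: weak n2.1 n2.2 _ p1 x1; apply: (Kc_gap (@hnodeS j k) (@vnodeS j k)); exact: gapRU.
have c14 : Kc (flip K (hnode j k)) (vnode (j + 1) k) K <= X (j, k).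
  apply: weak n8.1 n8.2 _ p2 x2; apply: (Kc_gap (@hnode_flip j k) (@vnodeS _ _)); exact: gapLU.
have c15 : Kc (hnode j (k + 1)) (flip K (vnode j k)) K <= X (j, k).
  apply: weak n8.1 n8.2 _ p3 x3; apply: (Kc_gap (@hnodeS _ _) (@vnode_flip j k)); exact: gapRD.
have c16 : Kc (flip K (hnode j (k + 1))) (flip K (vnode (j + 1) k)) K <= X (j, k).
  apply: weak n2.1 n2.2 _ p4 x4; apply: (Kc_gap (@hnode_flip _ _) (@vnode_flip _ _)); exact: gapLD.
by split; [apply: square_ext_horizontal|apply: square_ext_vertical].
Qed.

Let u : P2 -> R^o := grid_fun h K V.

Let total : R := fine (gp_norm2 d f).

Let totalE : total%:E = gp_norm2 d f.
Proof. by rewrite fineK// ge0_fin_numE// -esum_S esum_ge0. Qed.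

Let s_total jk : s jk <= total.
Proof.
rewrite -lee_fin sE totalE -esum_S; apply: esum_ge; exists [set jk].
  by split; [exact: finite_set1|].
by rewrite fsbig_set1.
Qed.

(** 9 from [grid_fun_energy], [16 * 3092] from the extension to a square, and 16 from [X]. *)
Let cst : R := 9 * (16 * (3092 * 16)).

Let cst0 : 0 <= cst. Proof. by rewrite /cst; do !(apply: mulr_ge0; first exact: ler0n); exact: ler0n. Qed.

(** Each index is counted by the four squares that meet at its node, hence the factor 4. *)
Lemma mesh_energy :
  (\int[@leb2 R]_z energy_density u z <= (cst * (4 * total))%:E)%E.
Proof.
have C1u := C1_grid_fun h0 K V.
rewrite (integral_squares d0 (measurable_energy_density C1u) (energy_density_ge0 u)).
pose sh (a b : int) (jk : int * int) := (jk.1 + a, jk.2 + b).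
have esh a b : (\esum_(jk in [set: int * int]) S (sh a b jk) = total%:E)%E.
  rewrite totalE -esum_S [RHS](reindex_esum setT setT (sh a b))//.
  split => //; first by move=> [x y] [x' y'] _ _ [/addIr -> /addIr ->].
  by move=> [x y] _; exists (x - a, y - b) => //; rewrite /sh/= !subrK.
pose Q jk := (S (sh 0%:Z 0%:Z jk) + S (sh 1%:Z 0%:Z jk) + S (sh 0%:Z 1%:Z jk) + S (sh 1%:Z 1%:Z jk))%E.
apply: (@le_trans _ _ (\esum_(jk in [set: int * int])
   (cst%:E * Q jk))%E).
  apply: le_esum => -[j k] _; have [e1 e2] := V_energy j k.
  have := grid_fun_energy h0 VR VT e1 e2; rewrite -dE => /le_trans; apply.
  rewrite /Q /sh/= !addr0 -!sE -!EFinD -EFinM lee_fin /X/= /cst.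
  by rewrite le_eqVlt; apply/orP; left; apply/eqP; ring.
apply: (le_trans (esum_scale_le cst0 (a := Q) _)).
  move=> jk; apply: (adde_ge0 (adde_ge0 (adde_ge0 _ _) _) _); exact: S_ge0.
rewrite /Q.
have B1 jk := adde_ge0 (S_ge0 (sh 0%:Z 0%:Z jk)) (S_ge0 (sh 1%:Z 0%:Z jk)).
have B2 jk := adde_ge0 (B1 jk) (S_ge0 (sh 0%:Z 1%:Z jk)).
rewrite (esumD (fun jk _ => B2 jk) (fun jk _ => S_ge0 (sh 1%:Z 1%:Z jk))).
rewrite (esumD (fun jk _ => B1 jk) (fun jk _ => S_ge0 (sh 0%:Z 1%:Z jk))).
rewrite (esumD (fun jk _ => S_ge0 (sh 0%:Z 0%:Z jk)) (fun jk _ => S_ge0 (sh 1%:Z 0%:Z jk))).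
rewrite !esh -!EFinD -EFinM lee_fin le_eqVlt; apply/orP; left; apply/eqP.
by congr (_ * _); ring.
Qed.

Let S_le (j k : int) (t : R) (c : R) : c <= 16 -> t <= c * s (j, k) -> t <= 16 * total.
Proof.
move=> c16 /le_trans; apply; apply: (le_trans (ler_wpM2r (s_ge0 _) c16)).
by rewrite ler_pM2l.
Qed.

Lemma mesh_hedge j k :
  (\int[@leb1 R]_(t in `[0%R, d]) ((u (hpt d j k t) - f (hpt d j k t)) ^+ 2)%:E <=
   (20 * (h * (16 * total)))%:E)%E.
Proof.
have cu : continuous u.
  by move=> z; apply: differentiable_continuous; exact: (proj1 (C1_grid_fun h0 K V)).
apply: (@le_trans _ _ (\int[mu]_(t in `[0%R, d]) ((u (hpt d j k t) - eh j k t) ^+ 2)%:E)%E).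
  rewrite le_eqVlt; apply/orP; left; apply/eqP; apply: eq_integral => t.
  by rewrite inE/= in_itv/= => td; rewrite ehE.
apply: (edge_error h0 K0 dE (meh j k) (ieh j k) (x := hnode j k)).
- apply: (measurableT_comp (continuous_measurable2 cu)).
  by apply: measurable_fun_pair; [exact: measurable_shift|exact: measurable_cst].
- by move=> i iK; rewrite hnodeS.
- by rewrite hnode_first expr0n mulr_ge0//; exact: le_trans (s_total (j, k)).
- by apply: S_le (hnode_last j k); rewrite ler_nat.
- by apply: (le_trans (S1 (j, k))); rewrite lee_fin; apply: (@S_le j k _ 1); rewrite ?mul1r// ler1n.
- move=> t td; rewrite dE in td *; have [i [iN it H]] := grid_fun_hedge h0 VR VT j k (eh j k t) td.
  by exists i; split => //; move: H; rewrite !VB// ltnW.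
Qed.

Lemma mesh_vedge j k :
  (\int[@leb1 R]_(t in `[0%R, d]) ((u (vpt d j k t) - f (vpt d j k t)) ^+ 2)%:E <=
   (20 * (h * (16 * total)))%:E)%E.
Proof.
have cu : continuous u.
  by move=> z; apply: differentiable_continuous; exact: (proj1 (C1_grid_fun h0 K V)).
apply: (@le_trans _ _ (\int[mu]_(t in `[0%R, d]) ((u (vpt d j k t) - ev j k t) ^+ 2)%:E)%E).
  rewrite le_eqVlt; apply/orP; left; apply/eqP; apply: eq_integral => t.
  by rewrite inE/= in_itv/= => td; rewrite evE.
apply: (edge_error h0 K0 dE (mev j k) (iev j k) (x := vnode j k)).
- apply: (measurableT_comp (continuous_measurable2 cu)).
  by apply: measurable_fun_pair; [exact: measurable_cst|exact: measurable_shift].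
- by move=> i iK; rewrite vnodeS.
- by apply: S_le (vnode_first j k); rewrite ler_nat.
- by apply: S_le (vnode_last j k); rewrite ler_nat.
- by apply: (le_trans (S2 (j, k))); rewrite lee_fin; apply: (@S_le j k _ 1); rewrite ?mul1r// ler1n.
- move=> t td; rewrite dE in td *; have [i [iN it H]] := grid_fun_vedge h0 VR VT j k (ev j k t) td.
  by exists i; split => //; move: H; rewrite !VL// ltnW.
Qed.

Lemma mesh_extension : exists u : P2 -> R^o,
  [/\ C1 u, (\int[@leb2 R]_z energy_density u z <= (cst * (4 * total))%:E)%E & forall j k,
    (\int[@leb1 R]_(t in `[0%R, d]) ((u (hpt d j k t) - f (hpt d j k t)) ^+ 2)%:E <=
      (20 * (h * (16 * total)))%:E)%E /\
    (\int[@leb1 R]_(t in `[0%R, d]) ((u (vpt d j k t) - f (vpt d j k t)) ^+ 2)%:E <=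
      (20 * (h * (16 * total)))%:E)%E].
Proof.
exists u; split; [exact: C1_grid_fun|exact: mesh_energy|move=> j k].
by split; [exact: mesh_hedge|exact: mesh_vedge].
Qed.

End mesh.

Lemma approximate_extension : exists C : R, forall K, (0 < K)%N ->
  exists u : P2 -> R^o, [/\ C1 u, (\int[@leb2 R]_z energy_density u z <= C%:E)%E &
    forall j k,
    (\int[@leb1 R]_(t in `[0%R, d]) ((u (hpt d j k t) - f (hpt d j k t)) ^+ 2)%:E <= (C / K.+1%:R)%:E)%E /\
    (\int[@leb1 R]_(t in `[0%R, d]) ((u (vpt d j k t) - f (vpt d j k t)) ^+ 2)%:E <= (C / K.+1%:R)%:E)%E].
Proof.
pose t := fine (gp_norm2 d f).
have t0 : 0 <= t by apply: fine_ge0; rewrite -esum_S esum_ge0.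
have c0 : 0 <= 9 * (16 * (3092 * 16)) * (4 * t) :> R.
  by apply: mulr_ge0; [do !(apply: mulr_ge0; first exact: ler0n); exact: ler0n|apply: mulr_ge0].
have c1 : 0 <= 20 * (d * (16 * t)) by apply: mulr_ge0 => //; apply: mulr_ge0; [exact: ltW|exact: mulr_ge0].
exists (9 * (16 * (3092 * 16)) * (4 * t) + 20 * (d * (16 * t))) => K K0.
have [u [u1 u2 u3]] := mesh_extension K0; exists u; split => //.
  by apply: (le_trans u2); rewrite lee_fin lerDl.
have le : 20 * (d / K.+1%:R * (16 * t)) <= (9 * (16 * (3092 * 16)) * (4 * t) + 20 * (d * (16 * t))) / K.+1%:R.
  rewrite [leRHS]mulrDl (_ : 20 * (d * (16 * t)) / K.+1%:R = 20 * (d / K.+1%:R * (16 * t))); last by ring.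
  by rewrite lerDr; apply: divr_ge0.
by move=> j k; have [h1 h2] := u3 j k; split; [apply: (le_trans h1)|apply: (le_trans h2)]; rewrite lee_fin.
Qed.

End extension.

(** * Energy minimization *)

Section minimizing.
Context {R : realType}.
Local Notation mu := (@lebesgue_measure R).
Local Notation P2 := (R^o * R^o)%type.
Implicit Types u v : P2 -> R^o.

Definition energy u : \bar R := locked (\int[@leb2 R]_z energy_density u z)%E.

Lemma energyE u : energy u = (\int[@leb2 R]_z energy_density u z)%E.
Proof. by rewrite /energy -lock. Qed.

Lemma energy_ge0 u : (0 <= energy u)%E.
Proof. by rewrite energyE; apply: integral_ge0 => z _; exact: energy_density_ge0. Qed.

Definition midpoint u v : P2 -> R^o := fun z => 2^-1 * (u z + v z).

Lemma C1_grad_mid u v p q p' q' : C1_grad u p q -> C1_grad v p' q' ->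
  C1_grad (midpoint u v) (fun z => 2^-1 * (p z + p' z)) (fun z => 2^-1 * (q z + q' z)).
Proof. by move=> Hu Hv; exact: C1_gradZ (C1_gradD Hu Hv). Qed.

Lemma C1_gradB u v (p q p' q' : P2 -> R^o) : C1_grad u p q -> C1_grad v p' q' ->
  C1_grad (fun z => u z - v z) (fun z => p z - p' z) (fun z => q z - q' z).
Proof.
move=> Hu Hv; have := C1_gradD Hu (C1_gradZ (-1) Hv).
by congr C1_grad; apply/funext => z; rewrite mulN1r.
Qed.

(** The pointwise parallelogram identity, integrated; it is stated with the midpoint because the
    midpoint of two competitors is again a competitor. *)
Lemma energy_parallelogram u v : C1 u -> C1 v ->
  (energy (fun z => u z - v z)%R + 4%:E * energy (midpoint u v) =
   2%:E * energy u + 2%:E * energy v)%E.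
Proof.
move=> Cu Cv; have /C1P Hu := Cu; have /C1P Hv := Cv.
have Hm := C1_grad_mid Hu Hv; have Hb := C1_gradB Hu Hv.
have mE w : C1 w -> measurable_fun [set: R * R] (energy_density w) by exact: measurable_energy_density.
have mm := mE _ (C1_grad_C1 Hm); have mb := mE _ (C1_grad_C1 Hb).
have mu_ := mE _ Cu; have mv_ := mE _ Cv.
have e0 w (c : R) z : 0 <= c -> (0 <= c%:E * energy_density w z)%E.
  by move=> c0; rewrite mule_ge0//; exact: energy_density_ge0.
have Z (c : R) w : 0 <= c -> measurable_fun [set: R * R] (energy_density w) ->
    (c%:E * energy w = \int[@leb2 R]_z (c%:E * energy_density w z))%E.
  by move=> c0 mw; rewrite energyE ge0_integralZl_EFin// => z _; exact: energy_density_ge0.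
have mZ (c : R) w : measurable_fun [set: R * R] (energy_density w) ->
    measurable_fun [set: R * R] (fun z => c%:E * energy_density w z)%E by exact: measurable_funeM.
have L := ge0_integralD (@lebesgue_measure R \x @lebesgue_measure R)%E measurableT
  (fun z _ => energy_density_ge0 (fun z => u z - v z) z) mb
  (fun z _ => e0 (midpoint u v) 4 z (ler0n R 4)) (mZ 4 _ mm).
have L' := ge0_integralD (@lebesgue_measure R \x @lebesgue_measure R)%E measurableT
  (fun z _ => e0 u 2 z (ler0n R 2)) (mZ 2 _ mu_) (fun z _ => e0 v 2 z (ler0n R 2)) (mZ 2 _ mv_).
refine (etrans (f_equal2 adde (energyE _) (Z _ _ (ler0n R 4) mm)) (etrans (esym L) (etrans _
  (etrans L' (f_equal2 adde (esym (Z _ _ (ler0n R 2) mu_)) (esym (Z _ _ (ler0n R 2) mv_))))))).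
apply: eq_integral => z _; rewrite /energy_density.
have [_ -> -> _ _] := Hm; have [_ -> -> _ _] := Hb.
by rewrite -!EFinM -!EFinD; congr EFin; field.
Qed.

Lemma fine_energy u : (energy u < +oo)%E -> (fine (energy u))%:E = energy u.
Proof. by move=> Eu; apply: fineK; rewrite (ge0_fin_numE (energy_ge0 u)). Qed.

Let mid_finite (D m a b : \bar R) (y z : R) : (D + 4%:E * m = 2%:E * a + 2%:E * b)%E ->
  (0 <= D)%E -> (0 <= m)%E -> y%:E = a -> z%:E = b -> (m < +oo)%E.
Proof.
move=> + D0 m0 ay bz; rewrite -ay -bz -!EFinM -EFinD => e.
apply: le_lt_trans (ltry (2 * y + 2 * z)); rewrite -e.
apply: (@le_trans _ _ (4%:E * m)%E); last exact: leeDr.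
by rewrite -[leLHS]mul1e lee_wpmul2r// lee_fin ler1n.
Qed.

(** The identity leaves [2 (M + r) + 2 (M + r) - 4 (M - r) = 8 r]. *)
Let gap_bound (D m a b : \bar R) (M r x y z : R) : (D + 4%:E * m = 2%:E * a + 2%:E * b)%E ->
  m = x%:E -> a = y%:E -> b = z%:E -> M - r <= x -> y <= M + r -> z <= M + r ->
  (D <= (8 * r)%:E)%E.
Proof.
move=> + me ae be; rewrite me ae be -!EFinM -EFinD; case: D => [D| |]//=.
by rewrite -EFinD => -[e] h1 h2 h3; rewrite lee_fin; lra.
Qed.

Variables (d : R) (f : P2 -> R) (fL : gp_L2loc d f).

Definition hedge_error u (j k : int) : \bar R :=
  (\int[@leb1 R]_(t in `[0%R, d]) ((u (hpt d j k t) - f (hpt d j k t)) ^+ 2)%:E)%E.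

Definition vedge_error u (j k : int) : \bar R :=
  (\int[@leb1 R]_(t in `[0%R, d]) ((u (vpt d j k t) - f (vpt d j k t)) ^+ 2)%:E)%E.

Definition near_trace (e : R) u : Prop :=
  [/\ C1 u, (energy u < +oo)%E &
   forall j k, (hedge_error u j k <= e%:E)%E /\ (vedge_error u j k <= e%:E)%E].

Lemma C1_continuous u : C1 u -> continuous u.
Proof. by move=> [du _] z; exact: differentiable_continuous. Qed.

Lemma measurable_hpt j k : measurable_fun [set: R] (hpt d j k : R -> R * R).
Proof. by apply: measurable_fun_pair; [exact: measurable_shift|exact: measurable_cst]. Qed.

Lemma measurable_vpt j k : measurable_fun [set: R] (vpt d j k : R -> R * R).
Proof. by apply: measurable_fun_pair; [exact: measurable_cst|exact: measurable_shift]. Qed.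

Let mI : measurable (`[0, d] : set R). Proof. exact: measurable_itv. Qed.

Lemma integral_mid_le (a b c : R -> R) (e : R) : measurable_fun `[0, d] a ->
  measurable_fun `[0, d] b -> measurable_fun `[0, d] c ->
  (\int[mu]_(t in `[0%R, d]) ((a t - c t) ^+ 2)%:E <= e%:E)%E ->
  (\int[mu]_(t in `[0%R, d]) ((b t - c t) ^+ 2)%:E <= e%:E)%E ->
  (\int[mu]_(t in `[0%R, d]) ((2^-1 * (a t + b t) - c t) ^+ 2)%:E <= e%:E)%E.
Proof.
move=> ma mb mc ae be.
have msq (g : R -> R) : measurable_fun `[0, d] g ->
    measurable_fun `[0, d] (fun t => ((g t - c t) ^+ 2)%:E).
  by move=> mg; apply/measurable_EFinP; apply: measurable_funX; exact: measurable_funB.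
apply: (@le_trans _ _ (\int[mu]_(t in `[0%R, d])
   (2^-1%:E * ((a t - c t) ^+ 2)%:E + 2^-1%:E * ((b t - c t) ^+ 2)%:E))%E).
  apply: ge0_le_integral => //.
  - by move=> t _; rewrite lee_fin sqr_ge0.
  - by apply: msq; apply: measurable_funM; [exact: measurable_cst|exact: measurable_funD].
  - by apply: emeasurable_funD; apply: measurable_funeM; exact: msq.
  - move=> t _; rewrite -!EFinM -EFinD lee_fin -subr_ge0.
    rewrite (_ : _ - _ = 2^-1 ^+ 2 * (a t - b t) ^+ 2); last by field.
    by rewrite mulr_ge0 ?sqr_ge0.
have s0 (g : R -> R) t : (0 <= ((g t - c t) ^+ 2)%:E)%E by rewrite lee_fin sqr_ge0.
rewrite ge0_integralD//; last 4 first.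
- by move=> t _; rewrite mule_ge0.
- by apply: measurable_funeM; exact: msq.
- by move=> t _; rewrite mule_ge0.
- by apply: measurable_funeM; exact: msq.
rewrite !ge0_integralZl_EFin//; [|exact: msq..].
have -> : e%:E = (2^-1%:E * e%:E + 2^-1%:E * e%:E)%E by rewrite -!EFinM -EFinD; congr EFin; field.
by apply: leeD; apply: lee_wpmul2l => //; rewrite lee_fin invr_ge0.
Qed.

(** The competitors form a convex class: the squared error on an edge is convex, and the
    parallelogram identity bounds the energy of the midpoint. *)
Lemma near_trace_mid e u v : near_trace e u -> near_trace e v -> near_trace e (midpoint u v).
Proof.
move=> [Cu Eu eu] [Cv Ev ev].
have /C1P Hu := Cu; have /C1P Hv := Cv.
have cm w (pt : R -> P2) : C1 w -> measurable_fun [set: R] (pt : R -> R * R) ->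
    measurable_fun `[0, d] (fun t => w (pt t)).
  move=> /C1_continuous cw mpt.
  exact: (measurable_funTS (measurableT_comp (continuous_measurable2 cw) mpt)).
split; first exact: C1_grad_C1 (C1_grad_mid Hu Hv).
  exact: (mid_finite (energy_parallelogram Cu Cv) (energy_ge0 _) (energy_ge0 _) (fine_energy Eu) (fine_energy Ev)).
move=> j k; have [u1 u2] := eu j k; have [v1 v2] := ev j k.
have [f1 f2 _ _] := fL j k.
by split; apply: integral_mid_le => //; apply: cm => //;
  [exact: measurable_hpt|exact: measurable_hpt|exact: measurable_vpt|exact: measurable_vpt].
Qed.

(** Base 8 leaves room for the weights [2 ^ i] used in extracting the limit: [2 ^ i / 8 ^ i] is
    summable. *)
Let rate (i : nat) : R := (8 ^+ i)^-1.

Let rate_gt0 i : 0 < rate i. Proof. by rewrite invr_gt0 exprn_gt0. Qed.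

Let rateS i : rate i.+1 <= rate i.
Proof. by rewrite lef_pV2 ?posrE ?exprn_gt0// exprS ler_peMl ?exprn_ge0// ler1n. Qed.

Lemma near_trace_weaken e e' u : e <= e' -> near_trace e u -> near_trace e' u.
Proof.
move=> ee [Cu Eu eu]; split => // j k; have [e1 e2] := eu j k.
by split; [apply: (le_trans e1)|apply: (le_trans e2)]; rewrite lee_fin.
Qed.

(* Let m e be the least energy of a competitor within e of f. It increases to a
   finite limit M as e goes to 0, so competitors with energy close to M have nearly
   optimal midpoints, and the parallelogram identity makes them Cauchy. *)
Lemma minimizing_sequence (C : R) :
  (forall e : R, 0 < e -> exists2 u, near_trace e u & (energy u <= C%:E)%E) ->
  exists w : nat -> P2 -> R^o, (forall i, near_trace (8 ^+ i)^-1 (w i)) /\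
    forall i, (energy (fun z => w i.+1 z - w i z)%R <= (8 * (8 ^+ i)^-1)%:E)%E.
Proof.
move=> exC.
pose En e : set R := [set fine (energy u) | u in near_trace e].
pose m e := inf (En e).
have En0 e : lbound (En e) 0 by move=> _ [u _ <-]; exact: fine_ge0 (energy_ge0 u).
have hasEn e : 0 < e -> has_inf (En e).
  by move=> /exC[u nu _]; split; [exists (fine (energy u)), u|exists 0].
have mE e u : near_trace e u -> m e <= fine (energy u).
  by move=> nu; apply: ge_inf; [exists 0|exists u].
have fE e u : near_trace e u -> (fine (energy u))%:E = energy u.
  by move=> [_ Eu _]; exact: fine_energy.
pose Ms : set R := [set m e | e in [set e | 0 < e]].
have hasM : has_sup Ms.
  split; first by exists (m 1), 1 => //=.
  exists C => _ [e e0 <-]; have [u nu uC] := exC e e0.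
  by apply: (le_trans (mE _ _ nu)); rewrite -lee_fin (fE _ _ nu).
pose M := sup Ms.
have mono e e' : 0 < e -> e <= e' -> m e' <= m e.
  move=> e0 ee; apply: lb_le_inf; first by have [] := hasEn e e0.
  by move=> _ [u nu <-]; apply: mE; exact: near_trace_weaken nu.
have mM e : 0 < e -> m e <= M.
  by move=> e0; apply: ub_le_sup; [have [] := hasM|exists e].
(* The tolerance is chosen with the competitor: small enough that its infimum is within [rate i] of
   [M], while the competitor exceeds that infimum by at most [rate i]. *)
have pick i : exists ew : R * (P2 -> R^o), [/\ 0 < ew.1, ew.1 <= rate i, near_trace ew.1 ew.2,
    M - rate i <= m ew.1 & fine (energy ew.2) <= M + rate i].
  have [_ [e e0 <-] Me] := sup_adherent (rate_gt0 i) hasM.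
  pose e' := Num.min e (rate i); have e'0 : 0 < e' by rewrite lt_min e0 rate_gt0.
  have Me' : M - rate i <= m e' by apply: le_trans (ltW Me) (mono _ _ e'0 _); rewrite ge_min lexx.
  have [_ [u nu <-] mu'] := inf_adherent (rate_gt0 i) (hasEn e' e'0).
  exists (e', u); split => //=; first by rewrite ge_min lexx orbT.
  by apply: (le_trans (ltW mu')); rewrite lerD2r mM.
have [ew ewP] := choice pick.
exists (fun i => (ew i).2); split.
  by move=> i; have [_ le nu _ _] := ewP i; exact: near_trace_weaken nu.
move=> i; have [p1 l1 n1 M1 E1] := ewP i; have [p2 l2 n2 M2 E2] := ewP i.+1.
have [C1i Ei _] := n1; have [C1j Ej _] := n2.
have midM : M - rate i <= fine (energy (midpoint (ew i.+1).2 (ew i).2)).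
  (* The midpoint competes at the larger of the two tolerances, and the infimum there is still at
     least [M - rate i]. *)
  have [le|le] := leP (ew i).1 (ew i.+1).1.
    apply: (@le_trans _ _ (m (ew i.+1).1)); first by apply: le_trans M2; rewrite lerD2l lerN2.
    by apply: mE; apply: near_trace_mid => //; exact: near_trace_weaken n1.
  apply: (le_trans M1); apply: mE; apply: near_trace_mid => //.
  by apply: near_trace_weaken n2; exact: ltW.
have nmid : near_trace (rate i) (midpoint (ew i.+1).2 (ew i).2).
  apply: near_trace_mid; last exact: near_trace_weaken n1.
  by apply: near_trace_weaken n2; exact: le_trans l2 (rateS i).
apply: (gap_bound (energy_parallelogram C1j C1i) (esym (fE _ _ nmid)) (esym (fE _ _ n2))
  (esym (fE _ _ n1)) midM _ E1).
by apply: (le_trans E2); rewrite lerD2l rateS.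
Qed.

End minimizing.

(** * Limit of the minimizing sequence *)

Section fast_Cauchy.
Context dT (T : measurableType dT) {R : realType} (m : {measure set T -> \bar R}).
Variable g : nat -> T -> R.
Hypothesis mg : forall n, measurable_fun [set: T] (g n).

(** The induction step of Cauchy-Schwarz: the cross term [2 x b] is at most [P q + p Q] because
    [4 P q p Q <= (P q + p Q) ^ 2]. *)
Let cauchy_schwarz_step (x b P Q p q : R) : 0 <= P -> 0 <= Q -> 0 <= p -> 0 <= q ->
  x ^+ 2 <= P * Q -> b ^+ 2 <= p * q -> (x + b) ^+ 2 <= (P + p) * (Q + q).
Proof.
move=> P0 Q0 p0 q0 xPQ bpq.
have y0 : 0 <= P * q + p * Q by rewrite addr_ge0 ?mulr_ge0.
suff : x * b *+ 2 <= P * q + p * Q.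
  have -> : (x + b) ^+ 2 = x ^+ 2 + b ^+ 2 + x * b *+ 2 by ring.
  have -> : (P + p) * (Q + q) = P * Q + p * q + (P * q + p * Q) by ring.
  by move=> h; rewrite lerD// lerD.
apply: (le_trans (ler_norm _)); rewrite -(@ler_pXn2r _ 2) ?nnegrE// real_normK ?num_real//.
apply: (@le_trans _ _ (4 * ((P * Q) * (p * q)))).
  have -> : (x * b *+ 2) ^+ 2 = 4 * (x ^+ 2 * b ^+ 2) by ring.
  by rewrite ler_pM2l// ler_pM ?sqr_ge0.
rewrite -subr_ge0 (_ : _ - _ = (P * q - p * Q) ^+ 2) ?sqr_ge0//; ring.
Qed.

Let wt (i : nat) : R := 2 ^+ i.

Let wt_gt0 i : 0 < wt i. Proof. by rewrite exprn_gt0. Qed.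

(** Cauchy-Schwarz on the telescoping sum with weights [2 ^ i]; the first factor is the geometric
    sum of their inverses from [n] to [n + k - 1]. *)
Let dist_le (u : nat -> R) n k :
  (u (n + k)%N - u n) ^+ 2 <=
  (2 * (wt n)^-1 - 2 * (wt (n + k))^-1) *
  \sum_(i < k) wt (n + i) * (u (n + i).+1 - u (n + i)%N) ^+ 2.
Proof.
elim: k => [|k IH]; first by rewrite addn0 subrr expr0n/= subrr mul0r.
have p0 i : 0 <= (wt i)^-1 by rewrite invr_ge0 ltW.
have -> : 2 * (wt n)^-1 - 2 * (wt (n + k.+1))^-1 =
    (2 * (wt n)^-1 - 2 * (wt (n + k))^-1) + (wt (n + k))^-1.
  rewrite addnS /wt exprS invfM mulrA divff ?pnatr_eq0// mul1r; set a := (2 ^+ (n + k))^-1; set b := (2 ^+ n)^-1; ring.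
rewrite big_ord_recr/= addnS.
rewrite [X in X ^+ 2](_ : _ = (u (n + k)%N - u n) + (u (n + k).+1 - u (n + k)%N)); last by ring.
apply: cauchy_schwarz_step => //.
- rewrite subr_ge0 ler_pM2l// lef_pV2 ?posrE//; apply: ler_weXn2l; rewrite ?ler1n//; exact: leq_addr.
- by apply: sumr_ge0 => i _; rewrite mulr_ge0 ?sqr_ge0// ltW.
- by rewrite mulr_ge0 ?sqr_ge0// ltW.
- by rewrite mulrA mulVf ?mul1r// gt_eqF.
Qed.

Let S (x : T) : \bar R := (\sum_(i <oo) (wt i * (g i.+1 x - g i x) ^+ 2)%:E)%E.

Let term_ge0 i x : (0 <= (wt i * (g i.+1 x - g i x) ^+ 2)%:E)%E.
Proof. by rewrite lee_fin mulr_ge0 ?sqr_ge0// ltW. Qed.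

Let S_ge0 x : (0 <= S x)%E. Proof. exact: nneseries_ge0. Qed.

Let mterm i : measurable_fun [set: T] (fun x => (wt i * (g i.+1 x - g i x) ^+ 2)%:E).
Proof.
apply/measurable_EFinP; apply: measurable_funM; first exact: measurable_cst.
by apply: measurable_funX; exact: measurable_funB.
Qed.

Let mS : measurable_fun [set: T] S.
Proof. by apply: ge0_emeasurable_sum. Qed.

Let A : set T := [set x | (S x < +oo)%E].

Let mA : measurable A.
Proof. by have := emeasurable_fun_infty_o measurableT mS +oo%E; rewrite setTI. Qed.

Let tail x n k : A x -> (n <= k)%N -> (g k x - g n x) ^+ 2 <= 2 * (wt n)^-1 * fine (S x).
Proof.
move=> Ax nk; rewrite -(subnKC nk); apply: (le_trans (dist_le (fun i => g i x) n (k - n))).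
have p0 i : 0 <= (wt i)^-1 by rewrite invr_ge0 ltW.
apply: ler_pM.
- rewrite subr_ge0 ler_pM2l// lef_pV2 ?posrE//; apply: ler_weXn2l; rewrite ?ler1n//; exact: leq_addr.
- by apply: sumr_ge0 => i _; rewrite mulr_ge0 ?sqr_ge0// ltW.
- by rewrite gerBl mulr_ge0.
rewrite -lee_fin fineK ?ge0_fin_numE// -sumEFin.
apply: le_trans (nneseries_lim_ge k (fun i _ _ => term_ge0 i x)).
rewrite -[in leRHS](subnKC nk) big_mkord big_split_ord/= leeDr//.
by apply: sume_ge0 => i _.
Qed.

Let cvg_on x : A x -> cvgn (fun n => g n x).
Proof.
move=> Ax; apply/cauchy_cvgP/cauchy_exP => e e0.
have s0 : 0 <= fine (S x) by exact: fine_ge0.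
have [n hn] : exists n, 2 * (wt n)^-1 * fine (S x) < e ^+ 2.
  exists (Num.truncn (2 * fine (S x) / e ^+ 2)).+1.
  have e2 : 0 < e ^+ 2 by rewrite exprn_gt0.
  rewrite mulrAC ltr_pdivrMr// [ltRHS]mulrC -ltr_pdivrMr//.
  apply: (lt_le_trans (truncnS_gt (2 * fine (S x) / e ^+ 2))).
  by rewrite /wt -natrX ler_nat ltnW// ltn_expl.
exists (g n x); exists n => // k /= nk; rewrite /ball/= distrC.
rewrite -(@ltr_pXn2r _ 2) ?nnegrE// ?ltW// real_normK ?num_real//.
exact: le_lt_trans (tail Ax nk) hn.
Qed.

(** The indicator makes the sequence constant off [A], so the limit exists everywhere and is
    measurable. *)
Let G (x : T) : R := limn (fun n => g n x * \1_A x).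

Let G_cvg x : (fun n => g n x * \1_A x) @ \oo --> G x.
Proof.
have [Ax|Ax] := pselect (A x).
  suff : cvgn (fun n => g n x * \1_A x) by [].
  rewrite indicE mem_set//; under eq_fun do rewrite mulr1; exact: cvg_on.
suff : cvgn (fun n => g n x * \1_A x) by [].
rewrite indicE memNset//; under eq_fun do rewrite mulr0; exact: is_cvg_cst.
Qed.

(* S = sum_i 2^i (g_(i+1) - g_i)^2 is integrable, hence finite almost everywhere, and
   by Cauchy-Schwarz (g_k - g_n)^2 <= 2 S / 2^n where it is finite. The limit does
   not depend on the domain D, on which only the rate is assumed. *)
Lemma fast_Cauchy_limit : exists G : T -> R, measurable_fun [set: T] G /\
  forall (D : set T) (C : R), measurable D -> 0 <= C ->
    (forall i, \int[m]_(x in D) ((g i.+1 x - g i x) ^+ 2)%:E <= (C * (8 ^+ i)^-1)%:E)%E ->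
    forall n, (\int[m]_(x in D) ((G x - g n x) ^+ 2)%:E <= (4 * C * (2 ^+ n)^-1)%:E)%E.
Proof.
exists G; have mG : measurable_fun [set: T] G.
  apply: (measurable_fun_cvg (h := fun n x => g n x * \1_A x)) => [n|x _]; last exact: G_cvg.
  by apply: measurable_funM => //; exact: measurable_indic.
split => // D C mD C0 HD n.
have c0 : 0 <= 2 * (wt n)^-1 by rewrite mulr_ge0// invr_ge0 ltW.
apply: (@le_trans _ _ (\int[m]_(x in D) ((2 * (wt n)^-1)%:E * S x))%E).
  apply: ge0_le_integral => //.
  - by move=> x _; rewrite lee_fin sqr_ge0.
  - by apply/measurable_EFinP/measurable_funTS; apply: measurable_funX; exact: measurable_funB.
  - by apply: measurable_funTS; exact: measurable_funeM.
  - move=> x _; have [Ax|Ax] := pselect (A x); last first.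
      have -> : S x = +oo%E.
        by apply/eqP; move/negP: Ax; rewrite /A/= -leNgt leye_eq.
      by rewrite gt0_muley ?leey// lte_fin mulr_gt0// invr_gt0.
    rewrite -(fineK (x := S x)) ?ge0_fin_numE// -EFinM lee_fin.
    have cv : (g k x - g n x) ^+ 2 @[k --> \oo] --> (G x - g n x) ^+ 2.
      have cg : g k x @[k --> \oo] --> G x.
        by have := @G_cvg x; rewrite indicE mem_set//; under eq_fun do rewrite mulr1.
      apply: (@cvgM _ _ _ _ (fun k => g k x - g n x) (fun k => g k x - g n x));
        by apply: cvgB => //; exact: cvg_cst.
    by apply: (cvgr_to_le cv); exists n => // k /= nk; exact: tail.
rewrite ge0_integralZl_EFin//; last exact: measurable_funTS.
rewrite integral_nneseries//; last by move=> i; exact: measurable_funTS.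
have -> : 4 * C * (2 ^+ n)^-1 = 2 * (wt n)^-1 * (2 * C) by rewrite /wt; ring.
rewrite [leRHS]EFinM; apply: lee_wpmul2l; first by rewrite lee_fin.
apply: lime_le.
  by apply: is_cvg_nneseries => i _ _; exact: integral_ge0.
(* The weights and the rate combine to [2 ^ i / 8 ^ i = 4 ^- i]; the subtracted remainder makes the
   induction close. *)
have geo k : \sum_(i < k) C * (4 ^+ i)^-1 <= 2 * C :> R.
  suff : \sum_(i < k) C * (4 ^+ i)^-1 <= 2 * C - 2 * (C * (4 ^+ k)^-1).
    by move=> /le_trans; apply; rewrite gerBl !mulr_ge0// invr_ge0 exprn_ge0.
  elim: k => [|k IH]; first by rewrite big_ord0 expr0 invr1 mulr1 subrr.
  rewrite big_ord_recr/= (le_trans (lerD IH (lexx _)))//.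
  have -> : (4 ^+ k.+1)^-1 = 4^-1 * (4 ^+ k)^-1 :> R by rewrite exprS invfM.
  have : 0 <= C * (4 ^+ k)^-1 by rewrite mulr_ge0// invr_ge0 exprn_ge0.
  by rewrite (mulrCA C); lra.
near=> k; rewrite big_mkord.
apply: (@le_trans _ _ (\sum_(i < k) (C * (4 ^+ i)^-1)%:E)%E); last by rewrite sumEFin lee_fin.
apply: lee_sum => i _; under eq_integral do rewrite EFinM.
rewrite ge0_integralZl_EFin//; last 3 first.
- by move=> x _; rewrite lee_fin sqr_ge0.
- by apply/measurable_EFinP/measurable_funTS; apply: measurable_funX; exact: measurable_funB.
- exact: ltW.
apply: (le_trans (lee_wpmul2l _ (HD i))); first by rewrite lee_fin ltW.
rewrite -EFinM lee_fin le_eqVlt; apply/orP; left; apply/eqP.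
rewrite mulrCA; congr (_ * _).
have -> : (8 : R) = 2 * 4 by ring.
by rewrite exprMn invfM mulrA divff ?mul1r// gt_eqF.
Unshelve. all: by end_near. Qed.

End fast_Cauchy.

(** * A Poincare inequality anchored on the horizontal axis *)

Section poincare.
Context {R : realType}.
Local Notation mu := (@lebesgue_measure R).
Local Notation P2 := (R^o * R^o)%type.

Lemma measurable_box (M : R) : measurable (box M).
Proof. exact: measurableX. Qed.

Lemma integral_chain_le (d e : R) (g : R -> R) (j : int) n : 0 < d -> 0 <= e -> continuous g ->
  (forall j : int, \int[mu]_(t in `[0%R, d]) ((g (j%:~R * d + t)) ^+ 2)%:E <= e%:E)%E ->
  (\int[mu]_(t in `[(j%:~R * d)%R, (j%:~R * d + n%:R * d)%R]) ((g t) ^+ 2)%:E <= (n%:R * e)%:E)%E.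
Proof.
move=> d0 e0 cg H; set a := j%:~R * d.
have mg : measurable_fun [set: R] (fun t => ((g t) ^+ 2)%:E).
  by apply/measurable_EFinP/measurable_funX; exact: continuous_measurable_fun.
have g0 t : (0 <= ((g t) ^+ 2)%:E)%E by rewrite lee_fin sqr_ge0.
elim: n => [|n IH]; first by rewrite !mul0r addr0 set_itv1 integral_set1.
set b := a + n%:R * d in IH *; have bE : a + n.+1%:R * d = b + d by rewrite -(natr1 n) /b; ring.
have ab : a <= b by rewrite lerDl mulr_ge0// ltW.
have -> : `[a, (a + n.+1%:R * d)]%classic = `[a, b]%classic `|` `]b, b + d]%classic.
  by rewrite bE -itv_bndbnd_setU// bnd_simp lerDl ltW.
rewrite ge0_integral_setU//=; last 2 first.
- exact: measurable_funTS.
- by apply/disj_setPS => x [] /=; rewrite !in_itv/= => /andP[_ h] /andP[]; rewrite ltNge h.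
rewrite -(natr1 n) mulrDl mul1r EFinD; apply: leeD => //.
apply: (@le_trans _ _ (\int[mu]_(t in `[b, (b + d)%R]) ((g t) ^+ 2)%:E)%E).
  by apply: ge0_subset_integral => //; [exact: measurable_funTS|exact: subset_itv_oc_cc].
have bj : b = (j + n%:Z)%:~R * d by rewrite /b /a intrD mulrDl.
rewrite [X in `[X, _]](_ : b = b + 0); last by rewrite addr0.
rewrite -(@ge0_integral_shift _ b)//; last exact: measurable_funTS.
by rewrite shift_itv bj; exact: H.
Qed.

Lemma sqr_increment_abs_le (M t : R) (v g : R -> R) : `|t| <= M ->
  (forall x : R, is_derive x 1 v (g x)) -> continuous g ->
  (((v t - v 0) ^+ 2)%:E <= M%:E * \int[mu]_(x in `[(- M)%R, M]) ((g x) ^+ 2)%:E)%E.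
Proof.
move=> tM dv cg.
have mg : measurable_fun [set: R] (fun t => ((g t) ^+ 2)%:E).
  by apply/measurable_EFinP/measurable_funX; exact: continuous_measurable_fun.
have g0 x : (0 <= ((g x) ^+ 2)%:E)%E by rewrite lee_fin sqr_ge0.
have M0 : 0 <= M by exact: le_trans tM.
move: tM; rewrite ler_norml => /andP[Mt tM].
have sub a b : - M <= a -> b <= M -> a <= b -> b - a <= M ->
    (((v b - v a) ^+ 2)%:E <= M%:E * \int[mu]_(x in `[(- M)%R, M]) ((g x) ^+ 2)%:E)%E.
  move=> Ma bM ab baM; apply: (le_trans (sqr_increment_le ab dv cg)).
  apply: lee_pmul.
  - by rewrite lee_fin subr_ge0.
  - exact: integral_ge0.
  - by rewrite lee_fin.
  - apply: ge0_subset_integral => //; first exact: measurable_funTS.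
    by move=> x /=; rewrite !in_itv/= => /andP[? ?]; apply/andP; split; lra.
have [t0|t0] := leP 0 t; first by apply: sub => //; lra.
by rewrite -sqrrN opprB; apply: sub; lra.
Qed.

(* Every point is reached vertically from the axis y = 0. *)
Lemma poincare_box (M a b : R) (v : P2 -> R^o) : 0 <= M -> C1 v ->
  (\int[mu]_(x in `[(- M)%R, M]) (v (x, 0) ^+ 2)%:E <= a%:E)%E -> (energy v <= b%:E)%E ->
  (\int[@leb2 R]_(z in box M) (v z ^+ 2)%:E <= (4 * M * a + 4 * M ^+ 2 * b)%:E)%E.
Proof.
move=> M0 Cv va vb; have cv := C1_continuous Cv; have [dv [_ cq]] := Cv.
have mI : measurable (`[(- M)%R, M] : set R) by exact: measurable_itv.
have muI : mu `[(- M)%R, M] = (2 * M)%:E.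
  rewrite -[LHS]mul1e -integral_cst// integral_cst_itv; last by lra.
  by congr EFin; ring.
(* The inner integral [s] may be infinite; then [M = 0] is a separate case, where the convention
   [0 * oo = 0] applies on both sides. *)
have cell (c : R) (s : \bar R) : (0 <= s)%E ->
    (((2 * c)%:E + (2 * M)%:E * s) * (2 * M)%:E <= (4 * M)%:E * c%:E + (4 * M ^+ 2)%:E * s)%E.
  case: s => [r _|_|//].
    by rewrite -!(EFinM, EFinD) lee_fin le_eqVlt; apply/orP; left; apply/eqP; ring.
  move: M0; rewrite le_eqVlt => /predU1P[<-|M0'].
    by rewrite !mulr0 expr0n/= mulr0 mule0 !mul0e adde0.
  by rewrite [X in (_ <= _ + X)%E]gt0_muley ?lte_fin ?mulr_gt0 ?exprn_gt0// addey ?leey.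
have m2 (g : P2 -> R) : continuous g -> measurable_fun [set: R * R] (fun z => g z ^+ 2).
  by move=> cg; apply/measurable_funX; exact: continuous_measurable2.
have sq0 (g : P2 -> R) z : 0 <= g z ^+ 2 by exact: sqr_ge0.
have my (g : P2 -> R) x : continuous g -> measurable_fun [set: R] (fun y => (g (x, y) ^+ 2)%:E).
  move=> cg; apply/measurable_EFinP/measurable_funX; apply: continuous_measurable_fun.
  exact: continuous_section2.
have mx (g : P2 -> R) y : continuous g -> measurable_fun [set: R] (fun x => (g (x, y) ^+ 2)%:E).
  move=> cg; apply/measurable_EFinP/measurable_funX; apply: continuous_measurable_fun.
  exact: continuous_section1.
pose I (g : P2 -> R) x := (\int[mu]_(y in `[(- M)%R, M]) (g (x, y) ^+ 2)%:E)%E.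
have I0 g x : (0 <= I g x)%E by apply: integral_ge0 => y _; rewrite lee_fin.
have mIg (g : P2 -> R) : continuous g -> measurable_fun [set: R] (I g).
  by move=> cg; exact: (measurable_integral_snd mI (m2 g cg) (sq0 g)).
have prodI (g : P2 -> R) : continuous g ->
    (\int[@leb2 R]_(z in box M) (g z ^+ 2)%:E = \int[mu]_(x in `[(- M)%R, M]) I g x)%E.
  move=> cg; apply: ge0_integral_prod => //; last by move=> z _; rewrite lee_fin.
  by apply/measurable_EFinP; exact: (measurable_funTS (m2 g cg)).
rewrite (prodI v cv).
apply: (@le_trans _ _ (\int[mu]_(x in `[(- M)%R, M])
   ((4 * M)%:E * (v (x, 0) ^+ 2)%:E + (4 * M ^+ 2)%:E * I (d2 v) x))%E).
  apply: ge0_le_integral => //.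
  - exact: (measurable_funTS (mIg v cv)).
  - apply: emeasurable_funD; apply: measurable_funeM; first exact: (measurable_funTS (mx v 0 cv)).
    exact: (measurable_funTS (mIg _ cq)).
  - move=> x _.
    apply: (@le_trans _ _ (\int[mu]_(y in `[(- M)%R, M])
        ((2 * v (x, 0) ^+ 2)%:E + (2 * M)%:E * I (d2 v) x))%E).
      apply: ge0_le_integral => //.
      + by move=> y _; rewrite lee_fin.
      + exact: (measurable_funTS (my v x cv)).
      + move=> y /=; rewrite in_itv/= -ler_norml => yM.
        have h := sqr_increment_abs_le yM (fun s => is_derive_section2 (dv (x, s)))
          (@continuous_section2 _ (d2 v) x cq).
        apply: (@le_trans _ _ ((2 * v (x, 0) ^+ 2)%:E + 2%:E * ((v (x, y) - v (x, 0)) ^+ 2)%:E)%E).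
          rewrite -EFinM -EFinD lee_fin -subr_ge0.
          rewrite (_ : _ - _ = (v (x, y) - 2 * v (x, 0)) ^+ 2) ?sqr_ge0//; ring.
        apply: leeD2l; rewrite [(2 * M)%:E]EFinM -muleA; apply: lee_wpmul2l => //.
    rewrite integral_cst// [X in (_ * X <= _)%E](_ : _ = (2 * M)%:E); last exact: muI.
    exact: cell.
rewrite ge0_integralD//; last 4 first.
- by move=> x _; rewrite mule_ge0// lee_fin// mulr_ge0.
- by apply: measurable_funeM; exact: (measurable_funTS (mx v 0 cv)).
- by move=> x _; rewrite mule_ge0// lee_fin// mulr_ge0// exprn_ge0.
- by apply: measurable_funeM; exact: (measurable_funTS (mIg _ cq)).
rewrite ge0_integralZl_EFin//; last 3 first.
- by move=> x _; rewrite lee_fin.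
- exact: (measurable_funTS (mx v 0 cv)).
- by rewrite mulr_ge0.
rewrite ge0_integralZl_EFin//; last 2 first.
- exact: (measurable_funTS (mIg _ cq)).
- by rewrite mulr_ge0// exprn_ge0.
rewrite EFinD; apply: leeD.
  by rewrite [leRHS]EFinM; apply: lee_wpmul2l => //; rewrite lee_fin mulr_ge0.
rewrite [leRHS]EFinM; apply: lee_wpmul2l; first by rewrite lee_fin mulr_ge0// exprn_ge0.
apply: le_trans vb; rewrite -(prodI _ cq) energyE.
apply: (@le_trans _ _ (\int[@leb2 R]_(z in box M) energy_density v z)%E).
  apply: ge0_le_integral.
  - exact: measurable_box.
  - by move=> z _; rewrite lee_fin.
  - by apply/measurable_EFinP; exact: (measurable_funTS (m2 _ cq)).
  - exact: (measurable_funTS (measurable_energy_density Cv)).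
  - by move=> z _; rewrite /energy_density lee_fin lerDr sqr_ge0.
apply: ge0_subset_integral => //.
- exact: measurable_box.
- exact: measurable_energy_density.
- by move=> z _; exact: energy_density_ge0.
Qed.

End poincare.

(** * Compactly supported functions *)

Section compact_support.
Context {R : realType}.
Local Notation mu := (@lebesgue_measure R).
Local Notation P2 := (R^o * R^o)%type.

Lemma continuous_bounded_box (g : P2 -> R^o) (M : R) : continuous g ->
  exists2 B, 0 <= B & forall z, box M z -> `|g z| <= B.
Proof.
move=> cg; have cb : compact (box M : set P2).
  by apply: compact_setX; exact: segment_compact.
have : bounded_set (g @` (box M : set P2)).
  by apply: compact_bounded; apply: continuous_compact => //; exact: continuous_subspaceT.
move=> /pinfty_ex_gt0[B B0 HB]; exists B; first exact: ltW.
by move=> z bz; apply: HB; exists z.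
Qed.

Lemma leb2_box_lty (M : R) : (@leb2 R (box M) < +oo)%E.
Proof.
rewrite /leb2 product_measure1E//= /leb1; apply: lte_mul_pinfty => //.
  by rewrite ge0_fin_numE// lebesgue_measure_itv/=; case: ifP => _; rewrite ?ltry// -EFinB ltry.
by rewrite lebesgue_measure_itv/=; case: ifP => _; rewrite ?ltry// -EFinB ltry.
Qed.

Lemma integrable_box (g : P2 -> R^o) (M : R) : continuous g ->
  (@leb2 R).-integrable (box M) (EFin \o g).
Proof.
move=> cg; have [B B0 HB] := continuous_bounded_box M cg.
have mg := continuous_measurable2 cg.
have mE : measurable_fun (box M) (EFin \o g : R * R -> \bar R).
  by apply/measurable_EFinP; exact: (measurable_funTS mg).
apply/integrableP; split; first exact: mE.
apply: (@le_lt_trans _ _ (\int[@leb2 R]_(z in box M) B%:E)%E).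
  apply: ge0_le_integral; first exact: measurable_box.
  - by move=> z _; exact: abse_ge0.
  - exact: (measurableT_comp _ mE).
  - exact: measurable_cst.
  - by move=> z bz; rewrite lee_fin; exact: HB.
rewrite (integral_cst (@lebesgue_measure R \x @lebesgue_measure R)%E (measurable_box M)).
by apply: lte_mul_pinfty => //; exact: leb2_box_lty.
Qed.

Lemma integral_support dT (T : measurableType dT) (m : {measure set T -> \bar R})
    (D : set T) (f : T -> \bar R) : (forall x, ~ D x -> f x = 0%E) ->
  (\int[m]_(x in D) f x = \int[m]_x f x)%E.
Proof.
move=> f0; rewrite integral_mkcond; congr integral; apply/funext => x.
by rewrite patchE; case: ifPn => // /negP Dx; rewrite f0// => /mem_set.
Qed.

Lemma gradient_support (u : P2 -> R^o) (M : R) : (forall z, ~ box M z -> u z = 0) ->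
  forall z, ~ box M z -> d1 u z = 0 /\ d2 u z = 0.
Proof.
move=> u0 z bz; have near0 : \forall y \near z, u y = (cst 0 : P2 -> R^o) y.
  have oB : open (~` (box M : set P2)).
    apply: closed_openC; apply: compact_closed; first exact: norm_hausdorff.
    by apply: compact_setX; exact: segment_compact.
  have : nbhs z (~` (box M : set P2)) by exact: open_nbhs_nbhs.
  by apply: filterS => y By; exact: u0.
by split; rewrite /d1 /d2 (near_eq_derive _ near0) ?derive_cst// xpair_eqE oner_eq0 ?andbF.
Qed.

Lemma C1_gradM (u v p q p' q' : P2 -> R^o) : C1_grad u p q -> C1_grad v p' q' ->
  C1_grad (fun z => u z * v z) (fun z => u z * p' z + p z * v z) (fun z => u z * q' z + q z * v z).
Proof.
move=> Hu Hv; have cu := C1_continuous (C1_grad_C1 Hu); have cv := C1_continuous (C1_grad_C1 Hv).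
move: Hu Hv => [du e1 e2 cp cq] [dv e1' e2' cp' cq']; split.
- by move=> z; exact: differentiableM.
- apply/funext => z; rewrite -e1 -e1' [RHS]addrC -[X in _ + X]mulrC addrC mulrC.
  by rewrite /d1 deriveM; [rewrite /GRing.scale/= mulrC; ring|exact: diff_derivable..].
- apply/funext => z; rewrite -e2 -e2'.
  by rewrite /d2 deriveM; [rewrite /GRing.scale/=; ring|exact: diff_derivable..].
- move=> z; apply: (@continuousD _ _ _ (fun z => u z * p' z) (fun z => p z * v z));
    apply: continuousM; [exact: cu|exact: cp'|exact: cp|exact: cv].
- move=> z; apply: (@continuousD _ _ _ (fun z => u z * q' z) (fun z => q z * v z));
    apply: continuousM; [exact: cu|exact: cq'|exact: cq|exact: cv].
Qed.

Lemma integral_derivative_support (N : R) (v g : R -> R) : 0 <= N ->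
  (forall x : R, is_derive x 1 v (g x)) -> continuous g ->
  (forall x, x \notin `[- N, N] -> g x = 0) -> v N = 0 -> v (- N) = 0 ->
  (\int[mu]_x (g x)%:E = 0)%E.
Proof.
move=> N0 dv cg g0 vN vN'.
have g0' x : ~ `[(- N)%R, N]%classic x -> (g x)%:E = 0%E by move=> /negP xN; rewrite g0.
refine (etrans (esym (integral_support mu g0')) _).
have NN : - N <= N by lra.
rewrite -EFin_Rintegral//; last by apply: continuous_at_integrable => x _; exact: cg.
by rewrite (FTC2_itv NN (fun x _ => dv x) (fun x _ => cg x)) vN vN' subrr.
Qed.

(** Fubini in the order that integrates first along the direction of differentiation; each inner
    integral is a difference of two boundary values equal to 0. *)
Lemma integral_gradient_support (u p q : P2 -> R^o) (M : R) : C1_grad u p q ->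
  (forall z, ~ box M z -> u z = 0) ->
  (\int[@leb2 R]_z (p z)%:E = 0)%E /\ (\int[@leb2 R]_z (q z)%:E = 0)%E.
Proof.
move=> [du e1 e2 cp cq] u0.
(* Strictly larger than [M], because [u] is known to vanish only outside the box and not on its
   boundary; nonnegative even when [M] is negative. *)
pose N := `|M| + 1; have N0 : 0 <= N by rewrite addr_ge0.
have MN : M < N by rewrite (le_lt_trans (ler_norm M))// ltrDl.
have out (x : R) : x \notin `[(- N), N] -> x \notin `[(- M), M].
  by apply: contra; rewrite !in_itv/= => /andP[? ?]; apply/andP; split; lra.
have NM : N \notin `[- M, M] by rewrite in_itv/= negb_and -!ltNge MN orbT.
have NM' : - N \notin `[- M, M] by rewrite in_itv/= negb_and -!ltNge ltrN2 MN.
have b1 (x y : R) : x \notin `[- M, M] -> ~ box M (x, y) by move=> /negP xM [].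
have b2 (x y : R) : y \notin `[- M, M] -> ~ box M (x, y) by move=> /negP yM [].
have p0 z : ~ box M z -> p z = 0 by move=> /(gradient_support u0)[]; rewrite e1.
have q0 z : ~ box M z -> q z = 0 by move=> /(gradient_support u0)[]; rewrite e2.
have int (g : P2 -> R^o) : continuous g -> (forall z, ~ box M z -> g z = 0) ->
    (@lebesgue_measure R \x @lebesgue_measure R)%E.-integrable setT (EFin \o g).
  move=> cg g0; have /integrableP[_ goo] := integrable_box M cg.
  have mE : measurable_fun [set: R * R] (EFin \o g : R * R -> \bar R).
    by apply/measurable_EFinP; exact: continuous_measurable2.
  have g0' z : ~ box M z -> `|(EFin \o g) z|%E = 0%E by move=> bz; rewrite /= g0// normr0.
  apply/integrableP; split; first exact: mE.
  by have := goo; rewrite /leb2 (integral_support (mu \x mu)%E g0').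
have D1 (x y : R) : is_derive x 1 (fun s : R => u (s, y)) (p (x, y)).
  by rewrite -e1; exact: is_derive_section1.
have D2 (x y : R) : is_derive y 1 (fun s : R => u (x, s)) (q (x, y)).
  by rewrite -e2; exact: is_derive_section2.
split.
- rewrite /leb2 -(integral21_prod_meas1 (int p cp p0)); apply: integral0_eq => y _.
  apply: (integral_derivative_support N0 (fun x => D1 x y)).
  + exact: continuous_section1.
  + by move=> x xN; apply: p0; apply: b1; exact: out.
  + by apply: u0; exact: b1.
  + by apply: u0; exact: b1.
- rewrite /leb2 -(integral12_prod_meas1 (int q cq q0)); apply: integral0_eq => x _.
  apply: (integral_derivative_support N0 (fun y => D2 x y)).
  + exact: continuous_section2.
  + by move=> y yN; apply: q0; apply: b2; exact: out.
  + by apply: u0; exact: b2.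
  + by apply: u0; exact: b2.
Qed.

End compact_support.

(** * Convergence of L^2 functions against a bounded function *)

Section L2_pairing.
Context {R : realType} dT (T : measurableType dT) (m : {measure set T -> \bar R}).
Variables (D : set T) (psi : T -> R) (B : R).
Hypotheses (mD : measurable D) (mDoo : (m D < +oo)%E) (mpsi : measurable_fun D psi).
Hypotheses (B0 : 0 <= B) (psiB : forall x, D x -> `|psi x| <= B).

Lemma integrable_mul_bounded (g : T -> R) : measurable_fun D g ->
  (\int[m]_(x in D) (g x ^+ 2)%:E < +oo)%E -> m.-integrable D (EFin \o (fun x => g x * psi x)).
Proof.
move=> mg goo; apply: sqr_integrable => //; first exact: measurable_funM.
apply: (@le_lt_trans _ _ (\int[m]_(x in D) ((B ^+ 2)%:E * (g x ^+ 2)%:E))%E).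
  apply: ge0_le_integral => //.
  - by move=> x _; rewrite lee_fin sqr_ge0.
  - by apply/measurable_EFinP/measurable_funX; exact: measurable_funM.
  - by apply: measurable_funeM; apply/measurable_EFinP/measurable_funX.
  - move=> x Dx; rewrite -EFinM lee_fin exprMn mulrC; apply: ler_wpM2r; first exact: sqr_ge0.
    by rewrite -[leLHS]real_normK ?num_real// lerXn2r// ?nnegrE// psiB.
rewrite ge0_integralZl_EFin ?sqr_ge0//; last 2 first.
- by move=> x _; rewrite lee_fin sqr_ge0.
- by apply/measurable_EFinP/measurable_funX.
by rewrite lte_mul_pinfty// lee_fin sqr_ge0.
Qed.

(* |h| <= s + h^2 / s with s = sqrt c. *)
Lemma integral_mul_bounded_le (h : T -> R) (c : R) : measurable_fun D h -> 0 < c ->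
  (\int[m]_(x in D) (h x ^+ 2)%:E <= c%:E)%E ->
  (`| \int[m]_(x in D) (h x * psi x)%:E | <=
   (B * (fine (m D) + 1) * Num.sqrt c)%:E)%E.
Proof.
move=> mh c0 hc; set s := Num.sqrt c; have s0 : 0 < s by rewrite sqrtr_gt0.
have sc : s ^+ 2 = c by rewrite sqr_sqrtr// ltW.
have mhp : measurable_fun D (fun x => (h x * psi x)%:E) by apply/measurable_EFinP/measurable_funM.
apply: (le_trans (le_abse_integral m mD mhp)).
apply: (@le_trans _ _ (\int[m]_(x in D) ((B * s)%:E + (B / s)%:E * (h x ^+ 2)%:E))%E).
  apply: ge0_le_integral => //.
  - exact: measurableT_comp.
  - apply: emeasurable_funD; first exact: measurable_cst.
    by apply: measurable_funeM; apply/measurable_EFinP/measurable_funX.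
  - move=> x Dx; rewrite -EFinM -EFinD lee_fin normrM mulrC.
    have hs : `|h x| <= s + `|h x| ^+ 2 / s.
      rewrite -(ler_pM2r s0) mulrDl mulfVK ?gt_eqF//.
      by rewrite -subr_ge0 (_ : _ - _ = (`|h x| - s / 2) ^+ 2 + 3 / 4 * s ^+ 2);
        [rewrite addr_ge0 ?sqr_ge0// mulr_ge0 ?sqr_ge0|field].
    have -> : B * s + B / s * h x ^+ 2 = B * (s + `|h x| ^+ 2 / s).
      by rewrite real_normK ?num_real//; ring.
    by apply: ler_pM => //; exact: psiB.
have mh2 : measurable_fun D (fun x => (h x ^+ 2)%:E) by apply/measurable_EFinP/measurable_funX.
have Bs : 0 <= B / s by rewrite divr_ge0// ltW.
rewrite ge0_integralD//; last 3 first.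
- by move=> x _; rewrite lee_fin mulr_ge0// ltW.
- by move=> x _; rewrite mule_ge0// lee_fin sqr_ge0.
- exact: measurable_funeM.
rewrite ge0_integralZl_EFin//; last by move=> x _; rewrite lee_fin sqr_ge0.
rewrite integral_cst// -(@fineK _ (m D)) ?ge0_fin_numE//.
apply: (@le_trans _ _ ((B * s)%:E * (fine (m D))%:E + (B / s)%:E * c%:E)%E).
  by apply: leeD2l; apply: lee_wpmul2l.
rewrite -!EFinM -EFinD lee_fin/= -sc.
have -> : B / s * s ^+ 2 = B * s by field; rewrite gt_eqF.
by rewrite le_eqVlt; apply/orP; left; apply/eqP; ring.
Qed.

Lemma L2_pairing_cvg (g_ : nat -> T -> R) (g : T -> R) (c : nat -> R) :
  (forall n, measurable_fun D (g_ n)) -> measurable_fun D g ->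
  (forall n, \int[m]_(x in D) (g_ n x ^+ 2)%:E < +oo)%E ->
  (\int[m]_(x in D) (g x ^+ 2)%:E < +oo)%E ->
  (forall n, \int[m]_(x in D) ((g x - g_ n x) ^+ 2)%:E <= (c n)%:E)%E ->
  (forall n, 0 < c n) -> c n @[n --> \oo] --> 0 ->
  (\int[m]_(x in D) (g_ n x * psi x)%:E)%E @[n --> \oo] --> (\int[m]_(x in D) (g x * psi x)%:E)%E.
Proof.
move=> mg_ mg goo_ goo gc c0 cv.
have ig := integrable_mul_bounded mg goo.
have ig_ n := integrable_mul_bounded (mg_ n) (goo_ n).
have fin (f : T -> R) : m.-integrable D (EFin \o f) ->
    (\int[m]_(x in D) (f x)%:E)%E \is a fin_num by exact: integrable_fin_num.
rewrite -(fineK (fin _ ig)); apply: cvg_EFin; first by apply: nearW => n; exact: (fin _ (ig_ n)).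
pose K := B * (fine (m D) + 1).
have bnd n : `|fine (\int[m]_(x in D) (g x * psi x)%:E)%E -
    fine (\int[m]_(x in D) (g_ n x * psi x)%:E)%E| <= K * Num.sqrt (c n).
  have := integral_mul_bounded_le (measurable_funB mg (mg_ n)) (c0 n) (gc n).
  have -> : (\int[m]_(x in D) ((g \- g_ n) x * psi x)%:E =
      \int[m]_(x in D) (g x * psi x)%:E - \int[m]_(x in D) (g_ n x * psi x)%:E)%E.
    have := integralB mD ig (ig_ n).
    move=> /= <-; apply: eq_integral => x _ /=; rewrite -EFinD; congr EFin; ring.
  by rewrite -(fineK (fin _ ig)) -(fineK (fin _ (ig_ n))) -EFinD /= lee_fin.
have sv : K * Num.sqrt (c n) @[n --> \oo] --> 0.
  have -> : 0 = K * Num.sqrt 0 :> R by rewrite sqrtr0 mulr0.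
  apply: cvgMr; exact: (cvg_comp _ _ cv (@sqrt_continuous R 0)).
apply/cvgrPdist_le => e e0; have /cvgrPdist_le/(_ e e0) := sv.
apply: filterS => n; rewrite sub0r normrN => /(le_trans (ler_norm _)).
exact: le_trans (bnd n).
Qed.

End L2_pairing.

Section integration_by_parts.
Context {R : realType}.
Local Notation mu := (@lebesgue_measure R).
Local Notation P2 := (R^o * R^o)%type.

(** The product [w * phi] vanishes outside the box, so its partial derivatives have integral 0. All
    four integrands vanish outside the box as well. *)
Lemma integration_by_parts (w phi : P2 -> R^o) (M : R) : C1 w -> C1 phi ->
  (forall z, ~ box M z -> phi z = 0) ->
  (\int[@leb2 R]_(z in box M) (w z * d1 phi z)%:E = - \int[@leb2 R]_(z in box M) (d1 w z * phi z)%:E)%E /\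
  (\int[@leb2 R]_(z in box M) (w z * d2 phi z)%:E = - \int[@leb2 R]_(z in box M) (d2 w z * phi z)%:E)%E.
Proof.
move=> Cw Cp phi0; have [Hw Hp] := (C1P w, C1P phi).
have cw := C1_continuous Cw; have cp := C1_continuous Cp.
have [_ [cw1 cw2]] := Cw; have [_ [cp1 cp2]] := Cp.
have H := C1_gradM (Hw.1 Cw) (Hp.1 Cp).
have wphi0 z : ~ box M z -> w z * phi z = 0 by move=> bz; rewrite phi0// mulr0.
have [I1 I2] := integral_gradient_support H wphi0.
have gs := gradient_support phi0.
have main (a b : P2 -> R^o) : continuous a -> continuous b ->
    (forall z, ~ box M z -> a z = 0) -> (forall z, ~ box M z -> b z = 0) ->
    (\int[@leb2 R]_z (a z + b z)%:E = 0)%E ->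
    (\int[@leb2 R]_(z in box M) (a z)%:E = - \int[@leb2 R]_(z in box M) (b z)%:E)%E.
  move=> ca cb a0 b0.
  have ab0 z : ~ box M z -> (a z + b z)%:E = 0%E by move=> bz; rewrite a0// b0// addr0.
  rewrite -(integral_support (mu \x mu)%E ab0).
  have ia : (mu \x mu)%E.-integrable (box M) (EFin \o a) := integrable_box M ca.
  have ib : (mu \x mu)%E.-integrable (box M) (EFin \o b) := integrable_box M cb.
  have fa : (\int[mu \x mu]_(z in box M) (a z)%:E)%E \is a fin_num.
    by apply: integrable_fin_num => //; exact: measurable_box.
  have fb : (\int[mu \x mu]_(z in box M) (b z)%:E)%E \is a fin_num.
    by apply: integrable_fin_num => //; exact: measurable_box.
  have iD := @integralD _ _ R (mu \x mu)%E _ (measurable_box M) _ _ ia ib.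
  move=> ab; apply/eqP; rewrite -(fineK fb) -EFinN /leb2 -(fineK fa) eqe -addr_eq0 -eqe EFinD.
  by rewrite (fineK fa) (fineK fb); apply/eqP; exact: etrans (esym iD) ab.
have cM (a b : P2 -> R^o) : continuous a -> continuous b -> continuous (fun z => a z * b z : R^o).
  by move=> ca cb z; apply: continuousM; [exact: ca|exact: cb].
split.
- apply: (main _ _ (cM _ _ cw cp1) (cM _ _ cw1 cp) _ _ I1) => z bz.
  + by rewrite (gs z bz).1 mulr0.
  + by rewrite (phi0 z bz) mulr0.
- apply: (main _ _ (cM _ _ cw cp2) (cM _ _ cw2 cp) _ _ I2) => z bz.
  + by rewrite (gs z bz).2 mulr0.
  + by rewrite (phi0 z bz) mulr0.
Qed.

End integration_by_parts.

(** * The limit function, its weak gradient and its trace *)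

Section limit_function.
Context {R : realType}.
Local Notation mu := (@lebesgue_measure R).
Local Notation lam := (@lebesgue_measure R \x @lebesgue_measure R)%E.
Local Notation P2 := (R^o * R^o)%type.
Variables (d : R) (d0 : 0 < d) (f : P2 -> R) (fL : gp_L2loc d f).
Variables (w : nat -> P2 -> R^o).
Hypothesis nw : forall i, near_trace d f (8 ^+ i)^-1 (w i).
Hypothesis Ew : forall i, (energy (fun z => w i.+1 z - w i z)%R <= (8 * (8 ^+ i)^-1)%:E)%E.

Let wC i : C1 (w i). Proof. by case: (nw i). Qed.

Let cw i : continuous (w i). Proof. exact: C1_continuous. Qed.

Let v i : P2 -> R^o := fun z => w i.+1 z - w i z.

Let vC i : C1_grad (v i) (fun z => d1 (w i.+1) z - d1 (w i) z) (fun z => d2 (w i.+1) z - d2 (w i) z).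
Proof. by apply: C1_gradB; apply/C1P. Qed.

Let rate_gt0 i : 0 < (8 ^+ i)^-1 :> R. Proof. by rewrite invr_gt0 exprn_gt0. Qed.

(** Anchors the additive constant that the energy does not see: on the axis [y = 0] two successive
    competitors are both close to [f], so [f] cancels in their difference. *)
Let v_edge i j :
  (\int[mu]_(t in `[0%R, d]) ((v i (hpt d j 0 t)) ^+ 2)%:E <= (4 * (8 ^+ i)^-1)%:E)%E.
Proof.
have [_ _ /(_ j 0)[e1 _]] := nw i.+1; have [_ _ /(_ j 0)[e2 _]] := nw i.
have [mf _ _ _] := fL j 0.
have mw k : measurable_fun `[0%R, d] (fun t => w k (hpt d j 0 t)).
  exact: (measurable_funTS (measurableT_comp (continuous_measurable2 (@cw k)) (measurable_hpt d j 0))).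
have mI : measurable (`[0, d] : set R) by exact: measurable_itv.
have H := integral_sqrD_le mu mI (measurable_funB (mw i.+1) mf) (measurable_funB mf (mw i)).
apply: (@le_trans _ _ (\int[mu]_(t in `[0%R, d])
    ((w i.+1 (hpt d j 0 t) - f (hpt d j 0 t) + (f (hpt d j 0 t) - w i (hpt d j 0 t))) ^+ 2)%:E)%E).
  rewrite le_eqVlt; apply/orP; left; apply/eqP; apply: eq_integral => t _.
  by rewrite /v; congr (_ ^+ 2)%:E; ring.
apply: (le_trans H).
have -> : 4 * (8 ^+ i)^-1 = 2 * ((8 ^+ i)^-1 + (8 ^+ i)^-1) :> R by ring.
rewrite [leRHS]EFinM [X in (_ <= _ * X)%E]EFinD; apply: lee_wpmul2l => //; apply: leeD.
  apply: (le_trans e1); rewrite lee_fin lef_pV2 ?posrE ?exprn_gt0//.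
  by rewrite exprS ler_peMl ?exprn_ge0// ler1n.
apply: le_trans e2; rewrite le_eqVlt; apply/orP; left; apply/eqP; apply: eq_integral => t _.
by rewrite /= -sqrrN opprB.
Qed.

Let v_box_ge0 (M : R) : 0 <= M -> exists2 C, 0 <= C &
  forall i, (\int[@leb2 R]_(z in box M) ((w i.+1 z - w i z) ^+ 2)%:E <= (C * (8 ^+ i)^-1)%:E)%E.
Proof.
(* [p] edges on each side of the origin cover [[- M, M]] on the axis. *)
move=> M0; pose p := (Num.truncn (M / d)).+1.
have Mp : M <= p%:R * d by rewrite -ler_pdivrMr// ltW// truncnS_gt.
exists (4 * M * ((2 * p)%:R * 4) + 4 * M ^+ 2 * 8).
  by rewrite addr_ge0// !mulr_ge0// exprn_ge0.
move=> i; have Cv := C1_grad_C1 (vC i).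
have cv := C1_continuous Cv.
have cx : continuous (fun x : R => v i (x, 0)) by exact: continuous_section1.
have e0 : 0 <= 4 * (8 ^+ i)^-1 :> R by rewrite mulr_ge0// ltW.
have H (j : int) : (\int[mu]_(t in `[0%R, d]) ((v i (j%:~R * d + t, 0)) ^+ 2)%:E <= (4 * (8 ^+ i)^-1)%:E)%E.
  by have := v_edge i j; rewrite /hpt mul0r.
have ax : (\int[mu]_(x in `[(- M)%R, M]) (v i (x, 0) ^+ 2)%:E <= ((2 * p)%:R * (4 * (8 ^+ i)^-1))%:E)%E.
  have := integral_chain_le (- p%:Z) (2 * p) d0 e0 cx H.
  apply: le_trans; apply: ge0_subset_integral => //.
  - apply/measurable_EFinP/measurable_funX/measurable_funTS; exact: continuous_measurable_fun.
  - by move=> x _; rewrite lee_fin sqr_ge0.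
  - move=> x /=; rewrite !in_itv/= intrN natrM => /andP[h1 h2].
    by rewrite -pmulrn; apply/andP; split; lra.
apply: (le_trans (poincare_box M0 Cv ax (Ew i))).
by rewrite lee_fin le_eqVlt; apply/orP; left; apply/eqP; ring.
Qed.

Let v_box (M : R) : exists2 C, 0 <= C &
  forall i, (\int[@leb2 R]_(z in box M) ((w i.+1 z - w i z) ^+ 2)%:E <= (C * (8 ^+ i)^-1)%:E)%E.
Proof.
have [C C0 H] := v_box_ge0 (normr_ge0 M); exists C => // i; apply: le_trans (H i).
have mv : measurable_fun [set: R * R] (fun z => ((w i.+1 z - w i z) ^+ 2)%:E).
  apply/measurable_EFinP/measurable_funX/measurable_funB; exact: continuous_measurable2.
apply: (@ge0_subset_integral _ _ _ lam).
- exact: measurable_box.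
- exact: measurable_box.
- exact: (measurable_funTS mv).
- by move=> z _; rewrite lee_fin sqr_ge0.
- have Mn := ler_norm M.
  by move=> z [/= h1 h2]; split => /=; move: h1 h2; rewrite !in_itv/= => /andP[? ?] /andP[? ?];
    apply/andP; split; lra.
Qed.

Let v_grad i : (\int[@leb2 R]_z ((d1 (w i.+1) z - d1 (w i) z) ^+ 2)%:E <= (8 * (8 ^+ i)^-1)%:E)%E /\
  (\int[@leb2 R]_z ((d2 (w i.+1) z - d2 (w i) z) ^+ 2)%:E <= (8 * (8 ^+ i)^-1)%:E)%E.
Proof.
have [_ E1 E2 _ _] := vC i; have Cv := C1_grad_C1 (vC i).
have m1 := measurable_d1 Cv; have m2 := measurable_d2 Cv.
split; apply: le_trans (Ew i); rewrite energyE; apply: (@ge0_le_integral _ _ _ lam) => //.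
- by move=> z _; rewrite lee_fin sqr_ge0.
- by apply/measurable_EFinP/measurable_funX; rewrite -E1.
- exact: measurable_energy_density.
- by move=> z _; rewrite /energy_density E1 E2 lee_fin lerDl sqr_ge0.
- by move=> z _; rewrite lee_fin sqr_ge0.
- by apply/measurable_EFinP/measurable_funX; rewrite -E2.
- exact: measurable_energy_density.
- by move=> z _; rewrite /energy_density E1 E2 lee_fin lerDr sqr_ge0.
Qed.

Let limits : exists F G1 G2 : P2 -> R,
  [/\ measurable_fun [set: R * R] F, measurable_fun [set: R * R] G1, measurable_fun [set: R * R] G2,
   (forall M, exists2 C, 0 < C &
      forall n, (\int[lam]_(z in box M) ((F z - w n z) ^+ 2)%:E <= (C * (2 ^+ n)^-1)%:E)%E) &
   exists2 C, 0 < C & forall n, (\int[lam]_z ((G1 z - d1 (w n) z) ^+ 2)%:E <= (C * (2 ^+ n)^-1)%:E)%E /\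
      (\int[lam]_z ((G2 z - d2 (w n) z) ^+ 2)%:E <= (C * (2 ^+ n)^-1)%:E)%E].
Proof.
have [F [mF HF]] := fast_Cauchy_limit lam (fun n => continuous_measurable2 (@cw n)).
have [G1 [mG1 HG1]] := fast_Cauchy_limit lam (fun n => measurable_d1 (wC n)).
have [G2 [mG2 HG2]] := fast_Cauchy_limit lam (fun n => measurable_d2 (wC n)).
exists F, G1, G2; split => //.
  (* The added 1 makes the constant positive, as convergence of the pairings requires. *)
  move=> M; have [C C0 HC] := v_box M; exists (4 * C + 1); first by rewrite ltr_wpDl// mulr_ge0.
  move=> n; apply: (le_trans (HF (box M) C (measurable_box M) C0 HC n)).
  by rewrite lee_fin ler_wpM2r ?invr_ge0 ?exprn_ge0// lerDl.
have c8 : 0 <= 8 :> R by [].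
exists (4 * 8) => // n; split.
- exact: (HG1 setT 8 measurableT c8 (fun i => (v_grad i).1) n).
- exact: (HG2 setT 8 measurableT c8 (fun i => (v_grad i).2) n).
Qed.

Let rate_cvg (C : R) : C * (2 ^+ n)^-1 @[n --> \oo] --> 0.
Proof.
have h : (2^-1 ^+ n : R) @[n --> \oo] --> 0.
  by apply: cvg_expr; rewrite ger0_norm ?invr_ge0// invf_lt1// ltr1n.
have -> : 0 = C * 0 :> R by rewrite mulr0.
have -> : (fun n => C * (2 ^+ n)^-1) = (fun n => C * (2^-1 ^+ n)).
  by apply/funext => n; rewrite exprVn.
exact: cvgMr.
Qed.

Let sqr_int_lty (D : set (R * R)) (g h : R * R -> R) (c : R) : measurable D ->
  measurable_fun [set: R * R] g -> measurable_fun [set: R * R] h ->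
  (\int[lam]_(z in D) ((g z - h z) ^+ 2)%:E <= c%:E)%E ->
  (\int[lam]_(z in D) (h z ^+ 2)%:E < +oo)%E -> (\int[lam]_(z in D) (g z ^+ 2)%:E < +oo)%E.
Proof.
move=> mD mg mh gh hoo.
have H := integral_sqrD_le lam mD (measurable_funTS (measurable_funB mg mh)) (measurable_funTS mh).
apply: (@le_lt_trans _ _ (\int[lam]_(z in D) ((g z - h z + h z) ^+ 2)%:E)%E).
  by rewrite le_eqVlt; apply/orP; left; apply/eqP; apply: eq_integral => z _; rewrite subrK.
apply: (le_lt_trans H); apply: lte_mul_pinfty => //; apply: lte_add_pinfty => //.
exact: le_lt_trans gh (ltry c).
Qed.

Let w_box_lty n M : (\int[lam]_(z in box M) (w n z ^+ 2)%:E < +oo)%E.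
Proof.
have cw2 : continuous (fun z => w n z ^+ 2 : R^o) by move=> z; apply: continuousM; exact: cw.
have /integrableP[_] := integrable_box M cw2; apply: le_lt_trans.
rewrite le_eqVlt; apply/orP; left; apply/eqP; apply: eq_integral => z _.
by rewrite /= ger0_norm// sqr_ge0.
Qed.

Let grad_lty n : (\int[lam]_z (d1 (w n) z ^+ 2)%:E < +oo)%E /\
  (\int[lam]_z (d2 (w n) z ^+ 2)%:E < +oo)%E.
Proof.
have [_ + _] := nw n; rewrite energyE => E.
have m1 := measurable_d1 (wC n); have m2 := measurable_d2 (wC n).
split; apply: le_lt_trans E; apply: (@ge0_le_integral _ _ _ lam) => //.
- by move=> z _; rewrite lee_fin sqr_ge0.
- exact/measurable_EFinP/measurable_funX.
- exact: measurable_energy_density.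
- by move=> z _; rewrite /energy_density lee_fin lerDl sqr_ge0.
- by move=> z _; rewrite lee_fin sqr_ge0.
- exact/measurable_EFinP/measurable_funX.
- exact: measurable_energy_density.
- by move=> z _; rewrite /energy_density lee_fin lerDr sqr_ge0.
Qed.

(** Integration by parts holds for every [w n]; inside the support both sides are pairings of
    L^2-convergent sequences with bounded functions, hence pass to the limit. *)
Let weak_limit (F G : P2 -> R) (g : nat -> P2 -> R^o) (phi psi : P2 -> R^o) (M C C' : R) :
  measurable_fun [set: R * R] F -> measurable_fun [set: R * R] G ->
  (forall n, measurable_fun [set: R * R] (g n)) ->
  (forall n, \int[lam]_z (g n z ^+ 2)%:E < +oo)%E ->
  0 < C -> (forall n, \int[lam]_(z in box M) ((F z - w n z) ^+ 2)%:E <= (C * (2 ^+ n)^-1)%:E)%E ->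
  0 < C' -> (forall n, \int[lam]_z ((G z - g n z) ^+ 2)%:E <= (C' * (2 ^+ n)^-1)%:E)%E ->
  continuous phi -> continuous psi ->
  (forall z, ~ box M z -> phi z = 0) -> (forall z, ~ box M z -> psi z = 0) ->
  (forall n, \int[lam]_(z in box M) (w n z * psi z)%:E = - \int[lam]_(z in box M) (g n z * phi z)%:E)%E ->
  (\int[lam]_z (F z * psi z)%:E = - \int[lam]_z (G z * phi z)%:E)%E.
Proof.
move=> mF mG mg goo C0 FC C'0 GC cphi cpsi phi0 psi0 parts.
have mB := @measurable_box R M.
have le_box (h : R * R -> R) : measurable_fun [set: R * R] h ->
    (\int[lam]_(z in box M) (h z ^+ 2)%:E <= \int[lam]_z (h z ^+ 2)%:E)%E.
  move=> mh; apply: (@ge0_subset_integral _ _ _ lam) => //.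
  - exact/measurable_EFinP/measurable_funX.
  - by move=> z _; rewrite lee_fin sqr_ge0.
have Boo : (lam (box M) < +oo)%E by exact: leb2_box_lty.
have rate0 c n : 0 < c -> 0 < c * (2 ^+ n)^-1 :> R.
  by move=> c0; rewrite mulr_gt0// invr_gt0 exprn_gt0.
have [B B0 HB] := continuous_bounded_box M cphi.
have [B' B'0 HB'] := continuous_bounded_box M cpsi.
have mw n : measurable_fun [set: R * R] (w n) by exact: continuous_measurable2.
have L1 := @L2_pairing_cvg R _ _ lam (box M) psi B' mB Boo
  (measurable_funTS (continuous_measurable2 cpsi)) B'0 HB' w F (fun n => C * (2 ^+ n)^-1)
  (fun n => measurable_funTS (mw n)) (measurable_funTS mF) (fun n => w_box_lty n M)
  (sqr_int_lty mB mF (mw 0%N) (FC 0%N) (w_box_lty 0%N M)) FC (fun n => rate0 C n C0) (rate_cvg C).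
have gC n : (\int[lam]_(z in box M) ((G z - g n z) ^+ 2)%:E <= (C' * (2 ^+ n)^-1)%:E)%E.
  by apply: le_trans (GC n); apply: le_box; exact: measurable_funB.
have goo' n : (\int[lam]_(z in box M) (g n z ^+ 2)%:E < +oo)%E.
  exact: le_lt_trans (le_box _ (mg n)) (goo n).
have L2 := @L2_pairing_cvg R _ _ lam (box M) phi B mB Boo
  (measurable_funTS (continuous_measurable2 cphi)) B0 HB g G (fun n => C' * (2 ^+ n)^-1)
  (fun n => measurable_funTS (mg n)) (measurable_funTS mG) goo'
  (sqr_int_lty mB mG (mg 0%N) (gC 0%N) (goo' 0%N)) gC (fun n => rate0 C' n C'0) (rate_cvg C').
have L3 : (- \int[lam]_(z in box M) (g n z * phi z)%:E)%E @[n --> \oo] -->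
    (- \int[lam]_(z in box M) (G z * phi z)%:E)%E by exact: cvgeN L2.
have Fpsi0 z : ~ box M z -> (F z * psi z)%:E = 0%E by move=> bz; rewrite psi0// mulr0.
have Gphi0 z : ~ box M z -> (G z * phi z)%:E = 0%E by move=> bz; rewrite phi0// mulr0.
rewrite -(integral_support lam Fpsi0) -(integral_support lam Gphi0).
rewrite (funext parts) in L1.
exact: (cvg_unique (@ereal_hausdorff R) L1 L3).
Qed.

(** The sequence [w] itself provides the [C^1] functions in the definition of trace: its convergence
    on the edges is part of [near_trace]. *)
Lemma trace_limit : exists F G1 G2 : P2 -> R, H1 F G1 G2 /\ is_trace d F G1 G2 f.
Proof.
have [F [G1 [G2 [mF mG1 mG2 HF [C' C'0 HG]]]]] := limits.
exists F, G1, G2.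
have mw n : measurable_fun [set: R * R] (w n) by exact: continuous_measurable2.
have g1 n := (grad_lty n).1; have g2 n := (grad_lty n).2.
have m1 n := measurable_d1 (wC n); have m2 n := measurable_d2 (wC n).
split.
  split=> //.
  - move=> M; have [C C0 HC] := HF M; have mB := @measurable_box R M.
    exact: (@sqr_integrable _ _ _ lam _ _ mB (leb2_box_lty M) (measurable_funTS mF)
      (sqr_int_lty mB mF (mw 0%N) (HC 0%N) (w_box_lty 0%N M))).
  - split.
    + exact: (sqr_int_lty measurableT mG1 (m1 0%N) (HG 0%N).1 (g1 0%N)).
    + exact: (sqr_int_lty measurableT mG2 (m2 0%N) (HG 0%N).2 (g2 0%N)).
  - move=> phi [Cp [M phi0]]; have [C C0 HC] := HF M.
    have cp := C1_continuous Cp; have [_ [cp1 cp2]] := Cp.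
    have gs := gradient_support phi0.
    split.
    + exact: (weak_limit mF mG1 m1 g1 C0 HC C'0 (fun n => (HG n).1) cp cp1 phi0
        (fun z bz => (gs z bz).1) (fun n => (integration_by_parts (wC n) Cp phi0).1)).
    + exact: (weak_limit mF mG2 m2 g2 C0 HC C'0 (fun n => (HG n).2) cp cp2 phi0
        (fun z bz => (gs z bz).2) (fun n => (integration_by_parts (wC n) Cp phi0).2)).
split=> //; exists w.
have cvg_rate (x : nat -> \bar R) (C : R) : (forall n, 0 <= x n)%E ->
    (forall n, x n <= (C * (2 ^+ n)^-1)%:E)%E -> x n @[n --> \oo] --> 0%E.
  by move=> x0 xC; apply: cvg0_squeeze x0 xC _; apply: cvg_EFin; [exact: nearW|exact: rate_cvg].
split=> //.
- move=> M; have [C C0 HC] := HF M; apply: (cvg_rate _ C) => n.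
    by apply: integral_ge0 => z _; rewrite lee_fin sqr_ge0.
  apply: le_trans (HC n); rewrite le_eqVlt; apply/orP; left; apply/eqP; apply: eq_integral => z _.
  by rewrite -sqrrN opprB.
- apply: (cvg_rate _ (C' + C')) => n.
    by apply: integral_ge0 => z _; rewrite lee_fin addr_ge0 ?sqr_ge0.
  rewrite mulrDl EFinD; have [h1 h2] := HG n; apply: le_trans (leeD h1 h2).
  have e0 (g : P2 -> R) z : [set: R * R] z -> (0 <= (g z ^+ 2)%:E)%E by rewrite lee_fin sqr_ge0.
  have me (g h : P2 -> R) : measurable_fun [set: R * R] g -> measurable_fun [set: R * R] h ->
      measurable_fun [set: R * R] (fun z => ((g z - h z) ^+ 2)%:E).
    by move=> mg mh; apply/measurable_EFinP/measurable_funX/measurable_funB.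
  have D := ge0_integralD lam measurableT (e0 (fun z => G1 z - d1 (w n) z)) (me _ _ mG1 (m1 n))
    (e0 (fun z => G2 z - d2 (w n) z)) (me _ _ mG2 (m2 n)).
  rewrite le_eqVlt; apply/orP; left; apply/eqP; apply: etrans D; apply: eq_integral => z _.
  by rewrite -sqrrN opprB -[X in _ + X]sqrrN opprB EFinD.
- have r2 n : (8 ^+ n)^-1 <= 1 * (2 ^+ n)^-1 :> R.
    by rewrite mul1r lef_pV2 ?posrE ?exprn_gt0// lerXn2r// ?nnegrE// ler_nat.
  move=> j k; split; apply: (cvg_rate _ 1) => n;
    try by apply: integral_ge0 => t _; rewrite lee_fin sqr_ge0.
  + by have [_ _ /(_ j k)[e1 _]] := nw n; apply: (le_trans e1); rewrite lee_fin.
  + by have [_ _ /(_ j k)[_ e2]] := nw n; apply: (le_trans e2); rewrite lee_fin.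
Qed.

End limit_function.

Section existence.
Context {R : realType}.
Local Notation P2 := (R^o * R^o)%type.

Lemma trace_of_H12 (d : R) (f : P2 -> R) : 0 < d -> H12 d f ->
  exists F G1 G2 : P2 -> R, H1 F G1 G2 /\ is_trace d F G1 G2 f.
Proof.
move=> d0 [fL norm_fin]; have [C HC] := approximate_extension d0 fL norm_fin.
have approx (e : R) : 0 < e -> exists2 u, near_trace d f e u & (energy u <= C%:E)%E.
  (* The error on the edges is at most [C / (K + 1)], so this mesh meets the tolerance [e], with an
     energy bound that does not depend on [e]. *)
  move=> e0; pose K := (Num.truncn (C / e)).+1.
  have KC : C / K.+1%:R <= e.
    rewrite ler_pdivrMr// mulrC -ler_pdivrMr//; apply: (le_trans (ltW (truncnS_gt (C / e)))).
    by rewrite ler_nat.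
  have [u [Cu Eu eu]] := HC K (ltn0Sn _); exists u; last by rewrite energyE.
  split=> //; first by rewrite energyE; exact: le_lt_trans Eu (ltry C).
  by move=> j k; have [e1 e2] := eu j k; split;
    [apply: (le_trans e1)|apply: (le_trans e2)]; rewrite lee_fin.
have [w [nw Ew]] := minimizing_sequence fL approx.
exact: (trace_limit d0 fL nw Ew).
Qed.

End existence.

Local Close Scope classical_set_scope.

(* For delta > 0: a function f on gp_delta is the trace of some F in
   H^1(R^2) if and only if f belongs to H^{1/2}(gp_delta). *)
Theorem theorem3p5 (R : realType) (delta : R) (hdelta : 0 < delta)
    (f : R^o * R^o -> R) :
  (exists F G1 G2 : R^o * R^o -> R, H1 F G1 G2 /\ is_trace delta F G1 G2 f)
  <-> H12 delta f.
Proof.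
split; last exact: trace_of_H12.
move=> [F [G1 [G2 [HF [fL [Fn [Fn1 _ eps0 edges]]]]]]].
exact: (H12_of_trace hdelta HF fL Fn1 eps0 edges).
Qed.
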